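(* Assume $t\leq n$. As a representation of $O(U)\times\mathrm{Sp}(V)$, $$\mu_{U\otimes V}\;\simeq\;\bigoplus_{r\in R(U)}\ \bigoplus_{\tau\in\mathrm{Irr}\,O(U_r)}\ \mathrm{Ind}_{O_r}^{O(U)}(\tau)\otimes\eta(\tau),$$ and all the irreducible $\mathrm{Sp}(V)$-representations $\eta(\tau)$ appearing in this decomposition (for $r\in R(U)$, $\tau\in\mathrm{Irr}\,O(U_r)$) are pairwise inequivalent.
   Context: Notation. $q$ is a power of an odd prime $p$. For $\lambda\in\mathbb{F}_q^\times$, $\ell_\lambda=+1$ if $\lambda$ is a square and $-1$ otherwise. $\omega(\lambda)=\exp\big(\tfrac{2\pi i}{p}\mathrm{Tr}(\lambda)\big)$ with $\mathrm{Tr}:\mathbb{F}_q\to\mathbb{F}_p$ the field trace. For a finite set $S$, $L^2(S)$ is the Hilbert space of complex functions on $S$, and $\delta_s$ is the indicator function of $s\in S$. The transpose of a linear map $A$ is $A^t$. A map $A:Y^*\to Y$ is symmetric if $A=A^t$; one writes $A(y,y')=y'(Ay)$. Oscillator representation. For a finite-dimensional $\mathbb{F}_q$-space $Y$, $Y\oplus Y^*$ carries the symplectic form $[x\oplus y,x'\oplus y']=y'(x)-y(x')$. The oscillator representation $\mu_{Y\oplus Y^*}$ of $\mathrm{Sp}(Y\oplus Y^* )$ on $L^2(Y^* )$ is the representation determined on generators by $\mu(N_A)\delta_y=\omega(2^{-1}A(y,y))\,\delta_y$, $\ \mu(D_C)\delta_y=\ell_{\det C}\,\delta_{C^{-t}y}$,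 $\ \mu(J_B)\delta_y=\gamma(B)^{-1}\sum_{y'\in Y^*}\omega(B(y,y'))\,\delta_{y'}$, where $N_A=\begin{pmatrix}1&A\\0&1\end{pmatrix}$ ($A:Y^*\to Y$ symmetric), $D_C=\begin{pmatrix}C&0\\0&C^{-t}\end{pmatrix}$ ($C\in GL(Y)$), $J_B=\begin{pmatrix}0&B\\-B^{-1}&0\end{pmatrix}$ ($B:Y^*\to Y$ symmetric invertible), and $\gamma(B)=\sum_{y\in Y^*}\omega(-2^{-1}B(y,y))$. Setting. $X$ is an $n$-dimensional $\mathbb{F}_q$-space and $V=X\oplus X^*$. $U$ is a $t$-dimensional $\mathbb{F}_q$-space with a non-degenerate symmetric bilinear form $\beta$ (an orthogonal space). Then $U\otimes V=(U\otimes X)\oplus(U\otimes X^* )$ is symplectic, the two summands being dual via $\langle u\otimes x,v\otimes y\rangle=\beta(u,v)y(x)$; identifying $U\otimes X^*=\mathrm{Hom}(X\to U)$, $\mu_{U\otimes V}$ acts on $L^2(\mathrm{Hom}(X\to U))$. It is regarded as a representation of $O(U)\times\mathrm{Sp}(V)$ via $(g,S)\mapsto g\otimes S\in\mathrm{Sp}(U\otimes V)$. If $U=0$, it is the one-dimensional trivial representation. Rank. For a (nonzero) representation $\pi$ of $\mathrm{Sp}(V)$, its restriction to the abelian group $\{N_A\mid A:X^*\to X\text{ symmetric}\}$ decomposes into characters $N_A\mapsto\omega(\mathrm{tr}\,AB)$ with $B:X\to X^*$ symmetric. The rank of $\pi$ is the maximal rank of the $B$'s that occur. The map $\eta$. For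 an orthogonal space $U'$ with $r=\dim U'\leq n$ one has $\mu_{U'\otimes V}\cong\bigoplus_{\tau\in\mathrm{Irr}(O(U'))}\tau\otimes\Theta(\tau)$ as an $O(U')\times\mathrm{Sp}(V)$-representation. It is a known theorem of Gurevich and Howe that $\Theta(\tau)$ contains a unique irreducible $\mathrm{Sp}(V)$-subrepresentation $\eta(\tau)$ of rank $r$, and that $\tau\mapsto\eta(\tau)$ is injective. The data $R(U),U_r,O_r$. A subspace $N\subset U$ is isotropic if $N\subset N^\perp$. $R(U)=\{t-2k\mid \text{there is an isotropic } N\subset U\text{ with }\dim N=k\}$. For each $r=t-2k\in R(U)$ fix some isotropic $N\subset U$ with $\dim N=k$, let $U_r=N^\perp/N$ with the form induced by $\beta$ (a non-degenerate orthogonal space of dimension $r$), and let $O_r\subset O(U)$ be the (setwise) stabilizer of $N$. $O_r$ acts on $U_r$, giving a surjective homomorphism $O_r\to O(U_r)$, via which every $\tau\in\mathrm{Irr}\,O(U_r)$ is regarded as a representation of $O_r$. *)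

(* Defs.v *)
From HB Require Import structures.
From mathcomp Require Import all_boot all_order all_fingroup all_algebra.
From mathcomp Require Import all_solvable all_field all_character.

Set Implicit Arguments.
Unset Strict Implicit.
Unset Printing Implicit Defensive.

Import Order.TTheory GRing.Theory Num.Theory.
Local Open Scope group_scope.
Local Open Scope ring_scope.

(* Conventions.  Vector spaces over F are coordinate spaces 'cV[F]_m, a linear
   map is a matrix acting on columns on the left, and the dual of 'cV[F]_m is
   'cV[F]_m again, y being the functional x |-> y^T *m x.  Subspaces are row
   spaces of matrices (scope %MS), i.e., their vectors are written transposed.
   Complex representations are matrix representations over algC. *)

(* The library's 'GL_m[F] consists of matrices of size m.-1.+1; the type below
   is also correct for m = 0. *)
Record GLmx (F : finFieldType) (m : nat) :=
  GLMx { gl_mx :> 'M[F]_m; gl_unitmx : gl_mx \in unitmx }.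

HB.instance Definition _ F m := [isSub for @gl_mx F m].
HB.instance Definition _ F m := [Finite of GLmx F m by <:].

Section GeneralLinear.

Variables (F : finFieldType) (m : nat).
Implicit Types g h : GLmx F m.

Fact glone_unit : (1%:M : 'M[F]_m) \in unitmx. Proof. exact: unitmx1. Qed.
Definition glone := GLMx glone_unit.

Fact glmul_unit g h : g *m h \in unitmx.
Proof. by rewrite unitmx_mul !gl_unitmx. Qed.
Definition glmul g h := GLMx (glmul_unit g h).

Fact glinv_unit g : invmx g \in unitmx.
Proof. by rewrite unitmx_inv gl_unitmx. Qed.
Definition glinv g := GLMx (glinv_unit g).

Fact glmulA : associative glmul.
Proof. by move=> g h k; apply: val_inj; rewrite /= mulmxA. Qed.
Fact glmul1 : left_id glone glmul.
Proof. by move=> g; apply: val_inj; rewrite /= mul1mx. Qed.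
Fact glmulV : left_inverse glone glinv glmul.
Proof. by move=> g; apply: val_inj; rewrite /= mulVmx ?gl_unitmx. Qed.

HB.instance Definition _ :=
  Finite_isGroup.Build (GLmx F m) glmulA glmul1 glmulV.

Lemma gl_mxM g h : (g * h)%g = g *m h :> 'M_m. Proof. by []. Qed.
Lemma gl_mx1 : (1%g : GLmx F m) = 1%:M :> 'M_m. Proof. by []. Qed.

End GeneralLinear.

Section Isometries.

Variables (F : finFieldType) (m : nat) (J : 'M[F]_m).

Definition isometries := [set g : GLmx F m | g^T *m J *m g == J].

Fact group_set_isometries : group_set isometries.
Proof.
apply/group_setP; split=> [|g h]; first by rewrite inE trmx1 mul1mx mulmx1.
rewrite !inE gl_mxM trmx_mul => /eqP gJ /eqP hJ; apply/eqP.
by rewrite -[RHS]hJ -[in RHS]gJ !mulmxA.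
Qed.
Canonical isometries_group := Group group_set_isometries.

End Isometries.

(* Matrix of [x (+) y, x' (+) y'] = y'(x) - y(x'). *)
Definition symp_mx (F : finFieldType) m : 'M[F]_(m + m) :=
  block_mx 0 1%:M (- 1%:M) 0.

Definition Sp (F : finFieldType) m : {group GLmx F (m + m)} :=
  isometries_group (symp_mx F m).

Record orthoSpace (F : finFieldType) (t : nat) := OrthoSpace {
  gram :> 'M[F]_t;
  gram_sym : gram^T = gram;
  gram_unitmx : gram \in unitmx }.

Definition Ogrp (F : finFieldType) t (U : orthoSpace F t) :
  {group GLmx F t} := isometries_group U.

Section Generators.

Variables (F : finFieldType) (m : nat).

Fact mx_N_unit (A : 'M[F]_m) : block_mx 1%:M A 0 1%:M \in unitmx.
Proof. by rewrite unitmxE det_ublock !det1 mulr1 unitr1. Qed.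
Definition gen_N A := GLMx (mx_N_unit A).

Fact mx_D_unit (C : GLmx F m) : block_mx C 0 0 (invmx C)^T \in unitmx.
Proof.
by rewrite unitmxE det_ublock det_tr unitrM -!unitmxE unitmx_inv !gl_unitmx.
Qed.
Definition gen_D C := GLMx (mx_D_unit C).

Fact mx_J_unit (B : GLmx F m) : block_mx 0 B (- invmx B) 0 \in unitmx.
Proof.
apply: (proj1 (mulmx1_unit (_ : _ *m block_mx 0 (- (B : 'M_m)) (invmx B) 0 = _))).
by rewrite mulmx_block !mul0mx !mulmx0 !add0r !addr0 mulNmx mulmxN opprK
  mulmxV ?mulVmx ?gl_unitmx // -scalar_mx_block.
Qed.
Definition gen_J B := GLMx (mx_J_unit B).

End Generators.

Section Oscillator.

Variables (F : finFieldType) (p : nat) (pcharFp : p \in [pchar F]).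

(* The trace of F over its prime field; pPrimeCharType is F seen as an
   extension of 'F_p, and the pick inverts the embedding of 'F_p into F. *)
Definition Ftrace (x : F) : 'F_p :=
  odflt 0 [pick c : 'F_p |
    c%:A == galTrace 1%VS {:pPrimeCharType pcharFp} x].

(* p.-root (-1) is the p-th root of -1 of least argument, namely e^(pi i / p),
   so its square is e^(2 pi i / p). *)
Definition omega (x : F) : algC := ((p.-root (-1)) ^+ 2) ^+ Ftrace x.

Definition ell (x : F) : algC := if [exists y, x == y ^+ 2] then 1 else -1.

(* A(y, y') = y'(A y) for A : Y* -> Y *)
Definition bil m (A : 'M[F]_m) (y y' : 'cV[F]_m) : F := (y'^T *m A *m y) 0 0.

Definition gaussB m (B : 'M[F]_m) : algC :=
  \sum_(y : 'cV[F]_m) omega (- 2^-1 * bil B y y).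

(* L^2 of the dual of Y consists of columns indexed by enum 'cV[F]_m. *)
Definition delta m (y : 'cV[F]_m) : 'cV[algC]_#|{: 'cV[F]_m}| :=
  delta_mx (enum_rank y) 0.

Record oscillator m (mu : mx_representation algC (Sp F m) #|{: 'cV[F]_m}|) :
    Prop := Oscillator {
  osc_N : forall (A : 'M[F]_m) y, A^T = A ->
    mu (gen_N A) *m delta y = omega (2^-1 * bil A y y) *: delta y;
  osc_D : forall (C : GLmx F m) y,
    mu (gen_D C) *m delta y = ell (\det C) *: delta ((invmx C)^T *m y);
  osc_J : forall (B : GLmx F m) y, B^T = B ->
    mu (gen_J B) *m delta y =
      (gaussB B)^-1 *: \sum_(y' : 'cV[F]_m) omega (bil B y y') *: delta y' }.

(* The character N_A |-> omega (tr AB) occurs in rG when the operators N_A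
   have a nonzero common eigenvector for it. *)
Definition occurs n d (rG : mx_representation algC (Sp F n) d) (B : 'M[F]_n) :=
  (\bigcap_(A : 'M[F]_n | A^T == A)
     eigenspace (rG (gen_N A)) (omega (\tr (A *m B))))%MS != 0.

Definition rep_rank n d (rG : mx_representation algC (Sp F n) d) : nat :=
  \max_(B : 'M[F]_n | (B^T == B) && occurs rG B) \rank B.

End Oscillator.

Section TensorProduct.

Variable F : fieldType.

Lemma tprod_tr m1 n1 (A : 'M[F]_(m1, 1 + n1)) m2 n2 (B : 'M[F]_(m2, n2)) :
  tprod A B = row_mx (trow (lsubmx A)^T B^T)^T (tprod (rsubmx A) B).
Proof.
elim: m1 n1 A m2 n2 B => [|m1 IH] n1 A m2 n2 B //=.
  by rewrite trmx0 row_mx0.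
rewrite !IH; pose A1 := A : 'M_(1 + m1, 1 + n1).
have F1 : dsubmx (rsubmx A1) = rsubmx (dsubmx A1).
  by apply/matrixP=> i j; rewrite !mxE.
have F2 : rsubmx (usubmx A1) = usubmx (rsubmx A1).
  by apply/matrixP=> i j; rewrite !mxE.
have F3 : lsubmx (dsubmx A1) = dsubmx (lsubmx A1).
  by apply/matrixP=> i j; rewrite !mxE.
rewrite tr_row_mx -block_mxEv -block_mxEh !(F1, F2, F3); congr block_mx.
- by rewrite !mxE linearZ /= trmxK.
by rewrite -trmx_dsub.
Qed.

Lemma trmx_tprod m1 n1 (A : 'M[F]_(m1, n1)) m2 n2 (B : 'M[F]_(m2, n2)) :
  (tprod A B)^T = tprod A^T B^T.
Proof.
elim: m1 n1 A => [|m1 IH] n1 A; first by apply/matrixP => ? [].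
rewrite tprod_tr /= tr_col_mx IH trmxK; congr (row_mx (trow _ _)^T (tprod _ _)).
  by rewrite -trmx_usub trmxK.
by rewrite -trmx_dsub.
Qed.

Lemma tprodDr m1 n1 (A : 'M[F]_(m1, n1)) m2 n2 (B C : 'M[F]_(m2, n2)) :
  tprod A (B + C) = tprod A B + tprod A C.
Proof.
elim: m1 n1 A => [|m1 IH] n1 A /=; first by rewrite addr0.
by rewrite linearD IH add_col_mx.
Qed.

Lemma tprod0r m1 n1 (A : 'M[F]_(m1, n1)) m2 n2 :
  tprod A (0 : 'M[F]_(m2, n2)) = 0.
Proof. by apply: (addrI (tprod A 0)); rewrite -tprodDr !addr0. Qed.

Lemma tprodNr m1 n1 (A : 'M[F]_(m1, n1)) m2 n2 (B : 'M[F]_(m2, n2)) :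
  tprod A (- B) = - tprod A B.
Proof. by apply: (addrI (tprod A B)); rewrite -tprodDr !subrr tprod0r. Qed.

End TensorProduct.

Section DualPair.

Variables (F : finFieldType) (t : nat) (U : orthoSpace F t) (n : nat).

(* With X' the dual of X, U (x) V is the sum of U (x) X and U (x) X', both with
   coordinates in 'cV_(t * n) (tprod is the Kronecker product).  The element
   v (x) y of U (x) X' is the functional u (x) x |-> beta(u, v) y(x) on U (x) X,
   whose coordinates in the dual of 'cV_(t * n) are (U *m v) (x) y; hence g (x) S
   is conjugated by the identification dual_id of U (x) X' with that dual. *)
Definition dual_id : 'M[F]_(t * n + t * n) :=
  block_mx 1%:M 0 0 (tprod U 1%:M).

Definition tensor_op (g : 'M[F]_t) (S : 'M[F]_(n + n)) :
    'M[F]_(t * n + t * n) :=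
  block_mx (tprod g (ulsubmx S)) (tprod g (ursubmx S))
           (tprod g (dlsubmx S)) (tprod g (drsubmx S)).

Definition dual_pair_mx g S := dual_id *m tensor_op g S *m invmx dual_id.

Lemma dual_id_unit : dual_id \in unitmx.
Proof.
rewrite unitmxE det_ublock det1 mul1r -unitmxE.
apply: (proj1 (mulmx1_unit (_ : _ *m tprod (invmx U) 1%:M = _))).
by rewrite -tprodE mulmxV ?gram_unitmx // mul1mx tprod1.
Qed.

Lemma tensor_opM g h S T :
  tensor_op (g *m h) (S *m T) = tensor_op g S *m tensor_op h T.
Proof.
rewrite /tensor_op -{1 2 3 4}[S]submxK -{1 2 3 4}[T]submxK !mulmx_block.
by rewrite block_mxKul block_mxKur block_mxKdl block_mxKdr !tprodDr !tprodE.
Qed.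

Lemma tensor_op1 : tensor_op 1%:M 1%:M = 1%:M.
Proof.
rewrite /tensor_op (scalar_mx_block n n 1) block_mxKul block_mxKur.
by rewrite block_mxKdl block_mxKdr tprod0r !tprod1 -scalar_mx_block.
Qed.

Lemma dual_pairM g h S T :
  dual_pair_mx (g *m h) (S *m T) = dual_pair_mx g S *m dual_pair_mx h T.
Proof. by rewrite /dual_pair_mx tensor_opM !mulmxA mulmxKV ?dual_id_unit. Qed.

Lemma dual_pair1 : dual_pair_mx 1%:M 1%:M = 1%:M.
Proof. by rewrite /dual_pair_mx tensor_op1 mulmx1 mulmxV ?dual_id_unit. Qed.

Fact dual_pair_unit (x : GLmx F t * GLmx F (n + n)) :
  dual_pair_mx x.1 x.2 \in unitmx.
Proof.
apply: (proj1 (mulmx1_unit (_ : _ *m dual_pair_mx (invmx x.1) (invmx x.2) = _))).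
by rewrite -dual_pairM !mulmxV ?gl_unitmx // dual_pair1.
Qed.
Definition dual_pair x := GLMx (dual_pair_unit x).

Fact dual_pair_morphM : {in setT &, {morph dual_pair : x y / (x * y)%g}}.
Proof. by move=> x y _ _; apply: val_inj; apply: dual_pairM. Qed.
Canonical dual_pair_morphism := Morphism dual_pair_morphM.

Lemma dual_id_symp :
  dual_id^T *m symp_mx F (t * n) *m dual_id = tensor_op U (symp_mx F n).
Proof.
rewrite /dual_id /tensor_op /symp_mx.
rewrite block_mxKul block_mxKur block_mxKdl block_mxKdr tr_block_mx !trmx0 trmx1.
rewrite trmx_tprod gram_sym trmx1 !mulmx_block.
rewrite !(mulmx0, mul0mx, mulmx1, mul1mx, addr0, add0r).
by rewrite tprodNr tprod0r mulmxN mulmx1.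
Qed.

Fact dual_pair_sub :
  setX_group (Ogrp U) (Sp F n) \subset dual_pair @*^-1 (Sp F (t * n)).
Proof.
apply/subsetP=> -[g S]; rewrite !inE /= => /andP[/eqP gU /eqP SJ].
set T := dual_id; set M := tensor_op g S.
have MT : M^T = tensor_op g^T S^T.
  rewrite /M /tensor_op tr_block_mx !trmx_tprod.
  by rewrite trmx_ulsub trmx_ursub trmx_dlsub trmx_drsub.
have TV : invmx T^T *m (T^T *m symp_mx F (t * n) *m T) *m invmx T
    = symp_mx F (t * n).
  by rewrite !mulmxA mulVmx ?unitmx_tr ?dual_id_unit // mul1mx mulmxK
    ?dual_id_unit.
apply/eqP; rewrite /dual_pair_mx -/T -/M !trmx_mul trmx_inv.
rewrite -[RHS]TV dual_id_symp -[in RHS]gU -[in RHS]SJ !tensor_opM -MT -dual_id_symp.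
by rewrite !mulmxA.
Qed.

(* mu_{U (x) V} as a representation of O(U) x Sp(V) *)
Definition howe_repr d (mu : mx_representation algC (Sp F (t * n)) d) :
    mx_representation algC (setX_group (Ogrp U) (Sp F n)) d :=
  subg_repr (morphpre_repr dual_pair_morphism mu) dual_pair_sub.

End DualPair.

Section ProductGroups.

Variables (gT hT : finGroupType) (G : {group gT}) (H : {group hT}).

Fact setX_sub_fst : setX_group G H \subset (@fst gT hT) @*^-1 G.
Proof. by apply/subsetP=> x; rewrite !inE => /andP[]. Qed.
Fact setX_sub_snd : setX_group G H \subset (@snd gT hT) @*^-1 H.
Proof. by apply/subsetP=> x; rewrite !inE => /andP[]. Qed.

(* (g, h) |-> rG g (x) rH h *)
Definition outer_repr d e (rG : mx_representation algC G d)
    (rH : mx_representation algC H e) :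
    mx_representation algC (setX_group G H) (d * e) :=
  prod_repr (subg_repr (morphpre_repr (fst_morphism gT hT) rG) setX_sub_fst)
            (subg_repr (morphpre_repr (snd_morphism gT hT) rH) setX_sub_snd).

Variables (N d : nat) (M : mx_representation algC (setX_group G H) N).
Variable rho : mx_representation algC G d.

(* The representation of H on Hom_G(rho, M): h maps an intertwiner W, a matrix
   such that rho g *m W = W *m M (g, 1), to W *m M (1, h).  If M is the direct
   sum of the tau (x) Theta(tau), with tau in Irr(G), this is Theta(rho) for rho
   irreducible. *)
Definition hom_mx (h : hT) : 'M[algC]_(d * N) := lin_mulmxr (M (1%g, h)).

Fact hom_mx_repr : mx_repr H hom_mx.
Proof.
split=> [|x y Hx Hy]; apply/row_matrixP=> i; rewrite rowE [in RHS]rowE.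
  rewrite -[delta_mx _ _]vec_mxK mul_vec_lin mulmx1 /= repr_mx1 mulmx1.
  by rewrite vec_mxK.
rewrite mulmxA -[delta_mx _ _]vec_mxK !mul_vec_lin /= -mulmxA -repr_mxM ?inE
  ?group1 ?Hx ?Hy //.
by congr (mxvec (_ *m M _)); congr pair; rewrite mulg1.
Qed.
Definition hom_repr := MxRepresentation hom_mx_repr.

Definition intertwiners : 'M[algC]_(d * N) :=
  (\bigcap_(g in G) kermx (lin_mulmx (rho g) - lin_mulmxr (M (g, 1%g))))%MS.

Fact intertwiners_module : mxmodule hom_repr intertwiners.
Proof.
apply/mxmoduleP=> h Hh; apply/row_subP=> i.
rewrite row_mul; set w := row i _.
have /sub_bigcapmxP wU : (w <= intertwiners)%MS by apply: row_sub.
apply/sub_bigcapmxP=> g Gg; have /sub_kermxP := wU g Gg.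
rewrite -[w]vec_mxK /= !mulmxBr !mul_vec_lin /= => /eqP.
rewrite subr_eq0 => /eqP/(can_inj mxvecK) eW.
apply/sub_kermxP; rewrite mulmxBr !mul_vec_lin /=.
rewrite mulmxA eW -!mulmxA -!repr_mxM ?inE ?group1 ?Gg ?Hh //.
apply/eqP; rewrite subr_eq0; apply/eqP; congr (mxvec (_ *m M _)).
by congr pair; rewrite /= ?mulg1 ?mul1g.
Qed.

Definition mult_repr := submod_repr intertwiners_module.

End ProductGroups.

Section InducedRepresentation.

Variables (gT : finGroupType) (G H : {group gT}) (d : nat).
Variable rho : mx_representation algC H d.

(* Block matrix indexed by the right cosets of H in G, with representatives
   x_i; its (i, j) block at g is rho (x_i g x_j^-1) if this lies in H. *)
Definition coset_rep (i : 'I_#|rcosets H G|) : gT := repr (enum_val i).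

Definition ind_mx (g : gT) : 'M[algC]_(\sum_(i < #|rcosets H G|) d) :=
  \mxblock_(i, j) (let h := (coset_rep i * g * (coset_rep j)^-1)%g in
                   if h \in H then rho h else 0).

Lemma coset_repK i : H :* coset_rep i = enum_val i.
Proof.
have := enum_valP i; rewrite /coset_rep => /rcosetsP[a _ ->].
by rewrite rcoset_repr.
Qed.

Lemma mem_coset_rep i g j :
  (coset_rep i * g * (coset_rep j)^-1 \in H)%g =
  (H :* (coset_rep i * g) == enum_val j).
Proof.
by rewrite -mem_rcoset (sameP rcoset_eqP eqP) coset_repK.
Qed.

Lemma rcosets_coset_rep i g :
  g \in G -> H :* (coset_rep i * g)%g \in rcosets H G.
Proof.
move=> Gg; rewrite rcosetM coset_repK.
have /rcosetsP[a Ga ->] := enum_valP i.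
by rewrite -rcosetM; apply/rcosetsP; exists (a * g)%g; rewrite ?groupM.
Qed.

Fact ind_mx_repr : mx_repr G ind_mx.
Proof.
split=> [|g g' Gg Gg'].
  rewrite -[RHS]mxdiagZ; apply/eq_mxblock=> i j /=.
  rewrite mem_coset_rep mulg1 coset_repK (inj_eq enum_val_inj).
  case: eqP => [->|//]; rewrite mulgV repr_mx1.
  by rewrite conform_mx_id.
rewrite [RHS]mul_mxblock; apply/eq_mxblock=> i k /=.
have Dj := enum_rankK_in (rcosets_coset_rep i Gg) (rcosets_coset_rep i Gg).
set j := enum_rank_in _ _ in Dj.
rewrite (bigD1 j) //= big1 => [|l ne_lj]; last first.
  rewrite mem_coset_rep -Dj (inj_eq enum_val_inj) eq_sym (negPf ne_lj).
  by rewrite mul0mx.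
have Hj : (coset_rep i * g * (coset_rep j)^-1 \in H)%g.
  by rewrite mem_coset_rep Dj.
have -> : (coset_rep i * (g * g') * (coset_rep k)^-1 =
  (coset_rep i * g * (coset_rep j)^-1) * (coset_rep j * g' * (coset_rep k)^-1))%g.
  by rewrite !mulgA mulgKV.
rewrite addr0 Hj groupMl //; case: ifP => [Hk|_]; first exact: repr_mxM.
by rewrite mulmx0.
Qed.

Definition ind_repr := MxRepresentation ind_mx_repr.

End InducedRepresentation.

Section Eta.

Variables (F : finFieldType) (p : nat) (pcharFp : p \in [pchar F]).
Variables (r : nat) (U : orthoSpace F r) (n : nat).
Variable mu : mx_representation algC (Sp F (r * n)) #|{: 'cV[F]_(r * n)}|.

Definition Theta (tau : Iirr (Ogrp U)) := mult_repr (howe_repr U mu) 'Chi_tau.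

(* For r <= n Theta(tau) has exactly one irreducible constituent of rank r (a
   theorem of Gurevich and Howe), so that the default 0 is then irrelevant. *)
Definition eta_irr (tau : Iirr (Ogrp U)) : Iirr (Sp F n) :=
  odflt 0 [pick i | (i \in irr_constt (cfRepr (Theta tau))) &&
                    (rep_rank pcharFp 'Chi_i == r)].

End Eta.

Section IsotropicQuotient.

Variables (F : finFieldType) (t : nat) (U : orthoSpace F t).

Definition orthog (N : 'M[F]_t) : 'M[F]_t := kermx (U *m N^T).

Definition isotropic (N : 'M[F]_t) := (N <= orthog N)%MS.

(* R(U) *)
Definition witt_ranks : {set 'I_t.+1} :=
  [set r : 'I_t.+1 |
    [exists N : 'M[F]_t, isotropic N && (r + 2 * \rank N == t)%N]].

Definition wittT := {r : 'I_t.+1 | r \in witt_ranks}.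
HB.instance Definition _ := Finite.on wittT.
Definition wittV (r : wittT) : nat := val (val r).

(* An isotropic subspace iqN of dimension (t - r)/2 and a coordinatization iqV
   of the orthogonal space iqN^perp / iqN: the linear map v |-> v *m iqP from
   iqN^perp to 'rV_r is onto, has kernel iqN and carries the form of U to that of
   iqV. *)
Record isoQuotient (r : nat) := IsoQuotient {
  iqN : 'M[F]_t;
  iqP : 'M[F]_(t, r);
  iqV : orthoSpace F r;
  iq_isotropic : isotropic iqN;
  iq_dim : (r + 2 * \rank iqN = t)%N;
  iq_onto : row_full (orthog iqN *m iqP);
  iq_ker : (orthog iqN :&: kermx iqP :=: iqN)%MS;
  iq_form : forall v w : 'rV[F]_t,
    (v <= orthog iqN)%MS -> (w <= orthog iqN)%MS ->
    (v *m iqP) *m iqV *m (w *m iqP)^T = v *m U *m w^T }.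

Variables (r : nat) (Q : isoQuotient r).
Local Notation N := (iqN Q).
Local Notation P := (iqP Q).
Local Notation V := (iqV Q).
Local Notation K := (orthog N).

(* O_r; the rows of N *m g^T are the images under g of the rows of N. *)
Definition iq_stab := [set g in Ogrp U | (N *m g^T == N)%MS].

Fact group_set_iq_stab : group_set iq_stab.
Proof.
apply/group_setP; split=> [|g h].
  by rewrite inE group1 gl_mx1 trmx1 mulmx1 submx_refl.
rewrite inE => /andP[Og /eqmxP Ng]; rewrite inE => /andP[Oh /eqmxP Nh].
rewrite inE groupM //; apply/eqmxP; rewrite gl_mxM trmx_mul mulmxA.
exact: eqmx_trans (eqmxMr _ Nh) Ng.
Qed.
Canonical iq_stab_group := Group group_set_iq_stab.

(* The rows of pinvmx (K *m P) *m K lift the standard basis of 'rV_r to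
   iqN^perp; iq_act_mx g is the matrix of the action of g on the quotient. *)
Definition iq_lift : 'M[F]_(r, t) := pinvmx (K *m P) *m K.
Definition iq_act_mx (g : 'M[F]_t) : 'M[F]_r := (iq_lift *m g^T *m P)^T.
Definition iq_act (g : GLmx F t) : GLmx F r := insubd (glone F r) (iq_act_mx g).

Lemma iq_liftK : iq_lift *m P = 1%:M.
Proof. by rewrite /iq_lift -mulmxA mulVpmx ?iq_onto. Qed.

Lemma iq_lift_sub m (A : 'M_(m, r)) : (A *m iq_lift <= K)%MS.
Proof. by rewrite mulmxA submxMl. Qed.

Lemma iq_stabK g m (v : 'M_(m, t)) :
  g \in iq_stab -> (v <= K -> v *m g^T <= K)%MS.
Proof.
rewrite !inE => /andP[/eqP gU /andP[_ sNN]] /sub_kermxP vK; apply/sub_kermxP.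
have [D ->] := submxP sNN.
rewrite !trmx_mul trmxK !mulmxA -(mulmxA v) -(mulmxA v) [_ *m U *m _]gU.
by rewrite -(mulmxA v) mulmxA -(mulmxA v) [X in X *m _]vK mul0mx.
Qed.

Lemma iq_actE g m (v : 'M_(m, t)) : g \in iq_stab -> (v <= K)%MS ->
  v *m g^T *m P = v *m P *m (iq_act_mx g)^T.
Proof.
move=> Sg vK; rewrite trmxK.
have -> : v *m P *m (iq_lift *m g^T *m P) = v *m P *m iq_lift *m g^T *m P.
  by rewrite !mulmxA.
apply/eqP; rewrite -subr_eq0 -!mulmxBl; set w := v - _.
have wN : (w <= N)%MS.
  rewrite -(iq_ker Q) sub_capmx; apply/andP; split.
    by rewrite addmx_sub ?eqmx_opp ?iq_lift_sub.
  apply/sub_kermxP; rewrite mulmxBl -(mulmxA (v *m P)) iq_liftK.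
  by rewrite mulmx1 subrr.
have /andP[sNN _] : (N *m g^T == N)%MS by move: Sg; rewrite !inE => /andP[].
apply/eqP/sub_kermxP; apply: submx_trans (submxMr _ wN) (submx_trans sNN _).
by rewrite -(iq_ker Q) capmxSr.
Qed.

Lemma iq_act_mxM g h : g \in iq_stab -> h \in iq_stab ->
  iq_act_mx (g *m h) = iq_act_mx g *m iq_act_mx h.
Proof.
move=> Sg Sh; apply: trmx_inj; rewrite trmx_mul trmxK trmx_mul mulmxA iq_actE //.
  by rewrite [in RHS]trmxK.
by apply: iq_stabK => //; rewrite -[iq_lift]mul1mx iq_lift_sub.
Qed.

Lemma iq_act_mx1 : iq_act_mx 1%:M = 1%:M.
Proof. by rewrite /iq_act_mx trmx1 mulmx1 iq_liftK trmx1. Qed.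

Lemma iq_actK g : g \in iq_stab -> iq_act g = iq_act_mx g :> 'M_r.
Proof.
move=> Sg; rewrite [LHS]val_insubd ifT //.
have SgV : (g^-1)%g \in iq_stab by apply: (groupVr (G := iq_stab_group)).
apply: (proj1 (mulmx1_unit (_ : _ *m iq_act_mx (g^-1)%g = _))).
by rewrite -iq_act_mxM // -gl_mxM mulgV iq_act_mx1.
Qed.

Fact iq_act_morphM : {in iq_stab &, {morph iq_act : g h / (g * h)%g}}.
Proof.
move=> g h Sg Sh; apply: val_inj; rewrite /= iq_actK ?iq_act_mxM ?iq_actK //.
exact: (groupM (G := iq_stab_group)).
Qed.
Canonical iq_act_morphism := Morphism iq_act_morphM.

Fact iq_act_sub : iq_stab_group \subset iq_act @*^-1 (Ogrp V).
Proof.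
apply/subsetP=> g Sg; rewrite inE Sg inE /= inE iq_actK //; apply/eqP.
rewrite /iq_act_mx trmxK.
have lK : (iq_lift <= K)%MS by rewrite -[iq_lift]mul1mx iq_lift_sub.
have lgK : (iq_lift *m g^T <= K)%MS by apply: iq_stabK.
have form m1 m2 (v : 'M_(m1, t)) (w : 'M_(m2, t)) :
    (v <= K)%MS -> (w <= K)%MS ->
    (v *m P) *m V *m (w *m P)^T = v *m U *m w^T.
  have entry k (A : 'M_(m1, k)) (B : 'M_k) (C : 'M_(m2, k)) i j :
      (A *m B *m C^T) i j = (row i A *m B *m (row j C)^T) 0 0.
    by rewrite -row_mul !mxE; apply: eq_bigr=> l _; rewrite !mxE.
  move=> vK wK; apply/matrixP=> i j; rewrite !entry !row_mul.
  by rewrite iq_form // (submx_trans (row_sub _ _)).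
rewrite form // trmx_mul trmxK !mulmxA -(mulmxA iq_lift) -(mulmxA iq_lift).
have /eqP -> : (g^T *m U *m g == U) by move: Sg; rewrite !inE => /andP[].
by rewrite -form // iq_liftK trmx1 mulmx1 mul1mx.
Qed.

(* tau in Irr O(U_r), regarded as a representation of O_r *)
Definition iq_repr d (tau : mx_representation algC (Ogrp V) d) :
    mx_representation algC iq_stab_group d :=
  subg_repr (morphpre_repr iq_act_morphism tau) iq_act_sub.

End IsotropicQuotient.

(* Main.v *)
Require Import Defs.
From HB Require Import structures.
From mathcomp Require Import all_boot all_order all_fingroup all_algebra.
From mathcomp Require Import all_solvable all_field all_character.
From mathcomp Require Import zify ring.

(** The space L^2(Hom(X, U)) has the basis dl M, for M : X -> U. On it the N_A act by
    characters given by the Gram matrices of the M, GL(X) and O(U) permute the basis up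
    to signs, and J acts by a Fourier transform (howe_N, howe_D, howe_g, howe_J).

    In full rank, the maps M with the Gram matrix of a fixed map of X onto U form a torsor
    of O(U). Therefore the corresponding eigenspace of the N_A in Theta(tau) is, up to a
    sign, the dual of tau as a representation of O(U) embedded in GL(X); it is
    irreducible, and so exactly one constituent eta(tau) of Theta(tau) has full rank
    (eta_spec). The part of L^2(Hom(X, U)) cut out by the eta(tau) is the sum of the
    tau (x) eta(tau) (trace_etop) and contains all the dl M with M of rank t (dl_etop).

    In lower rank, for an isotropic N, inverse image to Hom(X, orthog N), extended by zero,
    is a map jmap from L^2(Hom(X, orthog N / N)) to L^2(Hom(X, U)) which intertwines the
    actions of Sp(V) and of the stabilizer of N (jmap_intertwine). Since t <= n there
    are maps of X onto orthog N, and such a map is in the support of only one of the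
    translates of the image of jmap by O(U); so these translates, restricted to the sum
    of the eta(tau), are independent (coset_independent) and form a copy of the sum of
    the Ind(tau) (x) eta(tau) (trace_summand).

    These summands exhaust the space. The kernel of an operator e commuting with Sp(V) is a function on
    Hom(X, U + (-U)) which is supported on isotropic maps, invariant under GL(X) and equal
    to its Fourier transform. Such functions are determined by their values on the maps
    with Lagrangian image (split_inv0), so that e is a combination of the operators
    attached to the Lagrangians of U + (-U). If e kills the dl M with M of rank t, no
    graph of an isometry contributes; if it also kills the sums over the cosets of the
    Hom(X, N), with N isotropic and non-zero, then e * e = 0 (commutant_square_zero).
    Applied to projections onto complements, with Witt's theorem and induction on the
    dimension of N, this shows that the summands found above span (theta_span_full).

    Comparing traces gives the decomposition. The eta(tau) are inequivalent for
    different r because their ranks are, and for the same r by eta_inj. *)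

Set Implicit Arguments.
Unset Strict Implicit.
Unset Printing Implicit Defensive.

Import Order.TTheory GRing.Theory Num.Theory.
Local Open Scope group_scope.
Local Open Scope ring_scope.

(** * The additive character *)

Lemma mxtrace_mul_delta (R : pzSemiRingType) m k (A : 'M[R]_(k, m)) i j :
  \tr (A *m delta_mx j i) = A i j.
Proof.
rewrite /mxtrace (bigD1 i) //= mxE (bigD1 j) //= mxE !eqxx mulr1.
rewrite !big1 ?addr0 // => [l li|l lj]; last by rewrite mxE (negPf lj) mulr0.
by rewrite mxE big1 // => l' _; rewrite mxE (negPf li) andbF mulr0.
Qed.

Section AdditiveCharacter.

Variables (F : finFieldType) (p : nat) (pcharFp : p \in [pchar F]).
Local Notation L := (pPrimeCharType pcharFp).
Local Notation om := (omega pcharFp).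
Local Notation tr := (galTrace 1%VS {:L}).

Lemma FtraceE (x : F) : (Ftrace pcharFp x)%:A = tr x :> L.
Proof.
rewrite /Ftrace; case: pickP => [c /eqP //|no_c].
have /vlineP[c Dc] : tr x \in (1%VS : {vspace L}).
  by rewrite mem_galTrace ?memvf // finField_galois ?sub1v.
by have := no_c c; rewrite -Dc eqxx.
Qed.

Lemma FtraceD : {morph Ftrace pcharFp : x y / x + y}.
Proof.
move=> x y; have inj : injective (fun c : 'F_p => c%:A : L).
  move=> a b /eqP; rewrite -subr_eq0 -scalerBl scaler_eq0 oner_eq0 orbF subr_eq0.
  by move/eqP.
by apply: inj; rewrite scalerDl !FtraceE raddfD.
Qed.

(** Distinct automorphisms are linearly independent, so their sum is not zero. *)
Lemma Ftrace_neq0 : exists x, Ftrace pcharFp x != 0.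
Proof.
have /= := @gal_independent_contra 'F_p L {:L}%AS
  (fun y => y \in 'Gal({:L} / 1)%g) (fun _ => 1) 1%g (group1 _) (oner_neq0 _).
move=> [x _ nz]; exists x; apply: contraNneq nz => tr0.
have := FtraceE x; rewrite tr0 scale0r => /esym {2}<-.
by apply/eqP/eq_bigr => y _; rewrite mul1r.
Qed.

Let p_pr : prime p. Proof. exact: pcharf_prime pcharFp. Qed.

(** As p is prime it suffices that the square is not 1, and the root of -1 of least
    argument is not -1 since p > 1. *)
Lemma zeta_p_prim : p.-primitive_root ((p.-root (-1 : algC)) ^+ 2).
Proof.
set z := p.-root (-1); have p_gt0 := prime_gt0 p_pr.
have zp : z ^+ p = -1 by rewrite rootCK.
have z2p : (z ^+ 2) ^+ p = 1 by rewrite exprAC zp sqrrN expr1n.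
have [m prim_m] := prim_order_exists p_gt0 z2p.
case/primeP: p_pr => _ dvp /dvp /orP[/eqP m1|/eqP <-] //.
move: prim_m; rewrite m1 => /prim_expr_order; rewrite expr1 => /eqP.
rewrite sqrf_eq1 => /orP[/eqP z1|/eqP zN1].
  move: zp; rewrite z1 expr1n => /esym/eqP.
  by rewrite eqNr oner_eq0.
have := rootC_lt0 (-1 : algC) (prime_gt1 p_pr); rewrite -/z zN1.
by rewrite oppr_lt0 ltr01.
Qed.

Lemma omegaD x y : om (x + y) = om x * om y.
Proof.
rewrite /omega FtraceD; set a := Ftrace _ x; set b := Ftrace _ y.
have -> : nat_of_ord (a + b)%R = ((a + b) %% p)%N.
  by congr modn; apply: Fp_cast.
by rewrite (prim_expr_mod zeta_p_prim) exprD.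
Qed.

Lemma omega0 : om 0 = 1.
Proof.
have t0 : Ftrace pcharFp 0 = 0.
  by apply: (addrI (Ftrace pcharFp 0)); rewrite -FtraceD !addr0.
by rewrite /omega t0 expr0.
Qed.

Lemma omegaN x : om (- x) = (om x)^-1.
Proof.
have om1 : om x * om (- x) = 1 by rewrite -omegaD subrr omega0.
have nz : om x != 0.
  by apply: contra_eq_neq om1 => ->; rewrite mul0r eq_sym oner_neq0.
by apply: (mulfI nz); rewrite om1 divff.
Qed.

Lemma omega_neq0 x : om x != 0.
Proof.
have : om x * om (- x) != 0 by rewrite -omegaD subrr omega0 oner_neq0.
by rewrite mulf_eq0 negb_or => /andP[].
Qed.

Lemma omega_nontriv : exists x, om x != 1.
Proof.
have [x nz] := Ftrace_neq0; exists x; apply: contra nz.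
rewrite /omega -(prim_order_dvd zeta_p_prim) => dvp; apply/eqP/val_inj => /=.
apply/eqP; rewrite -leqn0 leqNgt; apply/negP => /dvdn_leq-/(_ _ dvp).
by rewrite leqNgt => /negP; apply; have := ltn_ord (Ftrace pcharFp x); rewrite [X in (_ < X)%N]Fp_cast.
Qed.

Lemma omega_trivP x : reflect (forall a, om (a * x) = 1) (x == 0).
Proof.
apply: (iffP eqP) => [-> a|triv]; first by rewrite mulr0 omega0.
apply/eqP/contraT => nz; have [y] := omega_nontriv.
by rewrite -(mulfVK nz y) triv eqxx.
Qed.

(** A non-trivial character of a finite abelian group sums to zero: translating
    by v0 multiplies the sum by om (f v0). *)
Lemma sum_omega_add (V : finZmodType) (f : V -> F) :
  {morph f : x y / x + y} -> (exists v, om (f v) != 1) ->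
  \sum_v om (f v) = 0.
Proof.
move=> fD [v0 nz]; apply/eqP/contraT => nzS; case/negP: nz; apply/eqP.
apply: (mulIf nzS); rewrite mul1r mulr_sumr.
rewrite [RHS](reindex_inj (addrI v0)) /=.
by apply: eq_bigr => v _; rewrite fD omegaD.
Qed.

Lemma sum_omega_triv (V : finType) (f : V -> F) :
  (forall v, f v = 0) -> \sum_v om (f v) = #|V|%:R.
Proof.
move=> f0; rewrite (eq_bigr (fun=> 1)); last by move=> v _; rewrite f0 omega0.
by rewrite sumr_const.
Qed.

(** Orthogonality of the additive characters of matrix spaces, written with the
    trace pairing. *)
Lemma sum_omega_mx m k (A : 'M[F]_(k, m)) :
  \sum_(X : 'M[F]_(m, k)) om (\tr (A *m X)) =
    if A == 0 then #|{: 'M[F]_(m, k)}|%:R else 0.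
Proof.
case: eqP => [->|nzA].
  by apply: sum_omega_triv => X; rewrite mul0mx mxtrace0.
apply: sum_omega_add => [X Y|]; first by rewrite mulmxDr mxtraceD.
have /existsP[i /existsP[j nz]] : [exists i, exists j, A i j != 0].
  apply/contraT => /existsPn H; case: nzA; apply/matrixP=> i j; rewrite mxE.
  by have /existsPn/(_ j) := H i; rewrite negbK => /eqP.
have [y ny] := omega_nontriv; exists ((y / A i j) *: delta_mx j i).
rewrite -scalemxAr mxtraceZ; suff -> : \tr (A *m delta_mx j i) = A i j.
  by rewrite divfK.
exact: mxtrace_mul_delta.
Qed.

End AdditiveCharacter.

(** * Tensor products and determinants *)

Section TensorModel.

Variable F : fieldType.

Lemma tprodDl m1 n1 (A B : 'M[F]_(m1, n1)) m2 n2 (C : 'M[F]_(m2, n2)) :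
  tprod (A + B) C = tprod A C + tprod B C.
Proof.
elim: m1 n1 A B => [|m1 IH] n1 A B /=; first by rewrite addr0.
by rewrite !linearD /= IH -!trowbE linearD /= add_col_mx.
Qed.

Lemma tprod0l m1 n1 m2 n2 (C : 'M[F]_(m2, n2)) :
  tprod (0 : 'M[F]_(m1, n1)) C = 0.
Proof. by apply: (addrI (tprod 0 C)); rewrite -tprodDl !addr0. Qed.

Lemma tprod_scale m1 n1 a (A : 'M[F]_(m1, n1)) m2 n2 (C : 'M[F]_(m2, n2)) :
  tprod (a *: A) C = tprod A (a *: C).
Proof.
elim: m1 n1 A => [|m1 IH] n1 A //=.
by rewrite !linearZ /= IH -[trow (a *: _) C]trowbE linearZ.
Qed.

Lemma tprodZr m1 n1 (A : 'M[F]_(m1, n1)) m2 n2 a (C : 'M[F]_(m2, n2)) :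
  tprod A (a *: C) = a *: tprod A C.
Proof.
elim: m1 n1 A => [|m1 IH] n1 A /=; first by rewrite scaler0.
by rewrite linearZ IH scale_col_mx.
Qed.

Variables n t : nat.

Definition tcol (a : 'cV[F]_t) (b : 'cV[F]_n) : 'cV[F]_(t * n) := tprod a b.

Lemma tcol_sumr I (r : seq I) a (b : I -> 'cV[F]_n) :
  tcol a (\sum_(i <- r) b i) = \sum_(i <- r) tcol a (b i).
Proof.
elim/big_rec2: _ => [|i x y _ <-]; first exact: (tprod0r a n 1).
by have := tprodDr a (b i) y.
Qed.

Lemma tcol_suml I (r : seq I) (a : I -> 'cV[F]_t) b :
  tcol (\sum_(i <- r) a i) b = \sum_(i <- r) tcol (a i) b.
Proof.
elim/big_rec2: _ => [|i x y _ <-]; first by have := tprod0l t 1 b.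
by have := tprodDl (a i) y b.
Qed.

Lemma tprod_tcol (A : 'M[F]_t) (B : 'M[F]_n) a b :
  tprod A B *m tcol a b = tcol (A *m a) (B *m b).
Proof. by rewrite [RHS]tprodE. Qed.

Lemma tcol_dot a b a' b' :
  (tcol a b)^T *m tcol a' b' = ((a^T *m a') 0 0 * (b^T *m b') 0 0)%:M.
Proof.
have -> : (tcol a b)^T *m tcol a' b' = tprod (a^T *m a') (b^T *m b').
  by rewrite tprodE -trmx_tprod.
set c := a^T *m a'; set d := b^T *m b'.
apply/matrixP=> i j; rewrite !ord1 [RHS]mxE mulr1n.
by have := mxtrace_prod c d; rewrite /mxtrace !big_ord1.
Qed.

(** The element of 'cV_(t * n) with matrix M: the sum of the e_i (x) (i-th column
    of M). *)
Definition vecT (M : 'M[F]_(n, t)) : 'cV[F]_(t * n) :=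
  \sum_i tcol (delta_mx i 0) (col i M).

Lemma tprod_vecT (A : 'M[F]_t) (B : 'M[F]_n) M :
  tprod A B *m vecT M = vecT (B *m M *m A^T).
Proof.
rewrite mulmx_sumr.
pose f i j := tcol (delta_mx j 0) (A j i *: (B *m col i M)).
transitivity (\sum_i \sum_j f i j).
  apply: eq_bigr => i _; rewrite tprod_tcol -colE.
  have -> : col i A = \sum_j A j i *: delta_mx j 0.
    rewrite [LHS]matrix_sum_delta; apply: eq_bigr => j _.
    by rewrite big_ord1 mxE.
  rewrite tcol_suml; apply: eq_bigr => j _.
  by have := tprod_scale (A j i) (delta_mx j 0 : 'cV_t) (B *m col i M).
rewrite exchange_big; apply: eq_bigr => j _ /=; rewrite -tcol_sumr.
suff -> : \sum_i A j i *: (B *m col i M) = col j (B *m M *m A^T) by [].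
apply/colP=> k; rewrite summxE !mxE; apply: eq_bigr => i _.
rewrite !mxE mulrC; congr (_ * _); apply: eq_bigr => l _; by rewrite !mxE.
Qed.

Lemma vecT_dot M M' : (vecT M)^T *m vecT M' = (\tr (M^T *m M'))%:M.
Proof.
rewrite /vecT [X in X *m _]linear_sum /= mulmx_suml [in RHS]/mxtrace raddf_sum /=.
apply: eq_bigr => i _; rewrite mulmx_sumr (bigD1 i) //= big1 => [|j ji].
  rewrite addr0 tcol_dot trmx_delta mul_delta_mx mxE eqxx mul1r.
  by congr (_%:M); rewrite !mxE; apply: eq_bigr => k _; rewrite !mxE.
rewrite tcol_dot trmx_delta mul_delta_mx_0 1?eq_sym //.
by rewrite mxE mul0r raddf0.
Qed.

Lemma vecTB : {morph vecT : M M' / M - M'}.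
Proof.
move=> M M'; rewrite /vecT -sumrB; apply: eq_bigr => i _.
by rewrite linearB /= /tcol tprodDr tprodNr.
Qed.
HB.instance Definition _ := GRing.isZmodMorphism.Build _ _ vecT vecTB.

Lemma vecTZ a M : vecT (a *: M) = a *: vecT M.
Proof.
rewrite /vecT scaler_sumr; apply: eq_bigr => i _.
by rewrite linearZ; have := tprodZr (delta_mx i 0 : 'cV_t) a (col i M).
Qed.

Lemma vecT_inj : injective vecT.
Proof.
move=> M M' /eqP; rewrite -subr_eq0 -vecTB => /eqP v0; apply/eqP.
rewrite -subr_eq0; apply/eqP/matrixP=> i j.
have := vecT_dot (delta_mx i j) (M - M'); rewrite v0 mulmx0 => /matrixP/(_ 0 0).
rewrite !mxE eqxx mulr1n mxtrace_mulC trmx_delta mxtrace_mul_delta.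
by rewrite !mxE.
Qed.

End TensorModel.

Section Determinants.

Variable F : fieldType.

(** Similar matrices have equal determinants, also when the two sizes are equal
    without being the same expression. *)
Lemma det_intertwine m k (A : 'M[F]_m) (B : 'M[F]_k) (S : 'M[F]_(m, k)) :
  m = k -> row_free S -> A *m S = S *m B -> \det A = \det B.
Proof.
move=> mk; move: B S; rewrite -{}mk => B S; rewrite row_free_unit => uS AS.
have /(congr1 determinant) := AS; rewrite !det_mulmx mulrC => /mulfI; apply.
by rewrite -unitfE -unitmxE.
Qed.

Lemma det_tprod1 t n (C : 'M[F]_n) : \det (tprod (1%:M : 'M_t) C) = \det C ^+ t.
Proof.
elim: t => [|t IH]; first by rewrite expr0 det_mx00.
have -> : tprod (1%:M : 'M_t.+1) C = block_mx C 0 0 (tprod 1%:M C).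
  rewrite /= (scalar_mx_block 1 t) col_mxKu col_mxKd tprod_tr.
  rewrite !row_mxKl !row_mxKr trmx0 !trow0 trmx0 mxE eqxx scale1r.
  by rewrite -block_mxEv.
by rewrite det_ublock IH exprS.
Qed.

End Determinants.

Section FiniteTensorModel.

Variable F : finFieldType.

Lemma vecT_surj n t (v : 'cV[F]_(t * n)) : exists M : 'M_(n, t), v = vecT M.
Proof.
have /codomP[M ->] : v \in codom (@vecT F n t); last by exists M.
by apply: inj_card_onto (@vecT_inj F n t) _ v; rewrite !card_mx muln1 mulnC.
Qed.

Lemma eq_vecT_mx n t k (A B : 'M[F]_(k, t * n)) :
  (forall M : 'M_(n, t), A *m vecT M = B *m vecT M) -> A = B.
Proof.
move=> eqAB; apply: trmx_inj; apply/row_matrixP=> i.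
have [M DM] := vecT_surj (delta_mx i 0).
by rewrite -!tr_col !colE DM eqAB.
Qed.

(** The exchange a (x) b -> b (x) a: it sends vecT M to vecT M^T. *)
Definition swap_mx n t : 'M[F]_(t * n, n * t) := \sum_i \sum_j
  vecT (delta_mx i j : 'M_(n, t)) *m (vecT (delta_mx j i : 'M_(t, n)))^T.

(** Exchanging the two factors of the tensor product is a change of basis. *)
Lemma det_tprodC n t (A : 'M[F]_t) :
  \det (tprod A (1%:M : 'M_n)) = \det (tprod (1%:M : 'M_n) A).
Proof.
have SE n' t' (N : 'M_(t', n')) : swap_mx n' t' *m vecT N = vecT N^T.
  rewrite [N^T]matrix_sum_delta (raddf_sum (@vecT F n' t')) /swap_mx mulmx_suml; apply: eq_bigr => i _.
  rewrite (raddf_sum (@vecT F n' t')) mulmx_suml; apply: eq_bigr => j _ /=.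
  rewrite -mulmxA vecT_dot trmx_delta mul_mx_scalar mxtrace_mulC.
  by rewrite mxtrace_mul_delta vecTZ mxE.
have SK : swap_mx n t *m swap_mx t n = 1%:M.
  by apply: eq_vecT_mx => M; rewrite -mulmxA !SE trmxK mul1mx.
apply: (det_intertwine (mulnC t n) (S := swap_mx n t)).
  by apply/row_freeP; exists (swap_mx t n).
apply: eq_vecT_mx => N.
by rewrite -!mulmxA !SE !tprod_vecT SE trmx1 mul1mx mulmx1 trmx_mul.
Qed.

End FiniteTensorModel.

(** * Generators of the symplectic group *)

Section SymplecticGenerators.

Variables (F : finFieldType) (n : nat).
Implicit Types (a b c d A T : 'M[F]_n).

Lemma Sp_blockP a b c d (h : GLmx F (n + n)) : h = block_mx a b c d :> 'M_(n + n) ->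
  h \in Sp F n ->
  [/\ c^T *m a = a^T *m c, a^T *m d = 1%:M + c^T *m b & d^T *m b = b^T *m d].
Proof.
move=> Dh; rewrite inE Dh /symp_mx tr_block_mx !mulmx_block.
rewrite !(mulmx0, mulmx1, mulmxN, mulNmx, add0r, addr0) => /eqP/eq_block_mx.
case=> /eqP; rewrite addrC subr_eq0 => /eqP -> <- _ /eqP.
by rewrite addrC subr_eq0 => /eqP ->; split=> //; rewrite addrAC addNr add0r.
Qed.

Lemma gen_N_Sp A : A^T = A -> gen_N A \in Sp F n.
Proof.
move=> sA; rewrite inE /= /symp_mx tr_block_mx !mulmx_block sA !trmx0 !trmx1.
rewrite !(mulmx0, mul0mx, mulmx1, mul1mx, mulmxN, mulNmx, add0r, addr0).
by rewrite addNr.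
Qed.

Lemma gen_D_Sp (C : GLmx F n) : gen_D C \in Sp F n.
Proof.
rewrite inE /= /symp_mx tr_block_mx !mulmx_block !trmx0 trmxK.
rewrite !(mulmx0, mul0mx, mulmx1, mul1mx, mulmxN, mulNmx, add0r, addr0).
by rewrite -trmx_mul !mulVmx ?gl_unitmx // trmx1.
Qed.

Lemma gen_J_Sp : gen_J (1%g : GLmx F n) \in Sp F n.
Proof.
rewrite inE /= /symp_mx tr_block_mx !mulmx_block !trmx0 invmx1 [(- 1%:M)^T]linearN /= trmx1.
by rewrite !(mulmx0, mul0mx, mulmx1, mul1mx, mulmxN, mulNmx, add0r, addr0, opprK) oppr0.
Qed.

(** Writing a = L pid R, the choice T = L copid L^T works: modulo L and R it adds
    to pid the block of c which is invertible because (a, c) has full rank and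
    a^T c is symmetric. *)
Lemma sym_shift_unit a c u v : c^T *m a = a^T *m c -> u *m a + v *m c = 1%:M ->
  exists2 T, T^T = T & a + T *m c \in unitmx.
Proof.
move=> sym_ac uavc; set L := col_ebase a; set R := row_ebase a.
set P : 'M[F]_n := pid_mx (\rank a).
have [uL uR] : L \in unitmx /\ R \in unitmx.
  by rewrite col_ebase_unit row_ebase_unit.
have Da : a = L *m P *m R by rewrite mulmx_ebase.
set Q : 'M[F]_n := copid_mx (\rank a).
have trP : P^T = P by rewrite tr_pid_mx.
have PP : P *m P = P by rewrite /P pid_mx_id ?rank_leq_row.
have trQ : Q^T = Q by rewrite /Q /copid_mx linearB /= trmx1 tr_pid_mx.
have DQ : Q = 1%:M - P by [].
have PQ : P *m Q = 0 by rewrite DQ mulmxBr mulmx1 PP subrr.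
have QQ : Q *m Q = Q by rewrite {1}DQ mulmxBl mul1mx PQ subr0.
exists (L *m Q *m L^T); first by rewrite !trmx_mul trmxK trQ mulmxA.
pose c' := L^T *m c *m invmx R.
have DP : P = invmx L *m a *m invmx R.
  by rewrite Da !mulmxA mulVmx // mul1mx mulmxK.
have sym' : P *m c' = c'^T *m P.
  rewrite -{1}trP DP /c' !trmx_mul trmxK !trmx_inv !mulmxA mulmxKV ?unitmx_tr //.
  by rewrite mulmxK // -(mulmxA _ c^T) sym_ac mulmxA.
have inj (x : 'rV_n) : x *m (P + Q *m c')^T = 0 -> x = 0.
  rewrite linearD /= trP trmx_mul trQ mulmxDr mulmxA => x0.
  have xP : x *m P = 0.
    have := congr1 (mulmx^~ P) x0; rewrite /= mulmxDl mul0mx -!mulmxA PP.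
    by rewrite DQ mulmxBl mul1mx PP subrr !mulmx0 addr0.
  have xc : x *m c'^T = 0.
    move: x0; rewrite xP add0r DQ mulmxBr mulmx1 -(mulmxA x) -sym' mulmxA xP.
    by rewrite mul0mx subr0.
  have ya : x *m (invmx R)^T *m a^T = 0.
    apply: (can_inj (mulmxK (_ : (invmx L)^T \in unitmx))).
      by rewrite unitmx_tr unitmx_inv.
    by rewrite mul0mx -!mulmxA -!trmx_mul -DP trP.
  have yc : x *m (invmx R)^T *m c^T = 0.
    apply: (can_inj (mulmxK uL)).
    rewrite mul0mx -[RHS]xc /c' !trmx_mul trmxK !mulmxA. by [].
  apply: (can_inj (mulmxK (_ : (invmx R)^T \in unitmx))).
    by rewrite unitmx_tr unitmx_inv.
  rewrite mul0mx -[LHS]mulmx1 -trmx1 -uavc linearD /= !trmx_mul mulmxDr !mulmxA.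
  by rewrite ya yc !mul0mx addr0.
have uPQ : P + Q *m c' \in unitmx.
  by rewrite -unitmx_tr -row_free_unit; apply: inj_row_free.
have -> : a + L *m Q *m L^T *m c = L *m (P + Q *m c') *m R.
  by rewrite (mulmxDr L P) (mulmxDl (L *m P)) -Da /c' !mulmxA mulmxKV.
by rewrite !unitmx_mul uL uPQ uR.
Qed.

(** If the upper left block a of h is invertible, then h is the product of a lower
    unipotent element, an element of GL(X) and some N_A; translating h by N_T
    replaces a by a + T c, which is invertible for a suitable T. *)
Lemma Sp_gen (S : {group GLmx F (n + n)}) :
  (forall A, A^T = A -> gen_N A \in S) -> (forall C : GLmx F n, gen_D C \in S) ->
  gen_J 1%g \in S -> Sp F n \subset S.
Proof.
move=> SN SD SJ.
have uL (s : 'M[F]_n) : block_mx 1%:M 0 s 1%:M \in unitmx.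
  by rewrite unitmxE det_lblock !det1 mulr1 unitr1.
have SL s : s^T = s -> GLMx (uL s) \in S.
  move=> ss; rewrite -(groupMr _ SJ).
  suff -> : (GLMx (uL s) * gen_J 1 = gen_J 1 * gen_N (- s))%g.
    by rewrite groupM ?SN // linearN /= ss.
  apply: val_inj; rewrite /= !mulmx_block invmx1.
  by rewrite !(mulmx0, mul0mx, mulmx1, mul1mx, mulmxN, mulNmx, add0r, addr0, opprK).
have Sul (h : GLmx F (n + n)) : h \in Sp F n -> ulsubmx h \in unitmx -> h \in S.
  move: (Sp_blockP (esym (submxK h))).
  set a := ulsubmx h; set b := ursubmx h; set c := dlsubmx h; set d := drsubmx h.
  move=> H /H[ca ad db] ua; have uaT : a^T \in unitmx by rewrite unitmx_tr.
  pose s := c *m invmx a; pose s' := invmx a *m b.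
  have ss : s^T = s.
    rewrite /s trmx_mul trmx_inv; apply: (canLR (mulKmx uaT)).
    by rewrite mulmxA -ca mulmxK.
  have Dd : d = invmx a^T + s *m b.
    apply: (can_inj (mulKmx uaT)); rewrite ad mulmxDr mulmxV //.
    by rewrite /s !mulmxA -ca mulmxK.
  have ss' : s'^T = s'.
    have : b^T *m invmx a^T = invmx a *m b.
      move: db; rewrite Dd linearD /= mulmxDl mulmxDr trmx_mul ss mulmxA => /addIr.
      by rewrite trmx_inv trmxK.
    by rewrite /s' trmx_mul trmx_inv.
  suff -> : h = (GLMx (uL s) * gen_D (GLMx ua) * gen_N s')%g by rewrite !groupM ?SL ?SN.
  apply: val_inj; rewrite /= -[LHS]submxK !mulmx_block.
  rewrite !(mulmx0, mul0mx, mulmx1, mul1mx, add0r, addr0).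
  by rewrite -/a -/b -/c -/d /s' mulKVmx // /s mulmxKV // Dd /s addrC trmx_inv mulmxA.
apply/subsetP=> h Sh; have [ca ad db] := Sp_blockP (esym (submxK h)) Sh.
have [T sT uT] : exists2 T : 'M_n, T^T = T &
    ulsubmx h + T *m dlsubmx h \in unitmx.
  apply: (sym_shift_unit (u := (drsubmx h)^T) (v := - (ursubmx h)^T)) => //.
  apply: trmx_inj; rewrite linearD /= mulNmx linearN /= !trmx_mul !trmxK trmx1 ad.
  by rewrite addrK.
rewrite -(groupMl _ (SN _ sT)); apply: Sul.
  by rewrite groupM ?gen_N_Sp.
by rewrite /= -[h : 'M_(n + n)]submxK mulmx_block block_mxKul mul1mx.
Qed.

End SymplecticGenerators.

(** * Witt's theorem for isotropic subspaces *)

Section Witt.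

Variables (F : finFieldType) (t : nat) (U : orthoSpace F t).
Hypothesis two_nz : (2 : F) != 0.

Definition oform (v w : 'rV[F]_t) : F := (v *m U *m w^T) 0 0.

Lemma oformE v w : v *m U *m w^T = (oform v w)%:M.
Proof. exact: mx11_scalar. Qed.

Lemma oformC v w : oform v w = oform w v.
Proof.
rewrite /oform; have -> : v *m U *m w^T = (w *m U *m v^T)^T.
  by rewrite !trmx_mul trmxK gram_sym mulmxA.
by rewrite mxE.
Qed.

Lemma oformBl u v w : oform (u - v) w = oform u w - oform v w.
Proof. by rewrite /oform !mulmxBl !mxE. Qed.

Lemma oformBr u v w : oform u (v - w) = oform u v - oform u w.
Proof. by rewrite ![oform u _]oformC oformBl. Qed.

Lemma oformZl a v w : oform (a *: v) w = a * oform v w.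
Proof. by rewrite /oform -!scalemxAl mxE. Qed.

Lemma oformZr a v w : oform v (a *: w) = a * oform v w.
Proof. by rewrite ![oform v _]oformC oformZl. Qed.

Lemma isotropicP (N : 'M[F]_t) : reflect (N *m U *m N^T = 0) (isotropic U N).
Proof. by rewrite -mulmxA; apply: sub_kermxP. Qed.

Lemma isotropic_form (N : 'M[F]_t) v w : isotropic U N -> (v <= N)%MS -> (w <= N)%MS ->
  oform v w = 0.
Proof.
move=> /isotropicP NN /submxP[x ->] /submxP[y ->].
rewrite /oform trmx_mul !mulmxA -(mulmxA x) -(mulmxA x) NN mulmx0 mul0mx.
by rewrite mxE.
Qed.

Lemma Ogrp_row (g : GLmx F t) : g \in Ogrp U -> g^T *m U *m g = U.
Proof. by rewrite inE => /eqP. Qed.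

Lemma isotropic_mul (N : 'M[F]_t) (g : GLmx F t) :
  g \in Ogrp U -> isotropic U N -> isotropic U (N *m g^T).
Proof.
move=> Og /isotropicP NN; apply/isotropicP; rewrite trmx_mul trmxK !mulmxA.
by rewrite -(mulmxA N) -(mulmxA N) [_ *m g]Ogrp_row.
Qed.

(** The reflection in v1 - v2 exchanges the isotropic vectors v1 and v2. *)
Lemma reflection_swap v1 v2 :
    oform v1 v1 = 0 -> oform v2 v2 = 0 -> oform v1 v2 != 0 ->
  exists2 g : GLmx F t, g \in Ogrp U & v1 *m g^T = v2 /\
    (forall w, oform w v1 = oform w v2 -> w *m g^T = w).
Proof.
move=> v11 v22 v12; set v := v1 - v2; pose q := oform v v.
have q_nz : q != 0.
  rewrite /q /v !oformBl !oformBr v11 v22 (oformC v2) sub0r subr0.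
  by rewrite -opprD oppr_eq0 -mulr2n -mulr_natl mulf_neq0.
have vUv : v *m U *m v^T = q%:M by rewrite oformE.
pose E := U *m v^T *m v; pose c := 2 / q.
have cq : c * c * q = c + c
  by rewrite -mulrA [c * q]divfK // mulr_natr mulr2n.
have EE : E *m E = q *: E.
  rewrite /E -!mulmxA (mulmxA v U) (mulmxA (v *m U) v^T) vUv mul_scalar_mx.
  by rewrite -!scalemxAr.
have EU : U *m E^T = E *m U by rewrite /E !trmx_mul trmxK gram_sym !mulmxA.
pose R : 'M[F]_t := 1%:M - c *: E.
have aux (V : zmodType) (x a : V) : x - a - (a - (a + a)) = x.
  have -> : a - (a + a) = - a by rewrite opprD addrA subrr sub0r.
  by rewrite opprK subrK.
have RR : R *m R = 1%:M.
  rewrite /R mulmxBr mulmx1 mulmxBl mul1mx -scalemxAl -scalemxAr EE !scalerA.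
  by rewrite cq scalerDl aux.
have RU : R *m U *m R^T = U.
  have -> : R^T = 1%:M - c *: E^T.
    by apply/matrixP=> i j; rewrite !mxE eq_sym.
  have ET : E *m U *m E^T = q *: (E *m U) by rewrite -mulmxA EU mulmxA EE -scalemxAl.
  rewrite /R mulmxBr mulmx1 -!scalemxAr mulmxBl mul1mx mulmxBl EU -!scalemxAl ET.
  by rewrite scalerBr !scalerA cq scalerDl aux.
have uR : R^T \in unitmx by rewrite unitmx_tr; case/mulmx1_unit: RR.
exists (GLMx uR); first by rewrite inE /= trmxK RU.
have RE w : w *m R = w - (c * oform w v) *: v.
  rewrite /R mulmxBr mulmx1 -scalemxAr /E !mulmxA oformE mul_scalar_mx.
  by rewrite scalerA.
rewrite /= trmxK; split=> [|w wv]; last first.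
  by rewrite RE /v oformBr wv subrr mulr0 scale0r subr0.
rewrite RE; suff -> : c * oform v1 v = 1 by rewrite scale1r /v subKr.
apply: (mulIf q_nz); rewrite mul1r mulrAC /c divfK //.
rewrite /q /v !oformBl !oformBr v11 v22 (oformC v2) !sub0r subr0.
by rewrite mulrN mulr_natl mulr2n opprD.
Qed.

(** A reflection taking a vector of N to a vector of N' not orthogonal to it fixes
    the intersection, whose vectors are orthogonal to both. *)
Lemma Witt_step (N N' : 'M[F]_t) :
    isotropic U N -> isotropic U N' -> N *m U *m N'^T != 0 ->
  exists2 g : GLmx F t, g \in Ogrp U &
    (\rank (N :&: N')%MS < \rank (N *m g^T :&: N')%MS)%N.
Proof.
move=> isoN isoN' nz.
have /existsP[i /existsP[j nzij]] :
    [exists i, exists j, oform (row i N) (row j N') != 0].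
  apply: contraNT nz => /existsPn H; apply/eqP/matrixP=> i j.
  have /existsPn/(_ j) := H i; rewrite negbK => /eqP ij0.
  rewrite [RHS]mxE -ij0 /oform -row_mul !mxE.
  by apply: eq_bigr => k _; rewrite !mxE.
have vN : (row i N <= N)%MS by apply: row_sub.
have vN' : (row j N' <= N')%MS by apply: row_sub.
set v := row i N in nzij vN; set v' := row j N' in nzij vN'.
have [g Og [vg fixg]] := reflection_swap (isotropic_form isoN vN vN)
  (isotropic_form isoN' vN' vN') nzij.
exists g => //; apply: rank_ltmx; rewrite /ltmx; apply/andP; split.
  rewrite sub_capmx capmxSr andbT; set I := (N :&: N')%MS.
  suff {1}<- : I *m g^T = I by rewrite submxMr ?capmxSl.
  apply/row_matrixP=> k; rewrite row_mul; apply: fixg.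
  have kI : (row k I <= I)%MS by apply: row_sub.
  rewrite (isotropic_form isoN (submx_trans kI (capmxSl _ _)) vN).
  by rewrite (isotropic_form isoN' (submx_trans kI (capmxSr _ _)) vN').
apply/negP => /(submx_trans _) H.
have : (v' <= N :&: N')%MS by apply: H; rewrite sub_capmx vN' andbT -vg submxMr.
rewrite sub_capmx => /andP[v'N _].
by rewrite (isotropic_form isoN vN v'N) eqxx in nzij.
Qed.

(** A vector w which is isotropic, orthogonal to the intersection of N and N', and
    orthogonal to neither of them: the reflection taking a vector of N to w makes
    the two subspaces non-orthogonal. *)
Lemma Witt_linking (N N' : 'M[F]_t) :
    isotropic U N -> N *m U *m N'^T = 0 ->
    ~~ (N <= N')%MS -> ~~ (N' <= N)%MS ->
  exists v v' w : 'rV[F]_t, [/\ (v <= N)%MS, (v' <= N')%MS, oform w w = 0,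
    oform v w = 1 & oform v' w = 1 /\
    forall u, (u <= N :&: N')%MS -> oform u w = 0].
Proof.
move=> isoN NN'; have coker (A B : 'M[F]_t) : ~~ (A <= B)%MS ->
    exists i (x : 'cV[F]_t), B *m x = 0 /\ (row i A *m x) 0 0 = 1.
  rewrite submxE => nz; have /existsP[i /existsP[j nzij]] :
      [exists i, exists j, (A *m cokermx B) i j != 0].
    apply: contraNT nz => /existsPn H; apply/eqP/matrixP=> i j; rewrite [RHS]mxE.
    by have /existsPn/(_ j) := H i; rewrite negbK => /eqP.
  exists i, (((A *m cokermx B) i j)^-1 *: col j (cokermx B)); split.
    by rewrite -scalemxAr colE (mulmxA B) mulmx_coker mul0mx scaler0.
  rewrite -scalemxAr mxE -[X in _^-1 * X](_ : (A *m cokermx B) i j = _) ?mulVf //.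
  by rewrite !mxE; apply: eq_bigr => k _; rewrite !mxE.
move=> /coker[i [x1 [N'x1 vx1]]] /coker[j [x2 [Nx2 vx2]]].
set v := row i N in vx1; set v' := row j N' in vx2.
have vN : (v <= N)%MS by apply: row_sub.
have v'N' : (v' <= N')%MS by apply: row_sub.
(* The functional x1 + x2 is 1 on v and v', and 0 on the intersection; w represents
   it, and the last step makes w isotropic by subtracting a multiple of v. *)
pose w := (invmx U *m (x1 + x2))^T.
have wE u : oform u w = (u *m (x1 + x2)) 0 0.
  by rewrite /oform /w trmxK -mulmxA mulKVmx ?gram_unitmx.
have kill (u : 'rV[F]_t) (A : 'M[F]_t) (x : 'cV[F]_t) :
    (u <= A)%MS -> A *m x = 0 -> u *m x = 0.
  by case/submxP=> y -> Ax; rewrite -mulmxA Ax mulmx0.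
have vw : oform v w = 1 by rewrite wE mulmxDr mxE vx1 (kill _ _ _ vN Nx2) mxE addr0.
have v'w : oform v' w = 1 by rewrite wE mulmxDr mxE vx2 (kill _ _ _ v'N' N'x1) mxE add0r.
have v'v : oform v' v = 0.
  rewrite oformC; case/submxP: vN => y ->; case/submxP: v'N' => z ->.
  by rewrite /oform trmx_mul !mulmxA -(mulmxA y) -(mulmxA y) NN' mulmx0 mul0mx mxE.
pose c := oform w w / 2.
exists v, v', (w - c *: v); split=> //.
- rewrite oformBl !oformBr !oformZl !oformZr (oformC w v) vw (isotropic_form isoN vN vN).
  by rewrite !mulr0 mulr1 subr0 -addrA -opprD -mulr2n -mulr_natr /c divfK ?subrr.
- by rewrite oformBr oformZr vw (isotropic_form isoN vN vN) mulr0 subr0.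
split=> [|u]; first by rewrite oformBr oformZr v'w v'v mulr0 subr0.
rewrite sub_capmx => /andP[uN uN']; rewrite oformBr oformZr.
rewrite (isotropic_form isoN uN vN) mulr0 subr0 wE mulmxDr.
by rewrite (kill _ _ _ uN' N'x1) (kill _ _ _ uN Nx2) addr0 mxE.
Qed.

(** Witt's theorem for isotropic subspaces: as long as N differs from N', products
    of at most two reflections enlarge the intersection. *)
Theorem Witt_transitive (N N' : 'M[F]_t) :
    isotropic U N -> isotropic U N' -> \rank N = \rank N' ->
  exists2 g : GLmx F t, g \in Ogrp U & (N *m g^T :=: N')%MS.
Proof.
have [m] := ubnP (\rank N - \rank (N :&: N')%MS)%N.
elim: m N => // m IHm N; rewrite ltnS => le_m isoN isoN' rNN'.
have [sNN'|nNN'] := boolP (N <= N')%MS.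
  exists 1%g; rewrite ?group1 // trmx1 mulmx1; apply/eqmxP.
  by rewrite -(geq_leqif (mxrank_leqif_eq sNN')) rNN'.
have nN'N : ~~ (N' <= N)%MS.
  apply: contra nNN' => sN'N.
  by have := mxrank_leqif_eq sN'N; rewrite rNN' => /leqif_refl/andP[].
have rank_g (g : GLmx F t) : \rank (N *m g^T) = \rank N.
  by rewrite mxrankMfree // row_free_unit unitmx_tr gl_unitmx.
have le_cap (A : 'M[F]_t) : (\rank (A :&: N')%MS <= \rank A)%N by rewrite mxrankS ?capmxSl.
have extend (g : GLmx F t) : g \in Ogrp U ->
    (\rank (N :&: N')%MS < \rank (N *m g^T :&: N')%MS)%N ->
    exists2 g : GLmx F t, g \in Ogrp U & (N *m g^T :=: N')%MS.
  move=> Og lt_cap; have [||||h Oh Nh] := IHm (N *m g^T); rewrite ?rank_g ?isotropic_mul //.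
    by have := le_cap (N *m g^T); rewrite rank_g; lia.
  by exists (h * g)%g; rewrite ?groupM // gl_mxM trmx_mul mulmxA.
have [NN'|nz] := eqVneq (N *m U *m N'^T) 0; last first.
  by have [g Og lt_g] := Witt_step isoN isoN' nz; apply: (extend g).
have [v [v' [w [vN v'N' ww vw [v'w capw]]]]] := Witt_linking isoN NN' nNN' nN'N.
have [|g Og [vg fixg]] := reflection_swap (isotropic_form isoN vN vN) ww.
  by rewrite vw oner_eq0.
have isoNg := isotropic_mul Og isoN.
have [|h Oh lt_h] := Witt_step isoNg isoN'.
  apply/eqP=> N1N'; have /eqP := v'w; rewrite oformC -vg.
  case/submxP: vN => y ->; case/submxP: v'N' => z ->; rewrite -mulmxA.
  rewrite /oform trmx_mul !mulmxA -(mulmxA y) -(mulmxA y) -(mulmxA y).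
  by rewrite N1N' mulmx0 mul0mx mxE eq_sym oner_eq0.
apply: (extend (h * g)%g); rewrite ?groupM // gl_mxM trmx_mul mulmxA.
apply: leq_ltn_trans lt_h; apply: mxrankS.
rewrite sub_capmx capmxSr andbT; set I := (N :&: N')%MS.
suff {1}<- : I *m g^T = I by rewrite submxMr ?capmxSl.
apply/row_matrixP=> k; rewrite row_mul; apply: fixg.
have kI : (row k I <= I)%MS by apply: row_sub.
by rewrite capw // (isotropic_form isoN (submx_trans kI (capmxSl _ _)) vN).
Qed.

End Witt.

(** * Traces on multiplicity spaces *)

Section TraceLemmas.

Variable R : fieldType.

(** The trace of A on the image of the projection X *m b, whose rows are spanned by
    those of b. *)
Lemma trace_image k d (b : 'M[R]_(k, d)) (X : 'M_(d, k)) (A : 'M_d) (S : 'M_k) :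
  b *m X = 1%:M -> b *m A = S *m b -> \tr (X *m b *m A) = \tr S.
Proof.
by move=> bX bA; rewrite -mulmxA bA mxtrace_mulC -mulmxA bX mulmx1.
Qed.

Lemma trace_submod (gT : finGroupType) (G : {group gT}) d
    (rG : mx_representation R G d) (U P : 'M_d) (modU : mxmodule rG U) g :
  (P <= U)%MS -> U *m P = U -> g \in G ->
  \tr (submod_repr modU g) = \tr (P *m rG g).
Proof.
move=> sPU UP Gg; set b := val_submod (1%:M : 'M_(\rank U)).
have bP : b *m P = b.
  have /submxP[W ->] : (b <= U)%MS by rewrite val_submodP.
  by rewrite -mulmxA UP.
rewrite -(@trace_image _ _ b (in_submod U P) (rG g)).
- by rewrite -val_submodE in_submodK.
- by rewrite in_submodE mulmxA -in_submodE bP val_submodK.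
by rewrite -val_submodJ // mul1mx val_submodE.
Qed.

Lemma lin_mulmxE m n p (A : 'M[R]_(m, n)) (W : 'M_(n, p)) :
  mxvec W *m lin_mulmx A = mxvec (A *m W).
Proof. by rewrite mul_vec_lin. Qed.

Lemma lin_mulmxrE m n p (A : 'M[R]_(n, p)) (W : 'M_(m, n)) :
  mxvec W *m lin_mulmxr A = mxvec (W *m A).
Proof. by rewrite mul_vec_lin. Qed.

(** The matrix of W |-> A W B on all matrices is the tensor product of A and B. *)
Lemma trace_two_sided m n (A : 'M[R]_m) (B : 'M_n) :
  \tr (lin_mulmx A *m lin_mulmxr B) = \tr A * \tr B.
Proof.
rewrite /mxtrace (reindex _ (curry_mxvec_bij m n)) /=.
rewrite mulr_suml (eq_bigr (fun i => \sum_j A i i * B j j)); last first.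
  by move=> i _; rewrite mulr_sumr.
rewrite pair_bigA /=; apply: eq_bigr => [[i j]] _ /=.
have -> (C : 'M_(m * n)) k l : C k l = ((delta_mx 0 k : 'rV_(m * n)) *m C) 0 l.
  by rewrite -rowE mxE.
rewrite mulmxA -mxvec_delta lin_mulmxE lin_mulmxrE mxvecE mxE.
rewrite (bigD1 j) //= big1 ?addr0 => [|l lj].
  rewrite mxE (bigD1 i) //= mxE !eqxx mulr1 big1 ?addr0 // => l li.
  by rewrite mxE (negPf li) mulr0.
rewrite mxE big1 ?mul0r // => l' _.
by rewrite mxE (negPf lj) andbF mulr0.
Qed.

End TraceLemmas.

Section MultiplicitySpaces.

Variables (gT hT : finGroupType) (G : {group gT}) (H : {group hT}) (N : nat).
Variable M : mx_representation algC (setX_group G H) N.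

Lemma setX_mem g h : g \in G -> h \in H -> (g, h) \in setX_group G H.
Proof. by move=> Gg Hh; rewrite inE /= Gg Hh. Qed.

Lemma setX_reprM g g' h h' : g \in G -> g' \in G -> h \in H -> h' \in H ->
  M (g, h) *m M (g', h') = M ((g * g')%g, (h * h')%g).
Proof. by move=> Gg Gg' Hh Hh'; rewrite -repr_mxM ?setX_mem. Qed.

(** The trace on the multiplicity space Hom_G(rho, M) is that of the averaging
    projection of all matrices onto the intertwiners. *)
Lemma mult_repr_trace d (rho : mx_representation algC G d) h : h \in H ->
  cfRepr (mult_repr M rho) h =
    #|G|%:R^-1 * \sum_(g in G) \tr (rho g^-1%g) * \tr (M (g, h)).
Proof.
move=> Hh; rewrite cfunE Hh mulr1n.
pose T g : 'M_(d * N) := lin_mulmx (rho g^-1%g) *m lin_mulmxr (M (g, 1%g)).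
pose P := #|G|%:R^-1 *: \sum_(g in G) T g.
have G_nz : #|G|%:R != 0 :> algC by apply: neq0CG.
have TE g W : mxvec W *m T g = mxvec (rho g^-1%g *m W *m M (g, 1%g)).
  by rewrite mulmxA lin_mulmxE lin_mulmxrE.
have UP : intertwiners M rho *m P = intertwiners M rho.
  apply/row_matrixP=> i; rewrite row_mul; set w := row i _.
  have /sub_bigcapmxP wU : (w <= intertwiners M rho)%MS by apply: row_sub.
  rewrite -[w]vec_mxK -scalemxAr mulmx_sumr (eq_bigr (fun=> w)).
    by rewrite sumr_const -scaler_nat scalerA mulVf // scale1r vec_mxK.
  move=> g Gg; have /sub_kermxP := wU g Gg.
  rewrite -[w]vec_mxK mulmxBr lin_mulmxE lin_mulmxrE => /eqP.
  rewrite subr_eq0 => /eqP/(can_inj mxvecK) eW.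
  by rewrite TE mxvecK -mulmxA -eW mulmxA -repr_mxM ?groupV // mulVg repr_mx1 mul1mx.
have sPU : (P <= intertwiners M rho)%MS.
  apply/row_subP=> i; set w := row i P.
  apply/sub_bigcapmxP=> g0 Gg0; apply/sub_kermxP; rewrite mulmxBr; apply/eqP.
  have -> : w = mxvec (vec_mx (delta_mx 0 i)) *m P by rewrite vec_mxK -rowE.
  rewrite subr_eq0 -!scalemxAr -!scalemxAl !mulmx_sumr !mulmx_suml.
  apply/eqP; congr (_ *: _); rewrite [RHS](reindex_inj (mulIg g0^-1%g)) /=.
  rewrite [RHS](eq_bigl [in G]) => [|g]; last by rewrite groupMr ?groupV.
  apply: eq_bigr => g Gg; rewrite !TE lin_mulmxE lin_mulmxrE.
  rewrite invMg invgK repr_mxM ?groupV // -!mulmxA setX_reprM ?groupM ?groupV //.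
  by rewrite mulgKV mul1g.
rewrite (trace_submod _ sPU UP Hh) -scalemxAl mxtraceZ mulmx_suml raddf_sum /=.
congr (_ * _); apply: eq_bigr => g Gg.
rewrite -trace_two_sided -mulmxA; congr (\tr (_ *m _)).
apply/row_matrixP=> i; rewrite !rowE -(vec_mxK (delta_mx 0 i)) mulmxA !lin_mulmxrE.
by rewrite -mulmxA setX_reprM // mulg1 mul1g.
Qed.

(** The decomposition of M into the tau (x) Hom_G(tau, M), on characters. *)
Lemma trace_expansion g h : g \in G -> h \in H ->
  \tr (M (g, h)) =
    \sum_(tau : Iirr G) 'chi_tau g * cfRepr (mult_repr M 'Chi_tau) h.
Proof.
move=> Gg Hh; have G_nz : #|G|%:R != 0 :> algC by apply: neq0CG.
transitivity (#|G|%:R^-1 * \sum_(x in G)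
    (\sum_tau 'chi[G]_tau g * ('chi_tau x)^* ) * \tr (M (x, h))); last first.
  rewrite mulr_sumr (eq_bigr (fun x => \sum_(tau : Iirr G)
    'chi_tau g * (#|G|%:R^-1 * (('chi_tau x)^* * \tr (M (x, h)))))).
    rewrite exchange_big /=; apply: eq_bigr => tau _.
    rewrite mult_repr_trace // -mulr_sumr -mulr_sumr; congr (_ * (_ * _)).
    apply: eq_bigr => x Gx; congr (_ * _).
    by rewrite -irr_inv -irrRepr cfunE groupV Gx mulr1n.
  move=> x Gx; rewrite mulr_suml mulr_sumr; apply: eq_bigr => tau _.
  by rewrite -mulrA mulrCA.
rewrite (eq_bigr (fun x => (if x \in g ^: G then #|'C_G[g]|%:R * \tr (M (g, h)) else 0))).
  rewrite -big_mkcondr /= (eq_bigl [in g ^: G]) => [|x].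
    rewrite sumr_const -[_ *+ #|g ^: G|]mulr_natl [X in _ * X]mulrA -natrM mulrA -index_cent1.
    by rewrite mulnC Lagrange ?subsetIl // mulVf ?mul1r.
  by apply: andb_idl => /imsetP[y Gy ->]; rewrite groupJ.
move=> x Gx; rewrite second_orthogonality_relation // class_sym.
case: ifP => [/imsetP[y Gy ->]|_]; last by rewrite mul0r.
rewrite mulr1n; congr (_ * _).
have -> : M ((g ^ y)%g, h) = M (y^-1%g, 1%g) *m (M (g, h) *m M (y, 1%g)).
  by rewrite !setX_reprM ?groupM ?groupV // mulg1 mul1g.
rewrite mxtrace_mulC -mulmxA setX_reprM ?groupV //.
by rewrite mulgV mulg1 (repr_mx1 M) mulmx1.
Qed.

Fact snd_mx_repr : mx_repr H (fun h => M (1%g, h)).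
Proof.
split=> [|h k Hh Hk]; first exact: (repr_mx1 M).
by rewrite setX_reprM // mulg1.
Qed.
Definition snd_repr := MxRepresentation snd_mx_repr.

End MultiplicitySpaces.

(** * Isotypic projections in the group algebra *)

Section GroupAlgebra.

Variables (gT : finGroupType) (G : {group gT}).

(** The action of the element sum_x c(x) x of the group algebra. *)
Definition gop (c : gT -> algC) d (rG : gT -> 'M[algC]_d) : 'M_d :=
  \sum_(x in G) c x *: rG x.

(** The central idempotent attached to the irreducible character i. *)
Definition eop (i : Iirr G) : forall d, (gT -> 'M[algC]_d) -> 'M_d :=
  gop (fun x => 'chi_i 1%g / #|G|%:R * 'chi_i x^-1%g).

Lemma gop_intertwine c d e (rG : gT -> 'M_d) (rG' : gT -> 'M_e) (f : 'M_(d, e)) :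
  (forall x, x \in G -> rG x *m f = f *m rG' x) ->
  gop c rG *m f = f *m gop c rG'.
Proof.
move=> fJ; rewrite mulmx_suml mulmx_sumr; apply: eq_bigr => x Gx.
by rewrite -scalemxAl -scalemxAr fJ.
Qed.

Lemma trace_gop c d (rG : gT -> 'M_d) (A : 'M_d) :
  \tr (A *m gop c rG) = \sum_(x in G) c x * \tr (A *m rG x).
Proof.
rewrite mulmx_sumr raddf_sum; apply: eq_bigr => x _ /=.
by rewrite -scalemxAr mxtraceZ.
Qed.

(** Schur orthogonality, as the convolution of two irreducible characters. *)
Lemma sum_irr_conv i j z : z \in G ->
  \sum_(x in G) 'chi[G]_i x^-1%g * 'chi_j (x * z)%g =
    (i == j)%:R * (#|G|%:R / 'chi_i 1%g) * 'chi_i z.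
Proof.
move=> Gz; have G_nz : #|G|%:R != 0 :> algC by apply: neq0CG.
have /(congr1 ( *%R #|G|%:R)) := generalized_orthogonality_relation z j i.
rewrite mulrA mulfV // mul1r => E.
rewrite (eq_bigr (fun x => 'chi_j (x * z)%g * 'chi_i x^-1%g)); last first.
  by move=> x _; rewrite mulrC.
rewrite {}E eq_sym; case: eqP => [->|_]; last by rewrite !mul0r mulr0.
by rewrite !mul1r mulrA mulrAC.
Qed.

Lemma cfun_swap (phi : 'CF(G)) x y : x \in G -> phi (x * y)%g = phi (y * x)%g.
Proof. by move=> Gx; rewrite -(cfunJ phi _ Gx) conjgE mulgA mulKg. Qed.

Variables (d : nat) (rG : mx_representation algC G d).

Lemma eopM i j : eop i rG *m eop j rG = if i == j then eop i rG else 0.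
Proof.
have G_nz : #|G|%:R != 0 :> algC by apply: neq0CG.
pose a (k : Iirr G) := 'chi_k 1%g / #|G|%:R.
transitivity (\sum_(z in G) (a i * a j *
    \sum_(x in G) 'chi_i x^-1%g * 'chi_j (x * z^-1)%g) *: rG z).
  rewrite mulmx_suml (eq_bigr (fun x => \sum_(z in G)
    (a i * a j * ('chi_i x^-1%g * 'chi_j (x * z^-1)%g)) *: rG z)).
    rewrite exchange_big; apply: eq_bigr => z Gz /=.
    by rewrite -scaler_suml mulr_sumr.
  move=> x Gx; rewrite mulmx_sumr (reindex_inj (mulgI x^-1%g)) /=.
  rewrite (eq_bigl [in G]) => [|z]; last by rewrite groupMl ?groupV.
  apply: eq_bigr => z Gz; rewrite -scalemxAl -scalemxAr scalerA -repr_mxM ?groupM ?groupV //.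
  rewrite invMg invgK (cfun_swap 'chi_j _ Gx); congr (_ *: _).
    by rewrite /a mulrACA.
  by rewrite mulKVg.
under eq_bigr => z Gz do rewrite sum_irr_conv ?groupV //.
have [<-{j}|ne_ij] := eqVneq i j; last first.
  by rewrite big1 // => z _; rewrite !mul0r mulr0 scale0r.
apply: eq_bigr => z Gz; congr (_ *: _).
by rewrite mul1r /a; field; rewrite G_nz irr1_neq0.
Qed.

Lemma eop_central i y : y \in G -> rG y *m eop i rG = eop i rG *m rG y.
Proof.
move=> Gy; rewrite mulmx_suml mulmx_sumr [RHS](reindex_inj (conjg_inj y^-1%g)) /=.
rewrite [RHS](eq_bigl [in G]) => [|x]; last by rewrite groupJr ?groupV.
apply: eq_bigr => x Gx; rewrite -scalemxAl -scalemxAr -!repr_mxM ?groupJ ?groupV //.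
by rewrite -conjVg cfunJ ?groupV // conjgE invgK mulgA mulgKV.
Qed.

(** The sum of the conjugates of a is central, so that it acts on the i-th isotypic
    part by a scalar, which is found by taking the trace on 'Chi_i. *)
Lemma eop_class_sum i a : a \in G ->
  eop i rG *m (\sum_(x in G) rG (x * a * x^-1)%g) =
    (#|G|%:R * 'chi_i a / 'chi_i 1%g) *: eop i rG.
Proof.
move=> Ga; pose chi := cfRepr 'Chi_i; pose C := \sum_(x in G) 'Chi_i (x * a * x^-1)%g.
have [c Dc] : exists c, C = c%:M.
  apply/is_scalar_mxP/(mx_abs_irr_cent_scalar (groupC (socle_irr _))).
  apply/centgmxP=> y Gy; rewrite mulmx_suml mulmx_sumr.
  rewrite (reindex_inj (mulgI y)) /= (eq_bigl [in G]) => [|x]; last by rewrite groupMl.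
  apply: eq_bigr => x Gx; rewrite -!repr_mxM ?groupM ?groupV //.
    by congr ('Chi_i _); rewrite invMg !mulgA mulgKV.
  by rewrite groupM.
have chiE : {in G, forall x, \tr ('Chi_i x) = 'chi_i x}.
  by move=> x Gx; rewrite -irrRepr cfunE Gx mulr1n.
have c1 : c * 'chi_i 1%g = #|G|%:R * 'chi_i a.
  have /(congr1 mxtrace) := Dc; rewrite mxtrace_scalar irr1_degree mulr_natr => <-.
  rewrite raddf_sum (eq_bigr (fun=> 'chi_i a)) ?sumr_const ?mulr_natl // => x Gx /=.
  by rewrite chiE ?groupM ?groupV // -{1}[x]invgK -mulgA -conjgE cfunJ ?groupV.
have -> : #|G|%:R * 'chi_i a / 'chi_i 1%g = c by rewrite -c1 mulfK ?irr1_neq0.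
have conv w : w \in G -> \sum_(x in G) 'chi_i (x * a * x^-1 * w)%g = c * 'chi_i w.
  move=> Gw; rewrite -chiE // -mxtraceZ -mul_scalar_mx -Dc mulmx_suml raddf_sum /=.
  apply: eq_bigr => x Gx; rewrite -repr_mxM ?groupM ?groupV //.
  by rewrite chiE ?groupM ?groupV.
rewrite scaler_sumr mulmx_suml.
rewrite (eq_bigr (fun y => \sum_(x in G) ('chi_i 1%g / #|G|%:R * 'chi_i y^-1%g) *:
   rG (y * (x * a * x^-1))%g)); last first.
  move=> y Gy; rewrite mulmx_sumr; apply: eq_bigr => x Gx.
  by rewrite -scalemxAl -repr_mxM ?groupM ?groupV.
rewrite exchange_big /=.
rewrite (eq_bigr (fun x => \sum_(z in G) ('chi_i 1%g / #|G|%:R *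
   'chi_i (x * a * x^-1 * z^-1)%g) *: rG z)); last first.
  move=> x Gx; rewrite (reindex_inj (mulIg (x * a * x^-1)^-1%g)) /=.
  rewrite (eq_bigl [in G]) => [|z]; last by rewrite groupMr ?groupV ?groupM ?groupV.
  by apply: eq_bigr => z Gz; rewrite mulgKV [((z * _)^-1)%g]invMg invgK.
rewrite exchange_big; apply: eq_bigr => z Gz /=.
rewrite -scaler_suml -mulr_sumr conv ?groupV // scalerA; congr (_ *: _).
by rewrite mulrCA.
Qed.

(** The average z of the conjugates of gop c is central, hence a scalar on the i-th
    isotypic part; the scalar is not zero because the trace of gop c is not, while
    z kills u. *)
Lemma eop_killed i c (u : 'rV_d) :
    \tr (gop c 'Chi_i) != 0 -> u *m eop i rG = u ->
    (forall x, x \in G -> u *m rG x *m gop c rG = 0) ->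
  u = 0.
Proof.
move=> nz ue u0; pose z := \sum_(x in G) rG x *m gop c rG *m rG x^-1%g.
have uz : u *m z = 0.
  rewrite mulmx_sumr big1 // => x Gx.
  by rewrite !mulmxA u0 ?mul0mx.
have ez : eop i rG *m z = (#|G|%:R * \tr (gop c 'Chi_i) / 'chi_i 1%g) *: eop i rG.
  rewrite /z (eq_bigr (fun x => \sum_(a in G) c a *: rG (x * a * x^-1)%g)).
    rewrite exchange_big mulmx_sumr /=.
    rewrite -[gop c 'Chi_i]mul1mx trace_gop mulr_sumr mulr_suml scaler_suml.
    apply: eq_bigr => a Ga; rewrite -scaler_sumr -scalemxAr eop_class_sum //.
    rewrite scalerA mul1mx -irrRepr cfunE Ga mulr1n; congr (_ *: _).
    by rewrite [X in _ = X / _]mulrCA -!mulrA.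
  move=> x Gx; rewrite mulmx_sumr mulmx_suml; apply: eq_bigr => a Ga.
  by rewrite -scalemxAr -scalemxAl -!repr_mxM ?groupM ?groupV.
have /eqP : (#|G|%:R * \tr (gop c 'Chi_i) / 'chi_i 1%g) *: u = 0.
  by rewrite -[u in LHS]ue scalemxAr -ez mulmxA ue.
rewrite scaler_eq0 !mulf_eq0 invr_eq0 (negPf (neq0CG G)) (negPf nz).
by rewrite (negPf (irr1_neq0 i)) => /eqP.
Qed.

End GroupAlgebra.

(** * The oscillator representation on Hom(X, U) *)

Section Model.

Variables (F : finFieldType) (n t : nat) (U : orthoSpace F t).
Implicit Types M : 'M[F]_(n, t).

Lemma tr_invmx_gram : (invmx U)^T = invmx U.
Proof. by rewrite trmx_inv gram_sym. Qed.

Lemma invmx_tprod k (A : 'M[F]_t) (B : 'M[F]_k) : A \in unitmx -> B \in unitmx ->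
  (tprod A B \in unitmx) /\ invmx (tprod A B) = tprod (invmx A) (invmx B).
Proof.
move=> uA uB; have E : tprod A B *m tprod (invmx A) (invmx B) = 1%:M.
  by rewrite -tprodE !mulmxV // tprod1.
have [uT _] := mulmx1_unit E; split=> //.
by apply: (can_inj (mulKmx uT)); rewrite E mulmxV.
Qed.

Lemma invmx_dual_id :
  invmx (dual_id U n) = block_mx 1%:M 0 0 (tprod (invmx U) 1%:M).
Proof.
apply: (can_inj (mulKmx (dual_id_unit U n))); rewrite mulmxV ?dual_id_unit //.
rewrite /dual_id mulmx_block !(mul0mx, mulmx0, mul1mx, mulmx1, addr0, add0r).
by rewrite -tprodE mulmxV ?gram_unitmx // mul1mx tprod1 -scalar_mx_block.
Qed.

Lemma dual_pair_mxE g a b c d :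
  dual_pair_mx U g (block_mx a b c d) = block_mx (tprod g a) (tprod (g *m invmx U) b)
    (tprod (U *m g) c) (tprod (U *m g *m invmx U) d) :> 'M_(t * n + t * n).
Proof.
rewrite /dual_pair_mx invmx_dual_id /dual_id /tensor_op.
rewrite block_mxKul block_mxKur block_mxKdl block_mxKdr !mulmx_block.
rewrite !(mul0mx, mulmx0, mul1mx, mulmx1, addr0, add0r) -!tprodE.
by rewrite !mul1mx !mulmx1.
Qed.

Fact tprod_unit (g : GLmx F t) (h : GLmx F n) : tprod g h \in unitmx.
Proof. by case: (invmx_tprod (gl_unitmx g) (gl_unitmx h)). Qed.
Definition gl_tprod g h : GLmx F (t * n) := GLMx (tprod_unit g h).

Lemma invmx_tprodE (A : 'M[F]_t) (B : 'M[F]_n) : A \in unitmx -> B \in unitmx ->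
  invmx (tprod A B) = tprod (invmx A) (invmx B).
Proof. by move=> uA uB; case: (invmx_tprod uA uB). Qed.

Definition gl_gramV : GLmx F t := GLMx (glinv_unit (GLMx (gram_unitmx U))).

(** Under (g, S) |-> g (x) S the generators of Sp(V) and the elements of O(U) become
    generators of Sp(U (x) V), on which the oscillator representation is given. *)
Lemma dual_pair_N A :
  dual_pair U (1%g, gen_N A) = gen_N (tprod (invmx U) A) :> GLmx F (t * n + t * n).
Proof.
apply: val_inj; rewrite /= dual_pair_mxE mul1mx mulmx1 mulmxV ?gram_unitmx //.
by rewrite !tprod1 tprod0r.
Qed.

Lemma dual_pair_D C : dual_pair U (1%g, gen_D C) = gen_D (gl_tprod 1%g C).
Proof.
apply: val_inj; rewrite /= dual_pair_mxE mul1mx mulmx1 mulmxV ?gram_unitmx //.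
by rewrite !tprod0r invmx_tprodE ?unitmx1 ?gl_unitmx ?unitmx_inv ?gram_unitmx // trmx_tprod invmx1 trmx1.
Qed.

Lemma dual_pair_J :
  dual_pair U (1%g, gen_J 1%g) = gen_J (gl_tprod gl_gramV 1%g).
Proof.
apply: val_inj; rewrite /= dual_pair_mxE mul1mx mulmx1 mulmxV ?gram_unitmx //.
by rewrite !tprod0r invmx_tprodE ?unitmx1 ?gl_unitmx ?unitmx_inv ?gram_unitmx // /= invmxK tprodNr invmx1.
Qed.

Lemma dual_pair_g g : g \in Ogrp U ->
  dual_pair U (g, 1%g) = gen_D (gl_tprod g (1%g : GLmx F n)).
Proof.
move=> Og; apply: val_inj; rewrite /= (scalar_mx_block n n 1) dual_pair_mxE.
rewrite !tprod0r invmx_tprodE ?unitmx1 ?gl_unitmx ?unitmx_inv ?gram_unitmx // trmx_tprod invmx1 trmx1; congr (block_mx _ _ _ (tprod _ _)).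
apply: (can_inj (mulmxK (gram_unitmx U))); rewrite mulmxKV ?gram_unitmx //.
have := Ogrp_row Og => gU; apply: (can_inj (mulKmx (_ : g^T \in unitmx))).
  by rewrite unitmx_tr gl_unitmx.
by rewrite !mulmxA gU trmx_inv mulmxV ?mul1mx // unitmx_tr gl_unitmx.
Qed.

(** The basis of L^2(Hom(X, U)): a map X -> U is the n x t matrix M whose rows are
    the images of the standard basis. *)
Definition ix M : 'I_#|{: 'cV[F]_(t * n)}| := enum_rank (vecT (M *m U)).
Definition dl M : 'rV[algC]_#|{: 'cV[F]_(t * n)}| := delta_mx 0 (ix M).

Lemma vecTU_inj : injective (fun M => vecT (M *m U)).
Proof. by move=> M M' /vecT_inj/(can_inj (mulmxK (gram_unitmx U))). Qed.

Lemma ix_inj : injective ix.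
Proof. by move=> M M' /enum_rank_inj/vecTU_inj. Qed.

Lemma vecTU_bij : bijective (fun M => vecT (M *m U)).
Proof. by apply: inj_card_bij vecTU_inj _; rewrite !card_mx muln1 mulnC. Qed.

Lemma ix_bij : bijective ix.
Proof. by apply: inj_card_bij ix_inj _; rewrite card_ord !card_mx muln1 mulnC. Qed.

Lemma ixP k : exists M, k = ix M.
Proof. by have [f _ fK] := ix_bij; exists (f k). Qed.

Lemma eq_dl (v w : 'rV[algC]_#|{: 'cV[F]_(t * n)}|) :
  (forall M, v 0 (ix M) = w 0 (ix M)) -> v = w.
Proof. by move=> vw; apply/rowP=> k; have [M ->] := ixP k. Qed.

Lemma eq_dl_mx k (A B : 'M[algC]_(#|{: 'cV[F]_(t * n)}|, k)) :
  (forall M, dl M *m A = dl M *m B) -> A = B.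
Proof.
by move=> AB; apply/row_matrixP=> i; have [M ->] := ixP i; rewrite !rowE AB.
Qed.

Lemma dlE M M' : dl M 0 (ix M') = (M' == M)%:R.
Proof. by rewrite mxE eqxx (inj_eq ix_inj). Qed.

Lemma dl_mulE M (A : 'M_#|{: 'cV[F]_(t * n)}|) M' :
  (dl M *m A) 0 (ix M') = A (ix M) (ix M').
Proof. by rewrite -rowE mxE. Qed.

Lemma mul_dl (A B : 'M[algC]_#|{: 'cV[F]_(t * n)}|) M M' :
  (A *m B) (ix M) (ix M') = \sum_M1 A (ix M) (ix M1) * B (ix M1) (ix M').
Proof. by rewrite mxE (reindex ix) //=; apply: onW_bij ix_bij. Qed.

Lemma dl_sum (v : 'rV_#|{: 'cV[F]_(t * n)}|) : v = \sum_M v 0 (ix M) *: dl M.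
Proof.
apply: eq_dl => M; rewrite summxE (bigD1 M) //= big1 => [|M' neM].
  by rewrite addr0 mxE dlE eqxx mulr1.
by rewrite mxE dlE eq_sym (negPf neM) mulr0.
Qed.

Lemma trace_dl (A : 'M[algC]_#|{: 'cV[F]_(t * n)}|) : \tr A = \sum_M A (ix M) (ix M).
Proof. by rewrite /mxtrace (reindex ix) //; apply: onW_bij ix_bij. Qed.

(** The sum of the basis over a coset of Hom(X, N); for N isotropic and M with
    values in its orthogonal these vectors span the image of
    L^2(Hom(X, orthog N / N)). *)
Definition cosetv (N : 'M[F]_t) M : 'rV[algC]_#|{: 'cV[F]_(t * n)}| :=
  \sum_(Y : 'M[F]_(n, t) | (Y <= N)%MS) dl (M + Y).

Lemma bil_vecT (B : 'M[F]_n) M M' :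
  bil (tprod (invmx U) B) (vecT (M *m U)) (vecT (M' *m U)) = \tr (B *m M *m U *m M'^T).
Proof.
rewrite /bil -mulmxA tprod_vecT vecT_dot mxE eqxx mulr1n tr_invmx_gram.
have -> : B *m (M *m U) *m invmx U = B *m M by rewrite mulmxA mulmxK ?gram_unitmx.
by rewrite trmx_mul gram_sym mxtrace_mulC !mulmxA.
Qed.

Variables (p : nat) (pcharFp : p \in [pchar F]).
Variable mu : mx_representation algC (Sp F (t * n)) #|{: 'cV[F]_(t * n)}|.
Hypothesis mu_osc : oscillator pcharFp mu.
Local Notation om := (omega pcharFp).
Local Notation W := (howe_repr U mu).

Lemma muE h i M : mu h i (ix M) = (mu h *m delta (vecT (M *m U))) i 0.
Proof. by rewrite -colE mxE. Qed.

Lemma deltaE M M' : delta (vecT (M' *m U)) (ix M) 0 = (M == M')%:R :> algC.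
Proof. by rewrite mxE andbT (inj_eq ix_inj). Qed.

(** The operators act on columns in the oscillator representation; the formulas
    below are for row vectors, i.e., for the transposed operators. *)
Lemma howe_N A M : A^T = A ->
  dl M *m W (1%g, gen_N A) = om (2^-1 * \tr (A *m M *m U *m M^T)) *: dl M.
Proof.
move=> sA; apply: eq_dl => M'; rewrite dl_mulE [RHS]mxE dlE.
rewrite [LHS](_ : _ = mu (dual_pair U (1%g, gen_N A)) (ix M) (ix M')) //.
rewrite dual_pair_N muE (osc_N mu_osc) ?trmx_tprod ?tr_invmx_gram ?sA //.
by rewrite mxE bil_vecT deltaE eq_sym; case: eqP => [->|]; rewrite ?mulr0.
Qed.

Lemma det_tprod_l (g : 'M[F]_t) : \det (tprod g (1%:M : 'M[F]_n)) = \det g ^+ n.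
Proof. by rewrite det_tprodC det_tprod1. Qed.

Lemma howe_D C M :
  dl M *m W (1%g, gen_D C) = ell (\det C ^+ t) *: dl (C^T *m M).
Proof.
apply: eq_dl => M'; rewrite dl_mulE [RHS]mxE dlE.
rewrite [LHS](_ : _ = mu (dual_pair U (1%g, gen_D C)) (ix M) (ix M')) //.
rewrite dual_pair_D muE (osc_D mu_osc) invmx_tprodE ?unitmx1 ?gl_unitmx ?unitmx_inv ?gram_unitmx // trmx_tprod invmx1 trmx1.
rewrite tprod_vecT trmx1 mulmx1 mulmxA mxE deltaE /= det_tprod1; congr (_ * (_ : bool)%:R).
by apply/eqP/eqP => ->; rewrite mulmxA -trmx_mul ?mulmxV ?mulVmx ?gl_unitmx // trmx1 mul1mx.
Qed.

Lemma howe_g g M : g \in Ogrp U ->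
  dl M *m W (g, 1%g) = ell (\det g ^+ n) *: dl (M *m (g^-1)%g^T).
Proof.
move=> Og; apply: eq_dl => M'; rewrite dl_mulE [RHS]mxE dlE.
rewrite [LHS](_ : _ = mu (dual_pair U (g, 1%g)) (ix M) (ix M')) //.
rewrite dual_pair_g // muE (osc_D mu_osc) invmx_tprodE ?unitmx1 ?gl_unitmx ?unitmx_inv ?gram_unitmx // trmx_tprod invmx1 trmx1.
rewrite tprod_vecT trmxK mul1mx mxE /= det_tprod_l; congr (_ * _).
have -> : M' *m U *m invmx g = M' *m g^T *m U.
  apply: (can_inj (mulmxK (gl_unitmx g))); rewrite mulmxKV ?gl_unitmx //.
  by rewrite -!mulmxA (mulmxA g^T) Ogrp_row.
rewrite deltaE /=; congr ((_ : bool)%:R).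
by apply/eqP/eqP => ->; rewrite -mulmxA -trmx_mul ?mulmxV ?mulVmx ?gl_unitmx // trmx1 mulmx1.
Qed.

Definition gam := gaussB pcharFp (tprod (invmx U) (1%:M : 'M[F]_n)).

Lemma howe_J M : dl M *m W (1%g, gen_J 1%g) =
  gam^-1 *: \sum_M' om (\tr (M *m U *m M'^T)) *: dl M'.
Proof.
apply: eq_dl => M'; rewrite dl_mulE.
rewrite [LHS](_ : _ = mu (dual_pair U (1%g, gen_J 1%g)) (ix M) (ix M')) //.
rewrite dual_pair_J muE (osc_J mu_osc) /=; last by rewrite trmx_tprod tr_invmx_gram trmx1.
rewrite [LHS]mxE [RHS]mxE; congr (_ * _); rewrite !summxE.
rewrite (reindex _ (onW_bij _ vecTU_bij)) (bigD1 M) //= [RHS](bigD1 M') //=.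
rewrite !big1 ?addr0 => [|M1 ne1|M1 ne1].
- by rewrite mxE deltaE mxE dlE !eqxx bil_vecT mul1mx -mxtrace_tr !trmx_mul trmxK gram_sym mulmxA.
- by rewrite mxE dlE eq_sym (negPf ne1) mulr0.
by rewrite mxE deltaE eq_sym (negPf ne1) mulr0.
Qed.

Lemma howe_NE A M M' : A^T = A -> W (1%g, gen_N A) (ix M) (ix M') =
  om (2^-1 * \tr (A *m M *m U *m M^T)) * (M' == M)%:R.
Proof. by move=> sA; rewrite -dl_mulE howe_N // mxE dlE. Qed.

Lemma howe_DE C M M' : W (1%g, gen_D C) (ix M) (ix M') =
  ell (\det C ^+ t) * (M' == C^T *m M)%:R.
Proof. by rewrite -dl_mulE howe_D mxE dlE. Qed.

Lemma howe_JE M M' : W (1%g, gen_J 1%g) (ix M) (ix M') =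
  gam^-1 * om (\tr (M *m U *m M'^T)).
Proof.
rewrite -dl_mulE howe_J mxE summxE; congr (_ * _).
rewrite (bigD1 M') //= big1 ?addr0 => [|M1 ne]; first by rewrite mxE dlE eqxx mulr1.
by rewrite mxE dlE eq_sym (negPf ne) mulr0.
Qed.

Lemma gamE : gam = \sum_(M : 'M[F]_(n, t)) om (- 2^-1 * \tr (M *m U *m M^T)).
Proof.
rewrite /gam /gaussB (reindex _ (onW_bij _ vecTU_bij)); apply: eq_bigr => M _ /=.
by rewrite bil_vecT mul1mx.
Qed.

End Model.

(** * Functions on Hom(X, Y) invariant under Sp(V), for Y split *)

Section SplitInvariants.

Variables (F : finFieldType) (p : nat) (pcharFp : p \in [pchar F]).
Hypothesis p_odd : odd p.
Local Notation om := (omega pcharFp).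
Local Notation q := #|F|.

Lemma two_neq0 : (2 : F) != 0.
Proof.
rewrite -(dvdn_pcharf pcharFp); apply/negP => /dvdn_leq-/(_ isT).
have p_pr := pcharf_prime pcharFp.
by have := prime_gt1 p_pr; case: (p) p_odd => [|[|[|]]].
Qed.

Variables (n t m : nat) (Q : 'M[F]_m).
Hypotheses (m2t : m = (t + t)%N) (le_tn : (t <= n)%N).
Hypotheses (symQ : Q^T = Q) (uQ : Q \in unitmx).
Hypothesis gaussQ : \sum_(w : 'rV[F]_m) om (2^-1 * (w *m Q *m w^T) 0 0) = q%:R ^+ t.

Definition pairQ k (Z Z' : 'M[F]_(k, m)) : F := \tr (Z *m Q *m Z'^T).

(** Functions on Hom(X, Y), for the split orthogonal space Y of dimension 2t with
    form Q, which are invariant under Sp(V): those supported on the isotropic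
    maps, invariant under GL(X) and equal to their Fourier transform. *)
Record split_inv (K : 'M[F]_(n, m) -> algC) : Prop := SplitInv {
  si_supp : forall Z, K Z != 0 -> Z *m Q *m Z^T = 0;
  si_GL : forall (C : 'M_n) Z, C \in unitmx -> K (C *m Z) = K Z;
  si_four : forall Z, q%:R ^+ (t * n) * K Z = \sum_Z' om (pairQ Z Z') * K Z' }.

Lemma pairQDl k (Z1 Z2 Z : 'M_(k, m)) : pairQ (Z1 + Z2) Z = pairQ Z1 Z + pairQ Z2 Z.
Proof. by rewrite /pairQ !mulmxDl mxtraceD. Qed.

Lemma pairQC k (Z Z' : 'M_(k, m)) : pairQ Z Z' = pairQ Z' Z.
Proof. by rewrite /pairQ -mxtrace_tr !trmx_mul trmxK symQ mulmxA. Qed.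

Lemma pairQDr k (Z1 Z2 Z : 'M_(k, m)) : pairQ Z (Z1 + Z2) = pairQ Z Z1 + pairQ Z Z2.
Proof. by rewrite ![pairQ Z _]pairQC pairQDl. Qed.

Lemma pairQNl k (Z Z' : 'M_(k, m)) : pairQ (- Z) Z' = - pairQ Z Z'.
Proof. by rewrite /pairQ !mulNmx raddfN. Qed.

Lemma pairQNr k (Z Z' : 'M_(k, m)) : pairQ Z (- Z') = - pairQ Z Z'.
Proof. by rewrite ![pairQ Z _]pairQC pairQNl. Qed.

Lemma pairQ_mul k l (A : 'M_(k, l)) (Z : 'M_(l, m)) Z' :
  pairQ (A *m Z) Z' = pairQ Z (A^T *m Z').
Proof. by rewrite /pairQ trmx_mul trmxK -!mulmxA mxtrace_mulC !mulmxA. Qed.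

Lemma pairQ_nondeg k (Z : 'M_(k, m)) :
  (forall Z', om (pairQ Z Z') = 1) -> Z = 0.
Proof.
move=> Z1; apply: (can_inj (mulmxK uQ)); rewrite mul0mx; apply/matrixP=> i j.
rewrite [RHS]mxE; apply/eqP/(omega_trivP pcharFp) => a.
rewrite -(Z1 (a *: delta_mx i j)) /pairQ linearZ /= trmx_delta -scalemxAr mxtraceZ.
by rewrite mxtrace_mul_delta.
Qed.

Lemma qE k : #|{: 'rV[F]_k}|%:R = q%:R ^+ k :> algC.
Proof. by rewrite card_mx mul1n natrX. Qed.

Lemma q_neq0 k : q%:R ^+ k != 0 :> algC.
Proof. by rewrite expf_neq0 // pnatr_eq0 -lt0n; apply/card_gt0P; exists 0. Qed.

Let oh : F := 2^-1.
Definition quadQ (v : 'rV[F]_m) : F := pairQ v v.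

Lemma quadQE v : quadQ v = (v *m Q *m v^T) 0 0.
Proof. by rewrite /quadQ /pairQ trace_mx11. Qed.

Lemma quadQD v w : quadQ (v + w) = quadQ v + quadQ w + 2 * pairQ v w.
Proof. by rewrite /quadQ !pairQDl !pairQDr (pairQC w v); ring. Qed.

(** The operator of the unipotent element of Sp(V) attached to x (x) x is, up to a
    constant, the convolution with a Gaussian along x (x) Y. *)
Section RankOne.

Variables (x : 'cV[F]_n) (y : 'rV[F]_n).
Hypothesis yx : y *m x = 1%:M.

Let S (Y : 'M[F]_(n, m)) := \sum_Z' om (pairQ Y Z' + oh * quadQ (x^T *m Z')).

Lemma rank1_sum0 Y : Y != x *m (y *m Y) -> S Y = 0.
Proof.
move=> neY; have [A nzA] : exists A, om (pairQ Y (A - y^T *m (x^T *m A))) != 1.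
  have [/existsP //|/existsPn H] := boolP [exists A : 'M_(n, m),
    om (pairQ Y (A - y^T *m (x^T *m A))) != 1].
  case/negP: neY; rewrite -subr_eq0; apply/eqP/pairQ_nondeg => A.
  have := H A; rewrite negbK => /eqP <-; congr (om _).
  rewrite pairQDl pairQNl pairQDr; congr (_ + _).
  by rewrite mulmxA pairQ_mul trmx_mul -mulmxA pairQNr.
set A0 := A - _ in nzA.
have xA0 : x^T *m A0 = 0.
  by rewrite mulmxBr !mulmxA -trmx_mul yx trmx1 mul1mx subrr.
apply/eqP/contraT => nzS; case/negP: nzA; apply/eqP/(mulIf nzS).
rewrite mul1r /S mulr_sumr [RHS](reindex_inj (addrI A0)) /=.
apply: eq_bigr => Z _; rewrite mulmxDr xA0 add0r (pairQDr A0).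
by rewrite -(omegaD pcharFp) addrA.
Qed.

Lemma rank1_sum v : q%:R ^+ m * S (x *m v) = q%:R ^+ (n * m + t) * om (- (oh * quadQ v)).
Proof.
pose g w := om (pairQ v w + oh * quadQ w).
have -> : S (x *m v) = \sum_Z' g (x^T *m Z').
  by apply: eq_bigr => Z _; rewrite pairQ_mul.
transitivity (\sum_(w : 'rV_m) \sum_Z' g (x^T *m Z' + w)).
  rewrite -qE -sumr_const mulr_suml; apply: eq_bigr => w _; rewrite mul1r.
  rewrite (reindex_inj (addIr (y^T *m w))) /=; apply: eq_bigr => Z _.
  by rewrite mulmxDr (mulmxA x^T) -trmx_mul yx trmx1 mul1mx.
rewrite exchange_big /= (eq_bigr (fun=> \sum_w g w)) => [|Z _]; last first.
  by rewrite [RHS](reindex_inj (addrI (x^T *m Z))).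
rewrite sumr_const card_mx -[_ *+ (_ ^ _)]mulr_natl natrX exprD -mulrA; congr (_ * _).
rewrite -gaussQ mulr_suml [RHS](reindex_inj (addrI v)) /=; apply: eq_bigr => w _.
rewrite /g -(omegaD pcharFp) -quadQE quadQD -/oh; congr (om _).
have oh2 : oh * 2 = 1 by rewrite mulVf ?two_neq0.
by rewrite !mulrDr mulrA oh2 mul1r; ring.
Qed.

Lemma split_inv_gauss K Z : split_inv K ->
  q%:R ^+ t * K Z = \sum_v om (- (oh * quadQ v)) * K (Z - x *m v).
Proof.
move=> invK; have [suppK GLK fourK] := invK.
have KN Z' : K (- Z') = K Z'.
  by rewrite -scaleN1r -mul_scalar_mx GLK // unitmxE det_scalar unitrX ?unitrN1.
apply: (mulfI (q_neq0 (n * m + t))).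
transitivity (q%:R ^+ m * (q%:R ^+ (t * n) * (q%:R ^+ (t * n) * K Z))).
  by rewrite !mulrA -!exprD; congr (_ ^+ _ * _); rewrite m2t; lia.
rewrite fourK mulr_sumr.
transitivity (q%:R ^+ m * \sum_Y K (Z - Y) * S Y).
  congr (_ * _); transitivity (\sum_Z' \sum_Z'' K Z'' *
     om (pairQ (Z - Z'') Z' + oh * quadQ (x^T *m Z'))).
    apply: eq_bigr => Z' _; rewrite mulrCA.
    have -> : q%:R ^+ (t * n) * K Z' = om (oh * quadQ (x^T *m Z')) *
        (q%:R ^+ (t * n) * K Z').
      have [->|/suppK ZZ] := eqVneq (K Z') 0; first by rewrite !mulr0.
      rewrite quadQE trmx_mul trmxK -!mulmxA (mulmxA Z') (mulmxA (Z' *m Q)) ZZ.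
      by rewrite mul0mx mulmx0 mxE mulr0 omega0 ?mul1r.
    rewrite fourK !mulr_sumr (reindex_inj oppr_inj) /=; apply: eq_bigr => Z'' _.
    rewrite KN !mulrA mulrC; congr (_ * _).
    rewrite -!(omegaD pcharFp) pairQDl pairQNl pairQNr.
    by rewrite (pairQC Z''); congr (om _); ring.
  rewrite exchange_big (reindex_inj (addrI Z)) /= (reindex_inj oppr_inj) /=.
  apply: eq_bigr => Y _; rewrite -mulr_sumr; congr (_ * _).
  by apply: eq_bigr => Z' _; rewrite subKr.
rewrite (bigID (fun Y => Y == x *m (y *m Y))) /= addrC big1 ?add0r; last first.
  by move=> Y /rank1_sum0 ->; rewrite mulr0.
rewrite (reindex_onto (fun v => x *m v) (fun Y => y *m Y)) /=; last first.
  by move=> Y /eqP.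
rewrite !mulr_sumr; apply: eq_big => [v|v _].
  by rewrite (mulmxA y x) yx mul1mx !eqxx.
by rewrite mulrCA rank1_sum mulrCA [K _ * _]mulrC.
Qed.

End RankOne.

(** Descending recursion: the value at a map of rank s < t is a multiple of the
    sum of values at maps of larger rank, since for v in the image of Z the
    translate Z - x v has the same image as Z. *)
Lemma split_inv_step K Z : split_inv K -> (\rank Z < t)%N ->
  (forall Z', (\rank Z < \rank Z')%N -> K Z' = 0) -> K Z = 0.
Proof.
move=> invK lt_s K0; apply/eqP/contraT => nzK.
have ZZ := si_supp invK nzK.
have [y yZ [x yx]] : exists2 y : 'rV[F]_n, y *m Z = 0 & exists x, y *m x = 1%:M.
  have : kermx Z != 0.
    by rewrite -mxrank_eq0 mxrank_ker subn_eq0 -ltnNge (leq_trans lt_s).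
  case/rowV0Pn=> y /sub_kermxP yZ nzy; exists y => //.
  have [j nzj] : exists j, y 0 j != 0.
    by apply/rV0Pn.
  exists (delta_mx j 0 *m ((y 0 j)^-1)%:M); apply/matrixP=> a b; rewrite !ord1.
  by rewrite mulmxA -colE mul_mx_scalar !mxE mulVf.
(* For v = w Z, Z - x v = (1 - x w') Z with w' x = 0. *)
have same v : (v <= Z)%MS -> K (Z - x *m v) = K Z.
  case/submxP=> w ->; pose w' := w - (w *m x) *m y.
  have -> : w *m Z = w' *m Z by rewrite mulmxBl -[w *m x *m y *m Z]mulmxA yZ mulmx0 subr0.
  have w'x : w' *m x = 0 by rewrite mulmxBl -[w *m x *m y *m x]mulmxA yx mulmx1 subrr.
  clearbody w'; rewrite mulmxA -{1}[Z]mul1mx -mulmxBl (si_GL invK) //.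
  have : (1%:M - x *m w') *m (1%:M + x *m w') = 1%:M.
    rewrite mulmxBl mul1mx mulmxDr mulmx1 -[x *m w' *m _]mulmxA (mulmxA w' x) w'x.
    by rewrite mul0mx mulmx0 addr0 addrK.
  by case/mulmx1_unit.
have quad0 v : (v <= Z)%MS -> quadQ v = 0.
  case/submxP=> w ->; rewrite quadQE trmx_mul !mulmxA -(mulmxA w) -(mulmxA w) ZZ.
  by rewrite mulmx0 mul0mx mxE.
have := split_inv_gauss yx Z invK.
rewrite (bigID (fun v => v <= Z)%MS) /= [X in _ + X]big1 ?addr0 => [|v nv]; last first.
  rewrite K0 ?mulr0 //; apply: rank_ltmx; rewrite /ltmx.
  have vZ : (v <= Z - x *m v)%MS.
    have Dv : v = - (y *m (Z - x *m v)).
      by rewrite mulmxBr yZ sub0r mulmxA yx mul1mx opprK.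
    by rewrite [X in (X <= _)%MS]Dv eqmx_opp submxMl.
  rewrite -{1}[Z](subrK (x *m v)) addmx_sub ?mulmx_sub //=.
  by apply: contra nv => /(submx_trans vZ).
rewrite (eq_bigr (fun=> K Z)) => [|v vZ]; last first.
  by rewrite quad0 // mulr0 oppr0 omega0 mul1r same.
rewrite sumr_const -[K Z *+ _]mulr_natl => E0.
have /eqP := mulIf nzK E0; rewrite -natrX eqr_nat => /eqP E.
have : (q ^ t <= q ^ \rank Z)%N.
  rewrite E; have <- : #|{: 'rV[F]_(\rank Z)}| = (q ^ \rank Z)%N by rewrite card_mx mul1n.
  apply: (@leq_trans #|[set u *m row_base Z | u in [set: 'rV_(\rank Z)]]|).
    apply: subset_leq_card; apply/subsetP=> v; rewrite -topredE /=.
    by rewrite -(eq_row_base Z) => /submxP[u ->]; apply/imsetP; exists u; rewrite ?inE.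
  by apply: leq_trans (leq_imset_card _ _) _; rewrite cardsT.
by rewrite leq_exp2l ?finNzRing_gt1 // leqNgt lt_s.
Qed.

Lemma isotropic_rank_le k (Z : 'M[F]_(k, m)) : Z *m Q *m Z^T = 0 -> (\rank Z <= t)%N.
Proof.
rewrite -mulmxA => /sub_kermxP/mxrankS; rewrite mxrank_ker.
have -> : \rank (Q *m Z^T) = \rank Z.
  by rewrite -mxrank_tr trmx_mul trmxK symQ mxrankMfree ?row_free_unit.
by move: (rank_leq_col Z) m2t; lia.
Qed.

(** By descending induction on the rank, as an isotropic map has rank at most t. *)
Lemma split_inv0 K : split_inv K -> (forall Z, \rank Z = t -> K Z = 0) ->
  forall Z, K Z = 0.
Proof.
move=> invK Kt Z; have [k] := ubnP (t - \rank Z)%N; elim: k Z => // k IHk Z.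
rewrite ltnS => le_k; case: (ltngtP (\rank Z) t) => [lt|gt|]; last exact: Kt.
  by apply: split_inv_step => // Z' ltZ; apply: IHk; lia.
apply/eqP/contraT => /(si_supp invK)/isotropic_rank_le.
by rewrite leqNgt gt.
Qed.

Lemma split_inv_comb (I : finType) (P : pred I) K (c : I -> algC) K' :
  split_inv K -> (forall i, P i -> split_inv (K' i)) ->
  split_inv (fun Z => K Z - \sum_(i | P i) c i * K' i Z).
Proof.
move=> invK invK'; split=> [Z|C Z uC|Z].
- apply: contraNeq => nzZ; have [->|/(si_supp invK)/eqP] := eqVneq (K Z) 0; last first.
    by rewrite (negPf nzZ).
  rewrite sub0r oppr_eq0 big1 // => i Pi.
  have [->|/(si_supp (invK' i Pi))/eqP] := eqVneq (K' i Z) 0; first by rewrite mulr0.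
  by rewrite (negPf nzZ).
- rewrite (si_GL invK) //; congr (_ - _); apply: eq_bigr => i Pi.
  by rewrite (si_GL (invK' i Pi)).
rewrite mulrBr (si_four invK); under [RHS]eq_bigr => Z' _ do rewrite mulrBr.
rewrite sumrB; congr (_ - _); under [RHS]eq_bigr => Z' _ do rewrite mulr_sumr.
rewrite exchange_big mulr_sumr; apply: eq_bigr => i Pi /=.
rewrite mulrCA (si_four (invK' i Pi)) mulr_sumr; apply: eq_bigr => Z' _.
by rewrite mulrCA.
Qed.

Lemma lagrangianP (L : 'M[F]_m) k (Z : 'M_(k, m)) : L *m Q *m L^T = 0 -> \rank L = t ->
  (Z <= L)%MS = (Z *m Q *m L^T == 0).
Proof.
move=> LL rL; have sLK : (L <= kermx (Q *m L^T))%MS.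
  by apply/sub_kermxP; rewrite mulmxA.
have /eqmxP eqLK : (L == kermx (Q *m L^T))%MS.
  rewrite -(geq_leqif (mxrank_leqif_eq sLK)) mxrank_ker rL.
  have -> : \rank (Q *m L^T) = t.
    by rewrite -mxrank_tr trmx_mul trmxK symQ mxrankMfree ?row_free_unit.
  by rewrite leq_subLR m2t.
by rewrite eqLK; apply/sub_kermxP/eqP; rewrite mulmxA.
Qed.

(** The characteristic function of Hom(X, L) for a Lagrangian L is invariant; its
    Fourier transform is supported on the orthogonal of L, which is L. *)
Lemma split_inv_lagrangian (L : 'M[F]_m) : L *m Q *m L^T = 0 -> \rank L = t ->
  split_inv (fun Z => (Z <= L)%MS%:R).
Proof.
move=> LL rL; split=> [Z|C Z uC|Z].
- case ZL: (Z <= L)%MS; rewrite ?eqxx // => _; case/submxP: ZL => D ->.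
  by rewrite trmx_mul !mulmxA -(mulmxA D) -(mulmxA D) LL mulmx0 mul0mx.
- by rewrite (eqmxMfull _ (_ : row_full C)) // row_full_unit.
transitivity (\sum_(Z' : 'M_(n, m) | (Z' <= L)%MS) om (pairQ Z Z')); last first.
  rewrite big_mkcond; apply: eq_bigr => Z' _.
  by case: ifP; rewrite ?mulr1 ?mulr0.
case ZL: (Z <= L)%MS.
  rewrite mulr1 (eq_bigr (fun=> 1)) => [|Z' /submxP[D ->]]; last first.
    move: ZL; rewrite lagrangianP // => /eqP ZL.
    by rewrite /pairQ trmx_mul !mulmxA ZL mul0mx mxtrace0 omega0.
  rewrite sumr_const -natrX; congr (_%:R).
  have -> : (q ^ (t * n))%N = #|{: 'M[F]_(n, \rank L)}| by rewrite card_mx rL mulnC.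
  have inj : injective (fun D : 'M_(n, \rank L) => D *m row_base L).
    by apply: row_free_inj; rewrite row_base_free.
  rewrite -(card_imset _ inj); apply: eq_card => Z'; rewrite -[RHS]topredE /=.
  have -> : (Z' <= L)%MS = (Z' <= row_base L)%MS by rewrite eq_row_base.
  apply/imsetP/idP => [[D _ ->]|/submxP[D ->]].
    by rewrite submxMl.
  by exists D.
rewrite mulr0; apply/esym/eqP/contraT => nzS.
have [Z0 [Z0L nzZ0]] : exists Z0, (Z0 <= L)%MS /\ om (pairQ Z Z0) != 1.
  have [/existsP[Z0 /andP[]]|/existsPn H] := boolP [exists Z0 : 'M_(n, m),
    (Z0 <= L)%MS && (om (pairQ Z Z0) != 1)]; first by exists Z0.
  move/negbT: ZL; rewrite lagrangianP //; case/negP; apply/eqP/matrixP=> i j.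
  rewrite [RHS]mxE; apply/eqP/(omega_trivP pcharFp) => a.
  have := H ((a *: delta_mx i j) *m L); rewrite submxMl negbK => /eqP <-.
  rewrite /pairQ trmx_mul mulmxA linearZ /= trmx_delta -scalemxAr mxtraceZ.
  by rewrite mxtrace_mul_delta.
case/negP: nzZ0; apply/eqP/(mulIf nzS); rewrite mul1r mulr_sumr.
rewrite [RHS](reindex_inj (addrI Z0)) /=; apply: eq_big => [Z'|Z' _].
  apply/idP/idP => [Z'L|ZZ]; first by rewrite addmx_sub.
  by rewrite -[Z'](addKr Z0) addmx_sub ?eqmx_opp.
by rewrite -(omegaD pcharFp) pairQDr.
Qed.

End SplitInvariants.

(** * Operators commuting with Sp(V) *)

Section Commutant.

Variables (F : finFieldType) (p : nat) (pcharFp : p \in [pchar F]).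
Hypothesis p_odd : odd p.
Local Notation om := (omega pcharFp).
Local Notation q := #|F|.
Variables (n t : nat) (le_tn : (t <= n)%N) (U : orthoSpace F t).
Variable mu : mx_representation algC (Sp F (t * n)) #|{: 'cV[F]_(t * n)}|.
Hypothesis mu_osc : oscillator pcharFp mu.
Local Notation W := (howe_repr U mu).

(** U + (-U), the sum of U and its opposite. *)
Definition splitQ : 'M[F]_(t + t) := block_mx U 0 0 (- (U : 'M_t)).

Lemma splitQ_sym : splitQ^T = splitQ.
Proof. by rewrite /splitQ tr_block_mx !trmx0 linearN /= gram_sym. Qed.

Lemma splitQ_unit : splitQ \in unitmx.
Proof.
rewrite unitmxE det_ublock unitrM -!unitmxE gram_unitmx /=.
by rewrite -scaleN1r unitmxZ ?gram_unitmx ?unitrN1.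
Qed.

Lemma splitQE k l (A B : 'M[F]_(k, t)) (C D : 'M_(l, t)) :
  row_mx A B *m splitQ *m (row_mx C D)^T = A *m U *m C^T - B *m U *m D^T.
Proof.
rewrite /splitQ mul_row_block !mulmx0 addr0 add0r tr_row_mx mul_row_col.
by rewrite mulmxN mulNmx.
Qed.

(** On the vectors (d + w, w) the quadratic form is linear in w. *)
Lemma splitQ_gauss :
  \sum_(w : 'rV[F]_(t + t)) om (2^-1 * (w *m splitQ *m w^T) 0 0) = q%:R ^+ t.
Proof.
have two := two_neq0 pcharFp p_odd.
pose f (u : 'rV[F]_t * 'rV[F]_t) := row_mx (u.1 + u.2) u.2.
have bij_f : bijective f.
  exists (fun w : 'rV[F]_(t + t) => (lsubmx w - rsubmx w, rsubmx w) : 'rV_t * 'rV_t)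
    => [[a b]|w].
    by rewrite /f /= row_mxKl row_mxKr addrK.
  by rewrite /f /= subrK hsubmxK.
rewrite (reindex f) /=; last exact: onW_bij.
transitivity (\sum_(d : 'rV[F]_t) \sum_(w : 'rV[F]_t)
    om (2^-1 * oform U d d) * om (\tr (d *m U *m w^T))).
  rewrite pair_bigA; apply: eq_bigr => [[d w]] _ /=.
  rewrite /f /= splitQE -omegaD; congr (om _).
  rewrite trace_mx11 -/(oform U d w) [LHS](_ : _ =
    2^-1 * (oform U (d + w) (d + w) - oform U w w)); last first.
    by congr (_ * _); rewrite mxE [X in _ + X]mxE.
  have D u v u' : oform U (u + v) u' = oform U u u' + oform U v u'.
    by rewrite /oform !mulmxDl mxE.
  rewrite D !(oformC U _ (d + w)) !D (oformC U w d).
  by field.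
rewrite (bigD1 0) //= [X in _ + X]big1 ?addr0 => [|d nzd].
  rewrite (eq_bigr (fun=> 1)) => [|w _].
    by rewrite sumr_const card_mx mul1n natrX.
  by rewrite /oform !mul0mx mxtrace0 mxE mulr0 omega0 mulr1.
rewrite -mulr_sumr (eq_bigr (fun w : 'rV_t => om (\tr (U *m d^T *m w)))).
  rewrite sum_omega_mx ifF ?mulr0 //; apply: contraNF nzd => /eqP Ud.
  by rewrite -[d]trmxK -[d^T](mulKmx (gram_unitmx U)) Ud mulmx0 trmx0.
move=> w _; congr (om _); rewrite -mxtrace_tr !trmx_mul trmxK gram_sym.
by rewrite mxtrace_mulC.
Qed.

Variable e : 'M[algC]_#|{: 'cV[F]_(t * n)}|.
Hypothesis eC : forall h, h \in Sp F n -> e *m W (1%g, h) = W (1%g, h) *m e.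

Let K (Z : 'M[F]_(n, t + t)) := e (ix U (lsubmx Z)) (ix U (rsubmx Z)).

(** The trace pairing of symmetric matrices is non-degenerate in odd
    characteristic. *)
Lemma sym_separation (S : 'M[F]_n) : S^T = S ->
  (forall A : 'M_n, A^T = A -> om (2^-1 * \tr (A *m S)) = 1) -> S = 0.
Proof.
move=> sS S1; apply/matrixP=> i j; rewrite [RHS]mxE.
apply/eqP/(omega_trivP pcharFp) => a.
rewrite -(S1 (a *: (delta_mx i j + delta_mx j i))); last first.
  by rewrite linearZ linearD /= !trmx_delta addrC.
rewrite -scalemxAl mxtraceZ mulmxDl mxtraceD ![\tr (delta_mx _ _ *m _)]mxtrace_mulC.
rewrite !mxtrace_mul_delta -[in S j i]sS mxE; congr (om _).
by field; apply: two_neq0 p_odd.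
Qed.

Lemma kernel_supp M M' : e (ix U M) (ix U M') != 0 -> M *m U *m M^T = M' *m U *m M'^T.
Proof.
move=> nz; apply/eqP; rewrite -subr_eq0; apply/eqP.
have sym (X : 'M[F]_(n, t)) : (X *m U *m X^T)^T = X *m U *m X^T.
  by rewrite !trmx_mul trmxK gram_sym mulmxA.
apply: sym_separation => [|A sA]; first by rewrite linearB /= !sym.
have /(congr1 (fun X : 'M_#|{: 'cV[F]_(t * n)}| => X (ix U M) (ix U M'))) := eC (gen_N_Sp sA).
rewrite /= !mul_dl (bigD1 M') //= [X in _ + X]big1 => [|M1 ne1]; last first.
  by rewrite (howe_NE U mu_osc) // eq_sym (negPf ne1) !mulr0.
rewrite (howe_NE U mu_osc) // eqxx mulr1 addr0 (bigD1 M) //= big1; last first.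
  by move=> M1 ne1; rewrite (howe_NE U mu_osc) // (negPf ne1) mulr0 mul0r.
rewrite (howe_NE U mu_osc) // eqxx mulr1 addr0 mulrC.
move/(mulIf nz) => E; rewrite mulmxBr raddfB mulrBr /= omegaD omegaN !mulmxA -E.
by rewrite divff // omega_neq0.
Qed.

Lemma ell_neq0 (x : F) : ell x != 0.
Proof. by rewrite /ell; case: ifP; rewrite ?oppr_eq0 oner_eq0. Qed.

Lemma kernel_GL (C : 'M_n) M M' : C \in unitmx ->
  e (ix U (C *m M)) (ix U (C *m M')) = e (ix U M) (ix U M').
Proof.
rewrite -unitmx_tr => uC; pose g := GLMx uC.
have /(congr1 (fun X : 'M_#|{: 'cV[F]_(t * n)}| => X (ix U M) (ix U (C *m M')))) :=
  eC (gen_D_Sp g).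
have inj : injective (mulmx C : 'M_(n, t) -> _) by apply/can_inj/mulKmx; rewrite -unitmx_tr.
rewrite /= !mul_dl (bigD1 M') //= [X in _ + X]big1 => [|M1 ne1]; last first.
  by rewrite (howe_DE U mu_osc) trmxK (inj_eq inj) eq_sym (negPf ne1) !mulr0.
rewrite (howe_DE U mu_osc) trmxK eqxx mulr1 addr0 (bigD1 (C *m M)) //= big1; last first.
  by move=> M1 ne1; rewrite (howe_DE U mu_osc) trmxK (negPf ne1) mulr0 mul0r.
rewrite (howe_DE U mu_osc) trmxK eqxx mulr1 addr0 mulrC.
by move/(mulfI (ell_neq0 _))/esym.
Qed.

(** Otherwise J would act by zero. *)
Lemma gam_neq0 : gam n U pcharFp != 0.
Proof.
have := howe_J U mu_osc 0; case: eqP => // ->; rewrite invr0 scale0r.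
have := repr_mxK W (setX_mem (group1 (Ogrp U)) (gen_J_Sp F n)).
move=> JK J0; have := JK _ (dl U (0 : 'M_(n, t))); rewrite J0 mul0mx => /esym.
by move/rowP/(_ (ix U 0)); rewrite dlE mxE eqxx => /eqP; rewrite oner_eq0.
Qed.

Lemma kernel_J M M' :
  \sum_M1 om (\tr (M *m U *m M1^T)) * e (ix U M1) (ix U M') =
  \sum_M1 e (ix U M) (ix U M1) * om (\tr (M1 *m U *m M'^T)).
Proof.
have /(congr1 (fun X : 'M_#|{: 'cV[F]_(t * n)}| => X (ix U M) (ix U M'))) := eC (gen_J_Sp F n).
rewrite /= !mul_dl => E; apply: (mulfI (invr_neq0 gam_neq0)).
rewrite !mulr_sumr; apply: etrans (etrans _ (esym E)) _; apply: eq_bigr => M1 _.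
  by rewrite (howe_JE U mu_osc) mulrA.
by rewrite (howe_JE U mu_osc) mulrCA.
Qed.

Lemma pairUC (M M' : 'M[F]_(n, t)) : \tr (M *m U *m M'^T) = \tr (M' *m U *m M^T).
Proof. by rewrite -mxtrace_tr !trmx_mul trmxK gram_sym mulmxA. Qed.

(** Commutation with the N_A, with GL(X) and with J gives the three conditions. *)
Lemma kernel_inv : split_inv pcharFp t splitQ K.
Proof.
split=> [Z|C Z uC|Z].
- move/kernel_supp/eqP; rewrite -subr_eq0 => /eqP E.
  by rewrite -{1 2}[Z]hsubmxK splitQE.
- by rewrite /K -[Z]hsubmxK mul_mx_row !row_mxKl !row_mxKr kernel_GL.
rewrite -[Z]hsubmxK; set M := lsubmx Z; set M' := rsubmx Z.
pose g (u : 'M[F]_(n, t) * 'M[F]_(n, t)) := row_mx u.1 u.2.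
have bij_g : bijective g.
  exists (fun w : 'M[F]_(n, t + t) => (lsubmx w, rsubmx w) : 'M_(n, t) * 'M_(n, t)).
    by case=> a b; rewrite /g /= row_mxKl row_mxKr.
  by move=> w; rewrite /g /= hsubmxK.
rewrite [RHS](reindex g) /=; last exact: onW_bij.
transitivity (\sum_(M1 : 'M[F]_(n, t)) \sum_(M2 : 'M[F]_(n, t))
   om (\tr (M *m U *m M1^T)) * e (ix U M1) (ix U M2) * om (- \tr (M2 *m U *m M'^T))).
  rewrite exchange_big /=; under eq_bigr => M2 _ do rewrite -mulr_suml kernel_J mulr_suml.
  rewrite exchange_big /= (bigD1 M') //= [X in _ + X]big1 ?addr0 => [|M1 ne1].
    rewrite (eq_bigr (fun=> e (ix U M) (ix U M'))) => [|M2 _].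
      rewrite sumr_const -[RHS]mulr_natl /K row_mxKl row_mxKr; congr (_ * _).
      by rewrite -natrX; congr (_%:R); rewrite mulnC -card_mx.
    by rewrite -mulrA -omegaD (pairUC M2 M') subrr omega0 mulr1.
  rewrite (eq_bigr (fun M2 => e (ix U M) (ix U M1) * om (\tr ((M1 - M') *m U *m M2^T)))).
    rewrite -mulr_sumr (eq_bigr (fun M2 => om (\tr (U *m (M1 - M')^T *m M2)))).
      rewrite sum_omega_mx ifF ?mulr0 //; apply: contraNF ne1 => /eqP U0.
      rewrite -subr_eq0; apply/eqP/trmx_inj/(can_inj (mulKmx (gram_unitmx U))).
      by rewrite U0 trmx0 mulmx0.
    move=> M2 _; congr (om _); rewrite -mxtrace_tr !trmx_mul !trmxK gram_sym.
    by rewrite mxtrace_mulC.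
  move=> M2 _; rewrite -mulrA -omegaD (pairUC M2 M'); congr (_ * om _).
  by rewrite !mulmxBl raddfB.
rewrite pair_bigA; apply: eq_bigr => [[M1 M2]] _ /=.
rewrite /K /g /= row_mxKl row_mxKr mulrAC -omegaD; congr (om _ * _).
by rewrite /pairQ splitQE raddfB /= (pairUC M2).
Qed.

Hypothesis e_top : forall M, \rank M = t -> dl U M *m e = 0.
Hypothesis e_cosetv : forall (N : 'M[F]_t) M, isotropic U N -> N != 0 ->
  (M <= orthog U N)%MS -> cosetv U N M *m e = 0.

Let lagr (L : 'M[F]_(t + t)) :=
  [&& L == <<L>>%MS, L *m splitQ *m L^T == 0 & \rank L == t].

(** A map X -> U + (-U) with image the Lagrangian L. *)
Let Zof (L : 'M[F]_(t + t)) : 'M[F]_(n, t + t) :=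
  (pid_mx (\rank L) : 'M_(n, \rank L)) *m row_base L.

Let ZofE L : lagr L -> (Zof L :=: L)%MS.
Proof.
case/and3P=> _ _ /eqP rL; apply: eqmx_trans (eqmxMfull _ _) (eq_row_base L).
by rewrite /row_full rank_pid_mx // rL.
Qed.

(** The difference of the two sides vanishes on the maps of rank t, hence is zero. *)
Let kernel_decomp Z : K Z = \sum_(L | lagr L) K (Zof L) * (Z <= L)%MS%:R.
Proof.
apply/eqP; rewrite -subr_eq0; apply/eqP; move: Z.
have inv : split_inv pcharFp t splitQ
    (fun Z => K Z - \sum_(L | lagr L) K (Zof L) * (Z <= L)%MS%:R).
  apply: split_inv_comb kernel_inv _ => L /and3P[_ /eqP LL /eqP rL].
  by apply: split_inv_lagrangian; rewrite ?splitQ_sym ?splitQ_unit.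
apply: (split_inv0 p_odd _ le_tn splitQ_sym splitQ_unit splitQ_gauss inv) => // Z rZ.
have [ZZ|nzZ] := eqVneq (Z *m splitQ *m Z^T) 0; last first.
  by apply/eqP/contraT => /(si_supp inv)/eqP; rewrite (negPf nzZ).
have lagZ : lagr <<Z>>%MS.
  rewrite /lagr genmx_id eqxx /= genmxE rZ eqxx andbT.
  have /submxP[D ->] : (<<Z>> <= Z)%MS by rewrite genmxE.
  by rewrite trmx_mul !mulmxA -(mulmxA D) -(mulmxA D) ZZ mulmx0 mul0mx.
rewrite (bigD1 <<Z>>%MS) //= big1 ?addr0 => [|L /andP[lagL neL]].
  rewrite genmxE submx_refl mulr1; apply/eqP; rewrite subr_eq0; apply/eqP.
  have /eqmxMunitP[C uC ->] : (Zof <<Z>> == Z)%MS.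
    by apply/eqmxP; apply: eqmx_trans (ZofE lagZ) (genmxE Z).
  by rewrite (si_GL kernel_inv).
case ZL: (Z <= L)%MS; rewrite ?mulr0 //; case/negP: neL.
case/and3P: lagL => /eqP LE _ /eqP rL; rewrite [L]LE; apply/eqP/esym/genmxP.
by rewrite -(geq_leqif (mxrank_leqif_eq ZL)) rL rZ.
Qed.

(** By kernel_decomp e is a combination of the operators with kernels the
    characteristic functions of the Hom(X, L), for the Lagrangians L of U + (-U). If
    L is the graph of an isometry then its coefficient is an entry of e at a map of
    rank t, which is zero. Otherwise L contains 0 + N for a non-zero isotropic N, and
    its operator takes values in the span of the cosetv N, which e kills. *)
Lemma commutant_square_zero : e *m e = 0.
Proof.
apply: (@eq_dl_mx _ _ _ U) => M; rewrite mulmx0 mulmxA [dl U M *m e](dl_sum U).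
rewrite mulmx_suml.
under eq_bigr => M' _ do rewrite dl_mulE.
have eE M' : e (ix U M) (ix U M') =
    \sum_(L | lagr L) K (Zof L) * (row_mx M M' <= L)%MS%:R.
  by rewrite -kernel_decomp /K row_mxKl row_mxKr.
under eq_bigr => M' _ do rewrite eE scaler_suml mulmx_suml.
rewrite exchange_big big1 //= => L lagL; have eqZL := ZofE lagL.
case/and3P: lagL => _ /eqP LL /eqP rL.
have subL k (Z : 'M[F]_(n, t + t)) (Z' : 'M[F]_(k, t + t)) :
    (Z <= L)%MS -> (Z' <= L)%MS -> Z *m splitQ *m Z'^T = 0.
  move=> /submxP[D ->] /submxP[D' ->].
  by rewrite trmx_mul !mulmxA -(mulmxA D) -(mulmxA D) LL mulmx0 mul0mx.
have [rL1|rL1] := eqVneq (\rank (lsubmx L)) t.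
  apply: big1 => M' _; suff -> : K (Zof L) = 0 by rewrite mul0r scale0r mul0mx.
  rewrite /K -dl_mulE e_top ?mxE //; apply: etrans rL1; apply/eqmx_rank.
  have /eqmxP/andP[/submxP[D ->] /submxP[D' E]] := eqZL.
  apply/andP; split; first by rewrite -mulmx_lsub submxMl.
  by rewrite {1}E -mulmx_lsub submxMl.
pose N := <<kermx (lsubmx L) *m rsubmx L>>%MS.
have NL (Y : 'M[F]_(n, t)) : (Y <= N)%MS = (row_mx 0 Y <= L)%MS.
  rewrite genmxE; apply/submxP/submxP => [[D ->]|[D DL]].
    exists (D *m kermx (lsubmx L)); rewrite -[X in _ = _ *m X]hsubmxK mul_mx_row.
    by rewrite -!(mulmxA D) mulmx_ker mulmx0.
  have [D1 D2] : D *m lsubmx L = 0 /\ D *m rsubmx L = Y.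
    by rewrite mulmx_lsub mulmx_rsub -DL row_mxKl row_mxKr.
  have /sub_kermxP/submxP[D3 D3E] := D1; exists D3.
  by rewrite mulmxA -D3E D2.
have subNL : (row_mx 0 N <= L)%MS.
  have /submxP[D ->] : (N <= kermx (lsubmx L) *m rsubmx L)%MS by rewrite genmxE.
  apply/submxP; exists (D *m kermx (lsubmx L)); rewrite -[X in _ = _ *m X]hsubmxK mul_mx_row.
  by rewrite -!(mulmxA D) mulmx_ker mulmx0.
have [/existsP[M0 M0L]|/existsPn noM] :=
    boolP [exists M' : 'M[F]_(n, t), (row_mx M M' <= L)%MS]; last first.
  by rewrite big1 // => M' _; rewrite (negPf (noM M')) mulr0 scale0r mul0mx.
transitivity (K (Zof L) *: (cosetv U N M0 *m e)); last first.
  rewrite e_cosetv ?scaler0 //.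
  - apply/isotropicP; have /submxP[D DN] := subNL.
    have := splitQE 0 N 0 N; rewrite !mul0mx sub0r DN => /esym/eqP.
    rewrite trmx_mul !mulmxA -(mulmxA D) -(mulmxA D) LL mulmx0 mul0mx oppr_eq0.
    by move/eqP.
  - apply: contraNneq rL1 => /eqP; rewrite -submx0 genmxE submx0 => /eqP N0.
    have kL : kermx (lsubmx L) *m L = 0.
      by rewrite -[X in _ *m X]hsubmxK mul_mx_row mulmx_ker N0 row_mx0.
    have /sub_kermxP/mxrankS := kL; rewrite !mxrank_ker rL => le_k.
    have le1 : (\rank (lsubmx L) <= t)%N by apply: rank_leq_col.
    by rewrite eqn_leq le1 /=; lia.
  have := subL _ _ _ M0L subNL; rewrite splitQE trmx0 mulmx0 sub0r => /eqP.
  by rewrite oppr_eq0 => /eqP M0N; apply/sub_kermxP; rewrite mulmxA.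
rewrite /cosetv mulmx_suml scaler_sumr [RHS]big_mkcond /= (reindex_inj (addrI M0)) /=.
apply: eq_bigr => Y _; rewrite NL.
have -> : (row_mx M (M0 + Y) <= L)%MS = (row_mx 0 Y <= L)%MS.
  have -> : row_mx M (M0 + Y) = row_mx M M0 + row_mx 0 Y by rewrite add_row_mx addr0.
  apply/idP/idP => [H|H]; last by rewrite addmx_sub.
  by rewrite -[row_mx 0 Y](addKr (row_mx M M0)) addmx_sub ?eqmx_opp.
by case: ifP; rewrite ?mulr1 -?scalemxAl // mulr0 scale0r.
Qed.

End Commutant.

(** * Decomposition under the Siegel unipotent radical *)

Section UniqueSummand.

Variables (gT : finGroupType) (G : {group gT}).

(** If a sum of characters is irreducible then it has a single non-zero term. *)
Lemma irr_unique_summand (I : finType) (m : I -> nat) (b : I -> 'CF(G)) :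
    (forall i, b i \is a character) -> \sum_i (b i *+ m i) \in irr G ->
  exists i0, [/\ m i0 = 1%N, b i0 = \sum_i (b i *+ m i) &
    forall i, m i != 0%N -> b i != 0 -> i = i0].
Proof.
move=> bC; set f := \sum_i _ => /irrP[k fk].
have f_l l : \sum_i '[b i, 'chi_l] *+ m i = (k == l)%:R.
  rewrite -cfdot_irr -fk /f cfdot_suml; apply: eq_bigr => i _.
  by rewrite -cfdotMnl.
have c_nat i l : '[b i, 'chi_l] *+ m i \is a Num.nat.
  by rewrite rpredMn // Cnat_cfdot_char_irr.
have f0 l i : k != l -> '[b i, 'chi_l] *+ m i = 0.
  move=> /negPf kl; have /eqP := f_l l; rewrite kl psumr_eq0 => [/allP/(_ i)|j _].
    by rewrite mem_index_enum => /(_ isT)/eqP.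
  exact: natr_ge0.
have := f_l k; rewrite eqxx => /natr_sum_eq1[|i0 [_ i0k others]] //.
have bm0 i : i != i0 -> b i *+ m i = 0.
  move=> ne; rewrite [b i]cfun_sum_cfdot -sumrMnl big1 // => l _.
  rewrite scalerMnl; have [<-|/f0->] := eqVneq k l; last by rewrite scale0r.
  by rewrite others ?scale0r.
have fi0 : f = b i0 *+ m i0.
  by rewrite /f (bigD1 i0) //= big1 ?addr0 // => i /bm0.
have m1 : m i0 = 1%N.
  have : '[b i0, 'chi_k] \is a Num.nat by rewrite Cnat_cfdot_char_irr.
  case/natrP=> c Dc; move: i0k; rewrite Dc -mulrnA => /eqP.
  by rewrite -[1]/(1%:R) eqr_nat muln_eq1 => /andP[_ /eqP].
exists i0; split=> //; first by rewrite fi0 m1.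
move=> i nzm nzb; apply/eqP/contraT => /bm0/eqP.
by rewrite -scaler_nat scaler_eq0 pnatr_eq0 (negPf nzb) orbF (negPf nzm).
Qed.

End UniqueSummand.

Section SiegelProjections.

Variables (F : finFieldType) (p : nat) (pcharFp : p \in [pchar F]).
Hypothesis p_odd : odd p.
Local Notation om := (omega pcharFp).
Variable n : nat.
Implicit Types A B : 'M[F]_n.

Lemma gen_N_mul A A' : (gen_N A * gen_N A')%g = gen_N (A + A').
Proof.
apply: val_inj; rewrite /= mulmx_block.
by rewrite !(mulmx0, mul0mx, mulmx1, mul1mx, addr0, add0r) addrC.
Qed.

Definition symS : {set 'M[F]_n} := [set A | A^T == A].

Lemma symSP A : reflect (A^T = A) (A \in symS).
Proof. by rewrite inE; apply: eqP. Qed.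

Lemma symS0 : (0 : 'M_n) \in symS. Proof. by rewrite inE trmx0. Qed.

Lemma symSD A A' : A \in symS -> (A' + A \in symS) = (A' \in symS).
Proof.
move=> /symSP sA; rewrite !inE linearD /= sA.
by rewrite (can_eq (addrK A)).
Qed.

Lemma symS_nz : #|symS|%:R != 0 :> algC.
Proof. by rewrite pnatr_eq0 -lt0n; apply/card_gt0P; exists 0; apply: symS0. Qed.

(** The coefficients of the projection onto the N_A |-> omega (tr AB) part. *)
Definition coefP B (h : GLmx F (n + n)) : algC :=
  \sum_(A in symS) (#|symS|%:R^-1 * om (- \tr (A *m B))) *+ (h == gen_N A).

Variables (d : nat) (rG : mx_representation algC (Sp F n) d).
Local Notation P B := (gop (Sp F n) (coefP B) rG).

Lemma gopPE B (f : GLmx F (n + n) -> 'M_d) : gop (Sp F n) (coefP B) f =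
  \sum_(A in symS) (#|symS|%:R^-1 * om (- \tr (A *m B))) *: f (gen_N A).
Proof.
rewrite /gop /coefP; under eq_bigr => h _ do rewrite scaler_suml.
rewrite exchange_big; apply: eq_bigr => A /symSP sA /=.
rewrite (bigD1 (gen_N A)) ?gen_N_Sp //= eqxx mulr1n big1 ?addr0 // => h /andP[_ ne].
by rewrite (negPf ne) scale0r.
Qed.

Lemma P_eig B A : A \in symS -> P B *m rG (gen_N A) = om (\tr (A *m B)) *: P B.
Proof.
move=> SA; have sA := symSP _ SA; rewrite gopPE mulmx_suml scaler_sumr.
rewrite [RHS](reindex_inj (addIr A)) /= [RHS](eq_bigl [in symS]) => [|A']; last first.
  exact: symSD.
apply: eq_bigr => A' /symSP sA'; rewrite -scalemxAl -repr_mxM ?gen_N_Sp //.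
rewrite gen_N_mul scalerA; congr (_ *: _); rewrite mulrCA; congr (_ * _).
rewrite -omegaD mulmxDl mxtraceD; congr (om _).
by rewrite opprD addrCA subrr addr0.
Qed.

Lemma P_comm B A : A \in symS -> rG (gen_N A) *m P B = P B *m rG (gen_N A).
Proof.
move=> /symSP sA; rewrite gopPE mulmx_suml mulmx_sumr; apply: eq_bigr => A' /symSP sA'.
rewrite -scalemxAl -scalemxAr -!repr_mxM ?gen_N_Sp //.
by rewrite !gen_N_mul addrC.
Qed.

Lemma P_fix B k (v : 'M_(k, d)) :
  (forall A, A \in symS -> v *m rG (gen_N A) = om (\tr (A *m B)) *: v) ->
  v *m P B = v.
Proof.
move=> vE; rewrite gopPE mulmx_sumr (eq_bigr (fun=> #|symS|%:R^-1 *: v)).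
  by rewrite sumr_const -scaler_nat scalerA divff ?symS_nz // scale1r.
move=> A SA; rewrite -scalemxAr vE // scalerA -mulrA -omegaD addNr.
by rewrite omega0 mulr1.
Qed.

Lemma P_idem B : P B *m P B = P B.
Proof. by apply: P_fix => A; apply: P_eig. Qed.

Lemma occursP B : reflect (P B != 0) (occurs pcharFp rG B).
Proof.
apply: (iffP idP) => [/rowV0Pn[v /sub_bigcapmxP vE nzv]|nzP].
  have vP : v *m P B = v.
    apply: P_fix => A SA; have /symSP/eqP sA := SA.
    by have /eigenspaceP := vE A sA.
  by apply: contraNneq nzv => P0; rewrite -vP P0 mulmx0.
have [v vP nzv] := rowV0Pn nzP; apply/rowV0Pn; exists v => //.
apply/sub_bigcapmxP=> A /eqP sA; apply/eigenspaceP.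
by case/submxP: vP => D ->; rewrite -mulmxA P_eig ?inE ?sA // -scalemxAr.
Qed.

(** Fourier inversion on the symmetric matrices. *)
Lemma sum_P : \sum_(B in symS) P B = 1%:M.
Proof.
under eq_bigr => B _ do rewrite gopPE.
rewrite exchange_big (bigD1 0) ?symS0 //= [X in _ + X]big1 ?addr0.
  rewrite (eq_bigr (fun=> #|symS|%:R^-1 *: 1%:M)).
    by rewrite sumr_const -scaler_nat scalerA divff ?symS_nz // scale1r.
  move=> B _; rewrite mul0mx mxtrace0 oppr0 omega0 mulr1; congr (_ *: _).
  by rewrite -(repr_mx1 rG); congr (rG _); apply: val_inj; rewrite /= -scalar_mx_block.
move=> A /andP[/symSP sA nzA]; rewrite -scaler_suml -mulr_sumr.
suff -> : \sum_(B in symS) om (- \tr (A *m B)) = 0 by rewrite mulr0 scale0r.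
apply/eqP/contraT => nzS; case/negP: nzA; apply/eqP.
apply: (sym_separation p_odd sA (pcharFp := pcharFp)) => B sB.
have SB : - (2^-1 *: B) \in symS by rewrite inE linearN linearZ /= sB.
apply: (mulIf nzS); rewrite mul1r mulr_sumr.
rewrite [RHS](reindex_inj (addIr (- (2^-1 *: B)))) /= [RHS](eq_bigl [in symS]) => [|C].
  apply: eq_bigr => C _; rewrite -omegaD mulmxDr mxtraceD mulmxN raddfN /=.
  by rewrite -scalemxAr mxtraceZ opprD opprK addrC (mxtrace_mulC B).
exact: symSD.
Qed.

Lemma exists_occurs : (0 < d)%N -> exists2 B, B^T = B & occurs pcharFp rG B.
Proof.
move=> d_gt0; have /existsP[B /andP[/symSP sB oB]] :
    [exists B, (B \in symS) && occurs pcharFp rG B]; last by exists B.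
apply/contraT => /existsPn H.
have /(congr1 mxtrace) := sum_P; rewrite big1 => [|B SB].
  by rewrite mxtrace0 mxtrace1 => /esym/eqP; rewrite pnatr_eq0 -leqn0 leqNgt d_gt0.
by have := H B; rewrite SB /=; case: occursP => // /negP; rewrite negbK => /eqP.
Qed.

Lemma occurs_conj (C : GLmx F n) B :
  occurs pcharFp rG (C *m B *m C^T) -> occurs pcharFp rG B.
Proof.
case/rowV0Pn=> v /sub_bigcapmxP vE nzv.
have CT := unitmx_tr C; rewrite gl_unitmx in CT.
pose D := gen_D (glinv (GLMx CT)).
apply/rowV0Pn; exists (v *m rG D); last first.
  by apply: contraNneq nzv => vD; rewrite -(repr_mxK rG (gen_D_Sp (glinv (GLMx CT))) v) vD mul0mx.
apply/sub_bigcapmxP=> A /eqP sA; apply/eigenspaceP.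
pose A' := invmx C^T *m A *m (invmx C^T)^T.
have sA' : A'^T = A' by rewrite /A' !trmx_mul trmxK sA mulmxA.
have DN : (D * gen_N A = gen_N A' * D)%g.
  apply: val_inj; rewrite /= !mulmx_block.
  rewrite !(mulmx0, mul0mx, mulmx1, mul1mx, addr0, add0r) invmxK trmxK /A'.
  by rewrite trmx_inv trmxK mulmxKV ?gl_unitmx.
rewrite -mulmxA -repr_mxM ?gen_D_Sp ?gen_N_Sp // DN repr_mxM ?gen_D_Sp ?gen_N_Sp //.
have /eigenspaceP : (v <= eigenspace (rG (gen_N A')) (om (\tr (A' *m (C *m B *m C^T)))))%MS.
  by apply: vE; apply/eqP.
move=> E; rewrite mulmxA {}E -scalemxAl; congr (om _ *: _).
rewrite /A' trmx_inv trmxK !mulmxA mulmxKV ?gl_unitmx // -!mulmxA mxtrace_mulC.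
by rewrite -!mulmxA mulmxV // mulmx1.
Qed.

End SiegelProjections.

(** * The part of full rank *)

Section TopRank.

Variables (F : finFieldType) (p : nat) (pcharFp : p \in [pchar F]).
Hypothesis p_odd : odd p.
Local Notation om := (omega pcharFp).
Variables (n t : nat) (le_tn : (t <= n)%N) (U : orthoSpace F t).
Variable mu : mx_representation algC (Sp F (t * n)) #|{: 'cV[F]_(t * n)}|.
Hypothesis mu_osc : oscillator pcharFp mu.
Local Notation W := (howe_repr U mu).
Local Notation G := (Ogrp U).
Local Notation H := (Sp F n).
Local Notation Wh := (snd_repr W).
Local Notation P B rG := (gop H (coefP pcharFp B) rG).
Local Notation theta tau := (cfRepr (@Theta F t U n mu tau)).

(** The base point: a map of X onto U. *)
Definition pidM : 'M[F]_(n, t) := pid_mx t.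
Local Notation M0 := pidM.

Lemma pidM_K : M0^T *m M0 = 1%:M.
Proof. by rewrite /M0 tr_pid_mx mul_pid_mx minnn (minn_idPr le_tn) pid_mx_1. Qed.

(** The character of the N_A on dl M0. *)
Definition B0 : 'M[F]_n := 2^-1 *: (M0 *m U *m M0^T).

(** The dl M are eigenvectors of the N_A, and the character is given by half the Gram
    matrix of M. *)
Lemma dl_P B (M : 'M[F]_(n, t)) : B^T = B ->
  dl U M *m P B Wh = if 2^-1 *: (M *m U *m M^T) == B then dl U M else 0.
Proof.
move=> sB; have sM : (2^-1 *: (M *m U *m M^T))^T = 2^-1 *: (M *m U *m M^T).
  by rewrite linearZ /= !trmx_mul trmxK gram_sym mulmxA.
have dlN A : A \in symS F n -> dl U M *m Wh (gen_N A) =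
    om (\tr (A *m (2^-1 *: (M *m U *m M^T)))) *: dl U M.
  by move=> /symSP sA; rewrite (howe_N U mu_osc) // -scalemxAr mxtraceZ !mulmxA.
case: eqP => [<-|neB]; first exact: (P_fix (rG := Wh)).
apply/eqP/contraT => nz; case: neB; apply/eqP; rewrite -subr_eq0; apply/eqP.
apply: (sym_separation p_odd (pcharFp := pcharFp)) => [|A sA].
  by rewrite linearB /= sM sB.
have SA : 2^-1 *: A \in symS F n by rewrite inE linearZ /= sA.
have E : om (\tr (2^-1 *: A *m (2^-1 *: (M *m U *m M^T)))) *: (dl U M *m P B Wh) =
    om (\tr (2^-1 *: A *m B)) *: (dl U M *m P B Wh).
  by rewrite scalemxAl -dlN // -mulmxA (P_comm _ Wh _ SA) (P_eig _ Wh _ SA) scalemxAr.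
have /eqP := E; rewrite -subr_eq0 -scalerBl scaler_eq0 (negPf nz) orbF subr_eq0.
move=> /eqP {}E; rewrite mulmxBr raddfB mulrBr /= omegaD omegaN.
rewrite -!mxtraceZ !(scalemxAl 2^-1 A) E divff // omega_neq0 //.
Qed.

Lemma gram_B0_sym : B0^T = B0.
Proof. by rewrite /B0 linearZ /= !trmx_mul trmxK gram_sym mulmxA. Qed.

Lemma half_inj m1 m2 : injective (fun B : 'M[F]_(m1, m2) => 2^-1 *: B).
Proof. by apply: scalerI; rewrite invr_eq0 (two_neq0 pcharFp). Qed.

(** If M has the Gram matrix of M0 then a = M0^T M is an isometry, and M = M0 a since
    their difference is orthogonal to all of U. *)
Lemma gram_torsor (M : 'M[F]_(n, t)) :
  reflect (exists2 g, g \in G & M = M0 *m g^T) (2^-1 *: (M *m U *m M^T) == B0).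
Proof.
apply: (iffP eqP) => [/half_inj MM|[g Gg ->]]; last first.
  rewrite /B0; congr (_ *: _); rewrite trmx_mul trmxK !mulmxA.
  by rewrite -(mulmxA M0) -(mulmxA M0) [_ *m g](Ogrp_row Gg).
pose a := M0^T *m M.
have aUa : a *m U *m a^T = U.
  rewrite /a trmx_mul trmxK -2!(mulmxA M0^T) (mulmxA (M *m U)) MM.
  by rewrite -!mulmxA pidM_K mulmx1 mulmxA pidM_K mul1mx.
have ua : a \in unitmx.
  have : (a *m U *m a^T) \in unitmx by rewrite aUa gram_unitmx.
  by rewrite !unitmx_mul => /andP[/andP[]].
have uaT : a^T \in unitmx by rewrite unitmx_tr.
have DM : M = M0 *m a.
  apply/eqP; rewrite -subr_eq0; apply/eqP.
  apply: (can_inj (mulmxK (gram_unitmx U))); apply: (can_inj (mulmxK uaT)).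
  rewrite !mul0mx mulmxBl mulmxBl -[X in _ - X]mulmxA -[X in _ - X]mulmxA.
  rewrite [X in M0 *m X]mulmxA aUa /a trmx_mul trmxK !mulmxA MM -!mulmxA pidM_K.
  by rewrite mulmx1 subrr.
exists (GLMx uaT); last by rewrite /= trmxK.
by rewrite inE /= trmxK aUa.
Qed.

(** The linear map of X acting as a on the first t coordinates. *)
Definition lift_mx (a : 'M[F]_t) : 'M[F]_n := M0 *m a *m M0^T + (1%:M - M0 *m M0^T).

Lemma lift_mxE1 a : M0^T *m lift_mx a = a *m M0^T.
Proof.
rewrite /lift_mx mulmxDr mulmxBr !mulmxA pidM_K !mul1mx mulmx1.
by rewrite subrr addr0.
Qed.

Lemma lift_mxE2 a : (lift_mx a)^T *m M0 = M0 *m a^T.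
Proof. by rewrite -[LHS]trmxK trmx_mul trmxK lift_mxE1 trmx_mul trmxK. Qed.

Lemma lift_mxM a b : lift_mx a *m lift_mx b = lift_mx (a *m b).
Proof.
rewrite {1}/lift_mx mulmxDl -mulmxA lift_mxE1 mulmxBl mul1mx -[M0 *m M0^T *m _]mulmxA.
rewrite lift_mxE1 /lift_mx !mulmxA.
by rewrite [X in _ + (X - _)]addrC addrK.
Qed.

Lemma lift_mx1 : lift_mx 1%:M = 1%:M.
Proof. by rewrite /lift_mx mulmx1 addrC subrK. Qed.

Fact lift_unit (g : GLmx F t) : lift_mx g \in unitmx.
Proof.
apply: (proj1 (mulmx1_unit (_ : _ *m lift_mx (invmx g) = _))).
by rewrite lift_mxM mulmxV ?gl_unitmx // lift_mx1.
Qed.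
Definition lift_gl g := GLMx (lift_unit g).
Definition lift_D (g : GLmx F t) := gen_D (lift_gl g).

Lemma gen_D_mul (C C' : GLmx F n) : (gen_D C * gen_D C')%g = gen_D (C * C')%g.
Proof.
apply: val_inj; rewrite /= mulmx_block.
rewrite !(mulmx0, mul0mx, addr0, add0r) -trmx_mul; congr (block_mx _ _ _ _^T).
apply: (can_inj (mulKmx (gl_unitmx (C * C')%g))).
rewrite mulmxV ?(gl_unitmx (C * C')%g) // gl_mxM -mulmxA (mulmxA C').
by rewrite mulmxV ?gl_unitmx // mul1mx mulmxV ?gl_unitmx.
Qed.

Fact lift_D_morphM : {in G &, {morph lift_D : g h / (g * h)%g}}.
Proof.
move=> g h _ _; rewrite /lift_D gen_D_mul; congr gen_D; apply: val_inj.
by rewrite /= lift_mxM.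
Qed.
Canonical lift_D_morphism := Morphism lift_D_morphM.

Fact lift_D_sub : G \subset lift_D @*^-1 H.
Proof. by apply/subsetP=> g Gg; rewrite inE Gg inE gen_D_Sp. Qed.

Definition lift_repr d (rG : mx_representation algC H d) :=
  subg_repr (morphpre_repr lift_D_morphism rG) lift_D_sub.

Lemma lift_P d (rG : mx_representation algC H d) g : g \in G ->
  P B0 rG *m rG (lift_D g) = rG (lift_D g) *m P B0 rG.
Proof.
move=> Gg; rewrite !gopPE mulmx_suml mulmx_sumr.
have dH : lift_D g \in H by apply: gen_D_Sp.
pose C := lift_gl g; pose s A := (C : 'M_n) *m A *m C^T.
have s_inj : injective s.
  move=> A A' /(can_inj (mulmxK (_ : C^T \in unitmx)))H'.
  by apply: (can_inj (mulKmx (gl_unitmx C))); apply: H'; rewrite unitmx_tr gl_unitmx.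
rewrite [LHS](reindex_inj s_inj) /= [LHS](eq_bigl [in symS F n]) => [|A].
  apply: eq_bigr => A /symSP sA; rewrite -scalemxAl -[RHS]scalemxAr.
  have sCA : (s A)^T = s A by rewrite /s !trmx_mul trmxK sA mulmxA.
  rewrite -!repr_mxM ?gen_N_Sp ?dH //; congr (_ * om (- _) *: rG _).
    rewrite /s /B0 -!scalemxAr !mxtraceZ; congr (_ * _).
    rewrite -!mulmxA mxtrace_mulC -!mulmxA [M0^T *m C]lift_mxE1.
    rewrite (mulmxA C^T) [C^T *m M0]lift_mxE2.
    rewrite -!mulmxA (mulmxA g^T) (mulmxA (g^T *m U)) (Ogrp_row Gg).
    by rewrite !mulmxA.
  apply: val_inj; rewrite /= !mulmx_block.
  rewrite !(mulmx0, mul0mx, mulmx1, mul1mx, addr0, add0r) /s.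
  by rewrite trmx_inv mulmxK // unitmx_tr lift_unit.
rewrite !inE; have -> : (s A)^T = s A^T by rewrite /s !trmx_mul trmxK mulmxA.
by rewrite (inj_eq s_inj).
Qed.

Lemma dl_lift_D g h : g \in G ->
  dl U (M0 *m h) *m W (1%g, lift_D g) =
    ell (\det (lift_mx g) ^+ t) *: dl U (M0 *m (g^T *m h)).
Proof. by move=> Gg; rewrite (howe_D U mu_osc) /= mulmxA lift_mxE2 -mulmxA. Qed.

(** The sign by which O(U) and its lift to GL(X) act. *)
Definition sgO g : algC := ell (\det (g : 'M[F]_t) ^+ n) * ell (\det (lift_mx g) ^+ t).

Lemma ell_sqr (x : F) : ell x * ell x = 1 :> algC.
Proof. by rewrite /ell; case: ifP; rewrite ?mulr1 ?mulrNN ?mulr1. Qed.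

Lemma sgO_sqr g : sgO g * sgO g = 1.
Proof. by rewrite /sgO mulrACA !ell_sqr mulr1. Qed.

Lemma card_conj (g g' : GLmx F t) : #|[set x in G | (g ^ x)%g == g']|%:R =
  \sum_(x in G) ((g ^ x)%g == g')%:R :> algC.
Proof.
rewrite -sum1_card natr_sum big_mkcond [RHS]big_mkcond; apply: eq_bigr => x _.
by rewrite !inE; case: (_ == U :> 'M_t) => //=; case: eqP.
Qed.

(** The trace counts the points M0 x^T of the torsor which are fixed by (g, g'). *)
Lemma trace_P g g' : g \in G -> g' \in G ->
  \tr (P B0 Wh *m W (g, lift_D g')) =
   ell (\det (g : 'M[F]_t) ^+ n) * ell (\det (lift_mx g') ^+ t) *
     #|[set x in G | (g ^ x)%g == g']|%:R.
Proof.
move=> Gg Gg'.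
rewrite card_conj; rewrite (trace_dl U); under eq_bigr => M _ do rewrite -dl_mulE mulmxA (dl_P _ gram_B0_sym).
rewrite (bigID (fun M => 2^-1 *: (M *m U *m M^T) == B0)) /= [X in _ + X]big1 => [|M /negPf ->].
  rewrite addr0 mulr_sumr.
  rewrite [LHS](eq_bigl [in [set M0 *m x^T | x : GLmx F t in G]]) => [|M]; last first.
    by apply/gram_torsor/imsetP => [[x Gx ->]|[x Gx ->]]; exists x.
  rewrite big_imset => [|x y _ _ /= xy]; last first.
    apply/val_inj/trmx_inj; rewrite -[LHS]mul1mx -[RHS]mul1mx -pidM_K.
    by rewrite -!mulmxA xy.
  apply: eq_bigr => x Gx; rewrite ifT; last by apply/gram_torsor; exists x.
  rewrite -[mu (dual_pair U (g, lift_D g'))]/(W (g, lift_D g')).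
  have -> : W (g, lift_D g') = W (g, 1%g) *m W (1%g, lift_D g').
    by rewrite setX_reprM ?gen_D_Sp // mulg1 mul1g.
  rewrite mulmxA (howe_g mu_osc) // -scalemxAl -mulmxA dl_lift_D //.
  rewrite scalerA mxE dlE; congr (_ * _).
  have -> : (M0 *m x^T == M0 *m (g'^T *m (x^T *m (g^-1)%g^T))) =
      (x == g^-1 * x * g')%g.
    apply/eqP/eqP => [E|{1}->]; last by rewrite !gl_mxM !trmx_mul.
    apply/val_inj/trmx_inj; rewrite -[LHS]mul1mx -pidM_K -mulmxA E.
    by rewrite mulmxA pidM_K mul1mx /= !trmx_mul.
  congr ((_ : bool)%:R); apply/eqP/eqP => [xE|<-]; last first.
    by rewrite conjgE -mulgA mulKVg mulKg.
  have gx : (g * x = x * g')%g by rewrite {1}xE -mulgA mulKVg.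
  by rewrite conjgE gx mulKg.
by rewrite mul0mx mxE.
Qed.

Fact modP d (rG : mx_representation algC H d) : mxmodule (lift_repr rG) (P B0 rG).
Proof.
apply/mxmoduleP=> g Gg; rewrite [lift_repr rG g](_ : _ = rG (lift_D g)) //.
by rewrite lift_P // submxMl.
Qed.

(** The character of O(U), embedded in GL(X) by lift_D, on the B0-part of 'Chi_i. *)
Definition topchar (i : Iirr H) : 'CF(G) := cfRepr (submod_repr (modP 'Chi_i)).

Lemma topcharE (i : Iirr H) g : g \in G -> topchar i g = \tr (P B0 'Chi_i *m 'Chi_i (lift_D g)).
Proof.
move=> Gg; rewrite cfunE Gg mulr1n.
by rewrite (trace_submod _ (submx_refl _) (P_idem pcharFp 'Chi_i B0)).
Qed.

Lemma topchar_char i : topchar i \is a character. Proof. exact: cfRepr_char. Qed.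

(** The multiplicity of 'chi_i in Theta(tau), as a number, so that sums weighted by
    multiplicities are visibly sums of characters. *)
Definition mlt (tau : Iirr G) (i : Iirr H) : nat := Num.truncn '[theta tau, 'chi_i].

Lemma thetaE tau h : theta tau h = \sum_i (mlt tau i)%:R * 'chi[H]_i h.
Proof.
rewrite {1}[theta tau]cfun_sum_cfdot sum_cfunE; apply: eq_bigr => i _.
by rewrite cfunE /mlt truncnK // Cnat_cfdot_char_irr // cfRepr_char.
Qed.

Lemma constt_mlt tau i : (i \in irr_constt (theta tau)) = (mlt tau i != 0%N).
Proof.
rewrite irr_consttE -[in RHS](eqr_nat algC) /mlt truncnK //.
by rewrite Cnat_cfdot_char_irr // cfRepr_char.
Qed.

Lemma trace_W g h : g \in G -> h \in H ->
  \tr (W (g, h)) = \sum_tau 'chi_tau g * \sum_i (mlt tau i)%:R * 'chi[H]_i h.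
Proof.
move=> Gg Hh; rewrite trace_expansion //; apply: eq_bigr => tau _.
by rewrite -thetaE.
Qed.

(** The left side is the character of the B0-part of Theta(tau), and Theta(tau) is
    the part of L^2 obtained by averaging against tau; the sum over the torsor of
    trace_P then reduces to the dual of tau, up to a sign character. *)
Lemma sum_topchar tau g : g \in G ->
  \sum_i topchar i g * (mlt tau i)%:R = sgO g * 'chi_tau g^-1%g.
Proof.
move=> Gg; have dH : lift_D g \in H by apply: gen_D_Sp.
have G_nz : #|G|%:R != 0 :> algC by apply: neq0CG.
have Ptr d (rG : mx_representation algC H d) :
    \tr (P B0 rG *m rG (lift_D g)) = \sum_(A in symS F n)
      (#|symS F n|%:R^-1 * om (- \tr (A *m B0))) * \tr (rG (gen_N A * lift_D g)%g).
  rewrite gopPE mulmx_suml raddf_sum; apply: eq_bigr => A /symSP sA /=.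
  by rewrite -scalemxAl mxtraceZ repr_mxM ?gen_N_Sp.
have chiE : {in H, forall h (i : Iirr H), \tr ('Chi_i h) = 'chi_i h}.
  by move=> h Hh i; rewrite -irrRepr cfunE Hh mulr1n.
transitivity (\sum_(A in symS F n) (#|symS F n|%:R^-1 * om (- \tr (A *m B0))) *
    theta tau (gen_N A * lift_D g)%g).
  under eq_bigr => i _ do rewrite topcharE // Ptr mulr_suml.
  rewrite exchange_big; apply: eq_bigr => A /symSP sA /=.
  rewrite thetaE mulr_sumr; apply: eq_bigr => i _.
  by rewrite chiE ?groupM ?gen_N_Sp //; ring.
transitivity (#|G|%:R^-1 * \sum_(x in G) 'chi_tau x^-1%g *
    \tr (P B0 Wh *m W (x, lift_D g))).
  rewrite mulr_sumr.
  under [RHS]eq_bigr => x Gx do rewrite gopPE mulmx_suml raddf_sum mulr_sumr mulr_sumr.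
  rewrite exchange_big; apply: eq_bigr => A /symSP sA /=.
  rewrite mult_repr_trace ?groupM ?gen_N_Sp // !mulr_sumr; apply: eq_bigr => x Gx.
  rewrite -scalemxAl mxtraceZ.
  rewrite [X in _ = _ * (_ * (_ * \tr X))](_ : _ = W (x, (gen_N A * lift_D g)%g)); last first.
    by rewrite -[in RHS](mul1g x) -setX_reprM ?gen_N_Sp.
  rewrite -irrRepr cfunE groupV Gx mulr1n.
  by ring.
have sgJ x y : x \in G -> y \in G ->
    ell (\det ((x ^ y)%g : 'M[F]_t) ^+ n) = ell (\det (x : 'M[F]_t) ^+ n) :> algC.
  move=> Gx Gy; rewrite conjgE !gl_mxM !det_mulmx mulrCA -det_mulmx /=.
  by rewrite mulVmx ?gl_unitmx // det1 mulr1.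
rewrite (eq_bigr (fun x => \sum_(y in G) if (x ^ y == g)%g then
    'chi_tau g^-1%g * sgO g else 0)).
  rewrite exchange_big (eq_bigr (fun=> 'chi_tau g^-1%g * sgO g)) => [|y Gy] /=.
    by rewrite sumr_const -[X in _ * X]mulr_natl mulKf // mulrC.
  rewrite (bigD1 (g ^ y^-1)%g) ?groupJ ?groupV //= conjgKV eqxx big1 ?addr0 // => x /andP[_].
  by rewrite (can2_eq (conjgK y) (conjgKV y)) => /negPf ->.
move=> x Gx; rewrite trace_P // card_conj !mulr_sumr; apply: eq_bigr => y Gy.
case: eqP => [<-|_]; last by rewrite !mulr0.
by rewrite mulr1 -conjVg cfunJ // /sgO sgJ.
Qed.

End TopRank.

(** * The representations eta(tau) *)

Section Eta.

Variables (F : finFieldType) (p : nat) (pcharFp : p \in [pchar F]).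
Hypothesis p_odd : odd p.
Local Notation om := (omega pcharFp).
Variables (n t : nat) (le_tn : (t <= n)%N) (U : orthoSpace F t).
Variable mu : mx_representation algC (Sp F (t * n)) #|{: 'cV[F]_(t * n)}|.
Hypothesis mu_osc : oscillator pcharFp mu.
Local Notation W := (howe_repr U mu).
Local Notation G := (Ogrp U).
Local Notation H := (Sp F n).
Local Notation Wh := (snd_repr W).
Local Notation P B rG := (gop H (coefP pcharFp B) rG).
Local Notation B0 := (B0 n U).
Local Notation M0 := (pidM F n t).
Local Notation topchar := (topchar pcharFp le_tn U).
Local Notation mlt := (@mlt F n t U mu).
Local Notation theta tau := (cfRepr (@Theta F t U n mu tau)).
Implicit Types (tau : Iirr G) (i : Iirr H).

Lemma idem_trace d (A : 'M[algC]_d) : A *m A = A -> \tr A = (\rank A)%:R.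
Proof.
move=> AA; have gen k (C : 'M_(d, k)) (R : 'M_(k, d)) C' R' :
    C *m R = A -> C' *m C = 1%:M -> R *m R' = 1%:M -> \tr A = k%:R.
  move=> CR CC' RR'; have RC : R *m C = 1%:M.
    have : C' *m (C *m R *m (C *m R)) *m R' = C' *m (C *m R) *m R' by rewrite CR AA.
    by rewrite !mulmxA CC' mul1mx -!mulmxA RR' mulmx1.
  by rewrite -CR mxtrace_mulC RC mxtrace1.
have /row_freeP[R' RR'] := row_base_free A.
have /row_fullP[C' CC'] := col_base_full A.
exact: gen (mulmx_base A) CC' RR'.
Qed.

(** The character of O(U) on the B0-part of Theta(tau). *)
Definition psi tau : 'CF(G) := \sum_i topchar i *+ mlt tau i.

Lemma psiE tau g : g \in G -> psi tau g = sgO n g * 'chi_tau g^-1%g.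
Proof.
move=> Gg; rewrite -(sum_topchar p_odd le_tn mu_osc) // sum_cfunE.
by apply: eq_bigr => i _; rewrite -scaler_nat cfunE mulrC.
Qed.

Lemma conj_ell (x : F) : (ell x)^* = ell x :> algC.
Proof. by rewrite /ell; case: ifP; rewrite ?rmorphN rmorph1. Qed.

Lemma psi_dot tau tau' : '[psi tau, psi tau'] = (tau == tau')%:R.
Proof.
rewrite eq_sym -cfdot_irr !cfdotE; congr (_ * _); apply: eq_bigr => g Gg.
rewrite !psiE // rmorphM /= -/(sgO n g).
have -> : (sgO n g)^* = sgO n g by rewrite /sgO rmorphM /= !conj_ell.
by rewrite mulrACA sgO_sqr mul1r !irr_inv conjCK mulrC.
Qed.

(** Up to a sign psi tau is the dual of chi_tau. *)
Lemma psi_irr tau : psi tau \in irr G.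
Proof.
rewrite irrEchar psi_dot !eqxx andbT rpred_sum // => i _.
by rewrite rpredMn // topchar_char.
Qed.

Lemma topchar1 i : topchar i 1%g = (\rank (P B0 'Chi_i))%:R.
Proof. exact: cfRepr1. Qed.

Lemma topchar_occurs i : (topchar i != 0) = occurs pcharFp 'Chi_i B0.
Proof.
have -> : (topchar i == 0) = (P B0 'Chi_i == 0).
  by rewrite -mxrank_eq0 -(eqr_nat algC) -topchar1 char1_eq0 // topchar_char.
by apply/idP/idP => /(occursP pcharFp 'Chi_i B0).
Qed.

Lemma trace_gopW c : \tr (gop H c Wh) =
  \sum_tau 'chi_tau 1%g * \sum_i (mlt tau i)%:R * \tr (gop H c 'Chi_i).
Proof.
rewrite -[gop H c Wh]mul1mx trace_gop.
transitivity (\sum_(h in H) \sum_tau 'chi[G]_tau 1%g *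
   (\sum_i (mlt tau i)%:R * (c h * 'chi[H]_i h))).
  apply: eq_bigr => h Hh; rewrite mul1mx [\tr _]trace_W // [LHS]mulr_sumr.
  apply: eq_bigr => tau _; rewrite mulrCA; congr (_ * _); rewrite mulr_sumr.
  by apply: eq_bigr => i _; rewrite mulrCA.
rewrite exchange_big; apply: eq_bigr => tau _ /=; rewrite -mulr_sumr exchange_big.
congr (_ * _); apply: eq_bigr => i _ /=; rewrite -mulr_sumr; congr (_ * _).
rewrite -[gop H c _]mul1mx trace_gop; apply: eq_bigr => h Hh.
by rewrite mul1mx -irrRepr cfunE Hh mulr1n.
Qed.

(** The ranks of the projections on the B-parts of the constituents are non-negative
    and add up to the rank on L^2, where only Gram matrices occur. *)
Lemma constt_occurs tau i B : i \in irr_constt (theta tau) -> B^T = B ->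
  occurs pcharFp 'Chi_i B -> exists M : 'M[F]_(n, t), B = 2^-1 *: (M *m U *m M^T).
Proof.
rewrite constt_mlt => nz sB /occursP oB.
have [/existsP[M /eqP <-]|/existsPn noM] :=
  boolP [exists M : 'M[F]_(n, t), 2^-1 *: (M *m U *m M^T) == B]; first by exists M.
have P0 : P B Wh = 0.
  apply: (@eq_dl_mx _ _ _ U) => M; rewrite mulmx0 (dl_P p_odd U mu_osc) //.
  by rewrite (negPf (noM M)).
have term_ge0 tau' i' : 0 <= (mlt tau' i')%:R * \tr (P B 'Chi_i') :> algC.
  by rewrite (idem_trace (P_idem pcharFp 'Chi_i' B)) -natrM ler0n.
have /eqP := trace_gopW (coefP pcharFp B); rewrite P0 mxtrace0 eq_sym psumr_eq0.
  move=> /allP/(_ tau); rewrite mem_index_enum => /(_ isT).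
  rewrite mulf_eq0 (negPf (irr1_neq0 _)) psumr_eq0 // => /allP/(_ i).
  rewrite mem_index_enum => /(_ isT); rewrite mulf_eq0 pnatr_eq0 (negPf nz) /=.
  rewrite (idem_trace (P_idem pcharFp 'Chi_i B)) pnatr_eq0 mxrank_eq0.
  by rewrite (negPf oB).
by move=> tau' _; rewrite mulr_ge0 ?sumr_ge0 // ltW // irr1_gt0.
Qed.

Lemma rank_gram_le (M : 'M[F]_(n, t)) : (\rank (2^-1 *: (M *m U *m M^T)) <= \rank M)%N.
Proof.
apply: leq_trans (mxrank_scale _ _) _; rewrite -mulmxA.
exact: mxrankM_maxl.
Qed.

Lemma rank_pidM : \rank M0 = t.
Proof. by rewrite rank_pid_mx. Qed.

Lemma rank_B0 : \rank B0 = t.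
Proof.
have two := two_neq0 pcharFp p_odd.
apply/eqP; rewrite eqn_leq (leq_trans (rank_gram_le _)) ?rank_leq_col //=.
have {1}<- : \rank (M0^T *m B0 *m M0) = t.
  rewrite /B0 -scalemxAr -scalemxAl !mulmxA pidM_K // mul1mx -mulmxA pidM_K // mulmx1.
  by rewrite mxrank_scale_nz ?invr_eq0 // mxrank_unit // gram_unitmx.
by apply: leq_trans (mxrankM_maxl _ _) (mxrankM_maxr _ _).
Qed.

Lemma full_rank_pidM (M : 'M[F]_(n, t)) : \rank M = t ->
  exists C : GLmx F n, M = C *m M0.
Proof.
move=> rM; have /eqmxMunitP[C uC ->] : (M == M0)%MS.
  have full (A : 'M[F]_(n, t)) : \rank A = t -> (A :=: 1%:M)%MS.
    by move=> rA; apply/eqmxP; rewrite submx1 sub1mx /row_full rA eqxx.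
  by apply/eqmxP; apply: eqmx_trans (full _ rM) (eqmx_sym (full _ rank_pidM)).
by exists (GLMx uC).
Qed.

(** The Gram matrices of maps X -> U have rank at most t, and those of rank t are
    conjugate to B0 under GL(X). *)
Lemma rep_rank_top tau i : i \in irr_constt (theta tau) ->
  (rep_rank pcharFp 'Chi_i == t) = (topchar i != 0).
Proof.
move=> ci; rewrite topchar_occurs.
have rank_le B : (B^T == B) && occurs pcharFp 'Chi_i B -> (\rank B <= t)%N.
  case/andP=> /eqP sB oB; have [M ->] := constt_occurs ci sB oB.
  by apply: leq_trans (rank_gram_le M) (rank_leq_col M).
apply/eqP/idP => [rk|o0]; last first.
  apply/eqP; rewrite eqn_leq; apply/andP; split; first exact/bigmax_leqP.
  by rewrite -{1}rank_B0; apply: leq_bigmax_cond; rewrite gram_B0_sym eqxx.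
have [B sB oB] : exists2 B : 'M_n, B^T = B & occurs pcharFp 'Chi_i B.
  by apply: exists_occurs => //; rewrite lt0n -(eqr_nat algC) -irr1_degree irr1_neq0.
have [|B1 /andP[/eqP sB1 oB1]] := @eq_bigmax_cond _
  [pred B : 'M_n | (B^T == B) && occurs pcharFp 'Chi_i B] (fun B => \rank B).
  by apply/card_gt0P; exists B; rewrite inE sB eqxx.
rewrite -[LHS]/(rep_rank pcharFp 'Chi_i) rk => rB1.
have [M DM] := constt_occurs ci sB1 oB1.
have rM : \rank M = t.
  by apply/eqP; rewrite eqn_leq rank_leq_col {1}rB1 DM rank_gram_le.
have [C DC] := full_rank_pidM rM.
apply: (occurs_conj (C := C)); rewrite /B0 -scalemxAr -scalemxAl.
by move: oB1; rewrite DM DC trmx_mul !mulmxA.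
Qed.

Local Notation eta := (@eta_irr F p pcharFp t U n mu).

(** As psi tau is irreducible, exactly one constituent of Theta(tau) has a non-zero
    B0-part; by rep_rank_top it is the only one of rank t. *)
Lemma eta_spec tau : [/\ mlt tau (eta tau) = 1%N, topchar (eta tau) = psi tau,
  rep_rank pcharFp 'Chi_(eta tau) = t &
  forall i, mlt tau i != 0%N -> topchar i != 0 -> i = eta tau].
Proof.
have [i0 [m1 b1 uniq0]] := irr_unique_summand (topchar_char pcharFp le_tn U) (psi_irr tau).
have psi_nz : psi tau != 0.
  by have /irrP[k ->] := psi_irr tau; rewrite irr_neq0.
suff -> : eta tau = i0.
  have ci0 : i0 \in irr_constt (theta tau) by rewrite constt_mlt m1.
  by split=> //; apply/eqP; rewrite (rep_rank_top ci0) b1 psi_nz.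
rewrite /eta_irr; case: pickP => [i /andP[ci rk]|/(_ i0)] /=.
  apply: uniq0; first by rewrite -constt_mlt.
  by rewrite -(rep_rank_top ci).
by rewrite constt_mlt m1 (rep_rank_top (tau := tau)) ?constt_mlt ?m1 // b1 psi_nz.
Qed.

(** If eta(tau) occurs in Theta(tau') then psi tau = psi tau', by uniqueness. *)
Lemma eta_mlt tau tau' : mlt tau' (eta tau) = (tau == tau').
Proof.
have [m1 b1 _ _] := eta_spec tau; have [<-|ne] := eqVneq tau tau'; first by rewrite m1.
apply/eqP/contraT => nz; have [_ b1' _ uniq'] := eta_spec tau'.
have psi_nz : psi tau != 0.
  by have /irrP[k ->] := psi_irr tau; rewrite irr_neq0.
have E := uniq' _ nz; rewrite b1 in E; have {}E := E psi_nz.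
have := psi_dot tau tau'; rewrite -b1 E b1' psi_dot eqxx (negPf ne) => /eqP.
by rewrite oner_eq0.
Qed.

Lemma eta_inj : injective eta.
Proof.
move=> tau tau' E; apply/eqP; have [m1 _ _ _] := eta_spec tau'.
by have := eta_mlt tau tau'; rewrite E m1; case: eqP.
Qed.

(** The projection of a representation of Sp(V) onto the sum of the isotypic parts
    of the eta(tau). *)
Definition etop d (f : GLmx F (n + n) -> 'M[algC]_d) : 'M_d := \sum_tau eop (eta tau) f.

Lemma etop_intertwine d d' (f : _ -> 'M_d) (f' : _ -> 'M_d') (j : 'M_(d, d')) :
  (forall h, h \in H -> f h *m j = j *m f' h) -> etop f *m j = j *m etop f'.
Proof.
move=> fj; rewrite mulmx_suml mulmx_sumr; apply: eq_bigr => tau _.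
exact: gop_intertwine.
Qed.

Lemma etop_idem d (rG : mx_representation algC H d) : etop rG *m etop rG = etop rG.
Proof.
rewrite mulmx_suml; apply: eq_bigr => tau _; rewrite mulmx_sumr (bigD1 tau) //=.
rewrite eopM eqxx big1 ?addr0 // => tau' ne.
by rewrite eopM ifF //; apply: contraNF ne => /eqP/eta_inj ->.
Qed.

Lemma W_mulh g h k : g \in G -> h \in H -> k \in H ->
  W (g, h) *m Wh k = W (g, (h * k)%g).
Proof.
by move=> Gg Hh Hk; have := setX_reprM W Gg (group1 G) Hh Hk; rewrite mulg1.
Qed.

Lemma etop_commH h : h \in H -> Wh h *m etop Wh = etop Wh *m Wh h.
Proof.
move=> Hh; rewrite mulmx_suml mulmx_sumr; apply: eq_bigr => tau _.
exact: eop_central.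
Qed.

Lemma etop_commG g : g \in G -> W (g, 1%g) *m etop Wh = etop Wh *m W (g, 1%g).
Proof.
move=> Gg; apply/esym/etop_intertwine => k Hk.
by rewrite [LHS]setX_reprM // [RHS]setX_reprM // !mulg1 !mul1g.
Qed.

(** The part of L^2 cut out by the eta(tau) is the sum of the tau (x) eta(tau), since
    eta(tau) occurs once in Theta(tau) and in no other Theta(tau'). *)
Lemma trace_etop g h : g \in G -> h \in H ->
  \tr (W (g, h) *m etop Wh) = \sum_tau 'chi_tau g * 'chi_(eta tau) h.
Proof.
move=> Gg Hh; rewrite mulmx_sumr raddf_sum; apply: eq_bigr => tau _ /=.
set i := eta tau; have H_nz : #|H|%:R != 0 :> algC by apply: neq0CG.
rewrite trace_gop.
transitivity (\sum_tau' 'chi[G]_tau' g * (\sum_j (mlt tau' j)%:R *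
    ('chi_i 1%g / #|H|%:R * \sum_(k in H) 'chi_i k^-1%g * 'chi[H]_j (k * h)%g))).
  under [RHS]eq_bigr => tau' _ do under eq_bigr => j _ do rewrite !mulr_sumr.
  under [RHS]eq_bigr => tau' _ do rewrite exchange_big mulr_sumr.
  rewrite exchange_big; apply: eq_bigr => k Hk /=.
  rewrite [X in \tr X](_ : _ = W (g, (h * k)%g)); last exact: W_mulh.
  rewrite trace_W ?groupM // mulr_sumr; apply: eq_bigr => tau' _.
  rewrite !mulr_sumr; apply: eq_bigr => j _.
  by rewrite (cfun_swap _ _ Hh); ring.
rewrite (eq_bigr (fun tau' => 'chi_tau' g * ((tau == tau')%:R * 'chi_i h))).
  rewrite (bigD1 tau) //= eqxx mul1r big1 ?addr0 // => tau' ne.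
  by rewrite eq_sym (negPf ne) mul0r mulr0.
move=> tau' _; congr (_ * _); rewrite (bigD1 i) //= [X in _ + X]big1 ?addr0 => [|j nej].
  rewrite sum_irr_conv // eqxx mul1r eta_mlt; congr (_ * _).
  by field; rewrite H_nz irr1_neq0.
by rewrite sum_irr_conv // eq_sym (negPf nej) !mul0r !mulr0.
Qed.

(** On the B0-part every vector is in the sum of the eta(tau): both sides have the
    same trace. *)
Lemma P_etop : P B0 Wh *m etop Wh = P B0 Wh.
Proof.
have PC : P B0 Wh *m etop Wh = etop Wh *m P B0 Wh.
  rewrite mulmx_suml mulmx_sumr; apply: eq_bigr => h Hh.
  by rewrite -scalemxAl -scalemxAr etop_commH.
set X := P B0 Wh; set E := etop Wh in PC *.
have XX : X *m X = X by apply: (P_idem pcharFp Wh B0).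
have EE : E *m E = E by apply: etop_idem.
pose Y := X - X *m E; have YY : Y *m Y = Y.
  have XEX : X *m E *m X = X *m E by rewrite -mulmxA -PC mulmxA XX.
  rewrite /Y mulmxBl !mulmxBr XX !mulmxA XX XEX -[X *m E *m E]mulmxA EE.
  by rewrite subrr subr0.
have trP d (rG : mx_representation algC H d) (A : 'M_d) : \tr (P B0 rG *m A) =
    \sum_(h in H) coefP pcharFp B0 h * \tr (rG h *m A).
  by rewrite mxtrace_mulC trace_gop; apply: eq_bigr => h _; rewrite mxtrace_mulC.
suff /eqP : \tr Y = 0.
  by rewrite idem_trace // pnatr_eq0 mxrank_eq0 subr_eq0 eq_sym => /eqP.
have tr_chi i : \tr (P B0 'Chi_i) = topchar i 1%g.
  by rewrite topchar1 (idem_trace (P_idem pcharFp _ B0)).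
rewrite raddfB /= trP; apply/eqP; rewrite subr_eq0; apply/eqP.
rewrite trace_gopW (eq_bigr (fun tau => 'chi_tau 1%g * psi tau 1%g)) => [|tau _]; last first.
  rewrite sum_cfunE; congr (_ * _); apply: eq_bigr => i _.
  by rewrite -scaler_nat cfunE tr_chi.
rewrite (eq_bigr (fun h => \sum_tau 'chi[G]_tau 1%g *
    (coefP pcharFp B0 h * 'chi_(eta tau) h))) => [|h Hh]; last first.
  rewrite [\tr _]trace_etop // mulr_sumr; apply: eq_bigr => tau _.
  by rewrite mulrCA.
rewrite exchange_big; apply: eq_bigr => tau _ /=; rewrite -mulr_sumr; congr (_ * _).
have [_ <- _ _] := eta_spec tau; rewrite -tr_chi -[gop _ _ _]mulmx1 trP.
by apply: eq_bigr => h Hh; rewrite mulmx1 -irrRepr cfunE Hh mulr1n.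
Qed.

(** GL(X) is transitive on the maps onto U, and P_etop applies to M0. *)
Lemma dl_etop M : \rank M = t -> dl U M *m etop Wh = dl U M.
Proof.
move=> rM; have [C ->] := full_rank_pidM rM.
have dl0 : dl U M0 *m etop Wh = dl U M0.
  have dlP : dl U M0 *m P B0 Wh = dl U M0.
    by rewrite (dl_P p_odd U mu_osc) ?gram_B0_sym // eqxx.
  by rewrite -dlP -mulmxA P_etop.
have uCT : (C : 'M_n)^T \in unitmx by rewrite unitmx_tr gl_unitmx.
have E : dl U (C *m M0) = (ell (\det (C : 'M_n)^T ^+ t))^-1 *:
    (dl U M0 *m W (1%g, gen_D (GLMx uCT))).
  by rewrite (howe_D U mu_osc) /= trmxK scalerA mulVf ?ell_neq0 // scale1r.
rewrite E -scalemxAl -mulmxA [W _ *m _]etop_commH ?gen_D_Sp //.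
by rewrite mulmxA dl0.
Qed.

(** The B0-part of each eta(tau) is non-zero, so eop_killed applies to each of the
    isotypic components of u. *)
Lemma etop_killed (u : 'rV_#|{: 'cV[F]_(t * n)}|) : u *m etop Wh = u ->
  (forall h, h \in H -> u *m Wh h *m P B0 Wh = 0) -> u = 0.
Proof.
move=> ue u0; rewrite -ue mulmx_sumr big1 // => tau _.
apply: (@eop_killed _ _ _ Wh (eta tau) (coefP pcharFp B0)).
- have [_ b1 _ _] := eta_spec tau; have := topchar1 (eta tau).
  rewrite b1 psiE ?group1 // invg1 (idem_trace (P_idem pcharFp _ B0)) => <-.
  by rewrite mulf_neq0 ?irr1_neq0 // /sgO mulf_neq0 ?ell_neq0.
- by rewrite -mulmxA eopM eqxx.
have PC : P B0 Wh *m eop (eta tau) Wh = eop (eta tau) Wh *m P B0 Wh.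
  rewrite mulmx_suml mulmx_sumr; apply: eq_bigr => h Hh.
  by rewrite -scalemxAl -scalemxAr eop_central.
move=> h Hh; rewrite -[u *m _ *m _]mulmxA -(eop_central Wh _ Hh) mulmxA -mulmxA -PC.
by rewrite mulmxA u0 ?mul0mx.
Qed.

End Eta.

(** * From the quotient orthog N / N to U *)

Section CosetVectors.

Variables (F : finFieldType) (p : nat) (pcharFp : p \in [pchar F]).
Hypothesis p_odd : odd p.
Local Notation om := (omega pcharFp).
Variables (n t : nat) (U : orthoSpace F t).
Variable mu : mx_representation algC (Sp F (t * n)) #|{: 'cV[F]_(t * n)}|.
Hypothesis mu_osc : oscillator pcharFp mu.
Local Notation W := (howe_repr U mu).
Implicit Types (N : 'M[F]_t) (M : 'M[F]_(n, t)).

(** The cardinal of Hom(X, N). *)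
Definition homcard N : nat := #|[pred Y : 'M[F]_(n, t) | (Y <= N)%MS]|.

Lemma homcard_neq0 N : (homcard N)%:R != 0 :> algC.
Proof.
rewrite pnatr_eq0 -lt0n; apply/card_gt0P; exists 0.
by rewrite -topredE /= sub0mx.
Qed.

Lemma orthogP N k (A : 'M[F]_(k, t)) :
  reflect (A *m U *m N^T = 0) (A <= orthog U N)%MS.
Proof. by rewrite -mulmxA; apply: sub_kermxP. Qed.

Lemma orthog_sub N k l (A : 'M[F]_(k, t)) (B : 'M[F]_(l, t)) :
  (A <= orthog U N)%MS -> (B <= N)%MS -> A *m U *m B^T = 0.
Proof.
by move=> /orthogP AN /submxP[D ->]; rewrite trmx_mul mulmxA AN mul0mx.
Qed.

Lemma gramC k l (A : 'M[F]_(k, t)) (B : 'M[F]_(l, t)) :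
  (A *m U *m B^T)^T = B *m U *m A^T.
Proof. by rewrite !trmx_mul trmxK gram_sym mulmxA. Qed.

Lemma gram_coset N M Y : isotropic U N -> (M <= orthog U N)%MS -> (Y <= N)%MS ->
  (M + Y) *m U *m (M + Y)^T = M *m U *m M^T.
Proof.
move=> isoN MN YN; have YNo := submx_trans YN isoN.
rewrite !mulmxDl linearD /= !mulmxDr (orthog_sub MN YN) (orthog_sub YNo YN).
by rewrite -[Y *m U *m M^T]gramC (orthog_sub MN YN) trmx0 !addr0.
Qed.

Lemma cosetv_eq N N' M M' : (N :=: N')%MS -> (M - M' <= N)%MS ->
  cosetv U N M = cosetv U N' M'.
Proof.
move=> NN' MM'; rewrite /cosetv (reindex_inj (addrI (M' - M))) /=.
apply: eq_big => [Y|Y _]; last by rewrite addrA addrCA subrr addr0.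
rewrite -NN'; apply/idP/idP => [H|H]; last by rewrite addmx_sub // -opprB eqmx_opp.
by rewrite -[Y](addKr (M' - M)) addmx_sub // opprB.
Qed.

Lemma cosetv_N N M A : isotropic U N -> (M <= orthog U N)%MS -> A^T = A ->
  cosetv U N M *m W (1%g, gen_N A) = om (2^-1 * \tr (A *m M *m U *m M^T)) *: cosetv U N M.
Proof.
move=> isoN MN sA; rewrite mulmx_suml scaler_sumr; apply: eq_bigr => Y YN.
rewrite (howe_N U mu_osc) //; congr (om (_ * \tr _) *: _).
by rewrite -!mulmxA; congr (_ *m _); rewrite !mulmxA (gram_coset isoN MN YN).
Qed.

Lemma cosetv_D N M C :
  cosetv U N M *m W (1%g, gen_D C) = ell (\det C ^+ t) *: cosetv U N (C^T *m M).
Proof.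
have uC : (C : 'M_n)^T \in unitmx by rewrite unitmx_tr gl_unitmx.
rewrite mulmx_suml scaler_sumr [RHS](reindex_inj (can_inj (mulKmx uC))) /=.
apply: eq_big => [Y|Y YN]; last by rewrite (howe_D U mu_osc) mulmxDr.
by rewrite (eqmxMfull _ (_ : row_full C^T)) // row_full_unit.
Qed.

Lemma cosetv_g N M g : g \in Ogrp U -> cosetv U N M *m W (g, 1%g) =
  ell (\det g ^+ n) *: cosetv U (N *m (g^-1)%g^T) (M *m (g^-1)%g^T).
Proof.
move=> Gg; have ug : (g^-1 : GLmx F t)%g^T \in unitmx.
  by rewrite unitmx_tr (gl_unitmx (g^-1)%g).
rewrite mulmx_suml scaler_sumr [RHS](reindex_inj (can_inj (mulmxK ug))) /=.
apply: eq_big => [Y|Y YN]; last by rewrite (howe_g mu_osc) // mulmxDl.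
by rewrite submxMfree ?row_free_unit.
Qed.

(** Orthogonality of characters on Hom(X, N). *)
Lemma sum_coset_pair N M M' : isotropic U N -> (M <= orthog U N)%MS ->
  \sum_(Y : 'M[F]_(n, t) | (Y <= N)%MS) om (\tr ((M + Y) *m U *m M'^T)) =
  if (M' <= orthog U N)%MS then (homcard N)%:R * om (\tr (M *m U *m M'^T)) else 0.
Proof.
move=> isoN MN; case: ifP => [M'N|/negbT nM'N].
  rewrite (eq_bigr (fun=> om (\tr (M *m U *m M'^T)))) => [|Y YN].
    by rewrite sumr_const mulr_natl.
  by rewrite !mulmxDl -[Y *m U *m _]gramC (orthog_sub M'N YN) trmx0 addr0.
have [Y0 Y0N nz] : exists2 Y0 : 'M[F]_(n, t), (Y0 <= N)%MS &
    om (\tr (Y0 *m U *m M'^T)) != 1.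
  have [/existsP[Y0 /andP[]]|/existsPn H] := boolP [exists Y0 : 'M[F]_(n, t),
    (Y0 <= N)%MS && (om (\tr (Y0 *m U *m M'^T)) != 1)]; first by exists Y0.
  case/negP: nM'N; apply/orthogP; apply/matrixP=> i j; rewrite [RHS]mxE.
  apply/eqP/(omega_trivP pcharFp) => a.
  have := H ((a *: delta_mx i j) *m N); rewrite submxMl negbK => /eqP <-.
  congr (om _); rewrite -!mulmxA -scalemxAl mxtraceZ mxtrace_mulC mxtrace_mul_delta.
  by rewrite !mulmxA -[N *m U *m M'^T]gramC [in RHS]mxE.
apply/eqP/contraT => nzS; case/negP: nz; apply/eqP/(mulIf nzS).
rewrite mul1r mulr_sumr [RHS](reindex_inj (addrI Y0)) /=.
apply: eq_big => [Y|Y YN].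
  apply/idP/idP => [YN|H]; first by rewrite addmx_sub.
  by rewrite -[Y](addKr Y0) addmx_sub ?eqmx_opp.
by rewrite -omegaD -raddfD /= -!mulmxDl addrCA.
Qed.

(** The Fourier transform of a coset of Hom(X, N) is supported on Hom(X, orthog N). *)
Lemma cosetv_J N M : isotropic U N -> (M <= orthog U N)%MS ->
  cosetv U N M *m W (1%g, gen_J 1%g) = ((gam n U pcharFp)^-1 * (homcard N)%:R) *:
    \sum_(M' : 'M[F]_(n, t) | (M' <= orthog U N)%MS) om (\tr (M *m U *m M'^T)) *: dl U M'.
Proof.
move=> isoN MN; rewrite mulmx_suml; under eq_bigr => Y _ do rewrite (howe_J U mu_osc).
rewrite -scaler_sumr -scalerA; congr (_ *: _).
rewrite exchange_big /= scaler_sumr [RHS]big_mkcond /=; apply: eq_bigr => M' _; rewrite -scaler_suml sum_coset_pair //.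
by case: ifP; rewrite ?scalerA ?scale0r.
Qed.

(** Averaging over Hom(X, N) restricts the Gauss sum to the orthogonal of N. *)
Lemma gam_orthog N : isotropic U N -> gam n U pcharFp =
  \sum_(M : 'M[F]_(n, t) | (M <= orthog U N)%MS) om (- 2^-1 * \tr (M *m U *m M^T)).
Proof.
move=> isoN; apply: (mulfI (homcard_neq0 N)); rewrite gamE.
transitivity (\sum_(M : 'M[F]_(n, t)) \sum_(Y : 'M[F]_(n, t) | (Y <= N)%MS)
    om (- 2^-1 * \tr ((M + Y) *m U *m (M + Y)^T))).
  rewrite exchange_big /=.
  rewrite [RHS](eq_bigr (fun=> \sum_(M : 'M[F]_(n, t)) om (- 2^-1 * \tr (M *m U *m M^T)))).
    by rewrite sumr_const mulr_natl.
  by move=> Y _; rewrite [RHS](reindex_inj (addIr Y)).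
rewrite mulr_sumr [RHS]big_mkcond; apply: eq_bigr => M _ /=.
have -> : \sum_(Y : 'M[F]_(n, t) | (Y <= N)%MS) om (- 2^-1 * \tr ((M + Y) *m U *m (M + Y)^T))
   = om (- 2^-1 * \tr (M *m U *m M^T)) *
     \sum_(Y : 'M[F]_(n, t) | (Y <= N)%MS) om (\tr ((0 + Y) *m U *m (- M)^T)).
  rewrite mulr_sumr; apply: eq_bigr => Y YN; rewrite add0r -omegaD; congr (om _).
  have YY := orthog_sub (submx_trans YN isoN) YN.
  rewrite !mulmxDl [(M + Y)^T]linearD /= !mulmxDr YY addr0 !mxtraceD.
  rewrite -[M *m U *m Y^T]gramC mxtrace_tr [(- M)^T]linearN /= mulmxN raddfN /=.
  by field; apply: (two_neq0 pcharFp).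
rewrite sum_coset_pair ?sub0mx // eqmx_opp; case: ifP; rewrite ?mulr0 // => _.
by rewrite !mul0mx mxtrace0 omega0 mulr1 mulrC.
Qed.

End CosetVectors.

Section QuotientIntertwiner.

Variables (F : finFieldType) (p : nat) (pcharFp : p \in [pchar F]).
Hypothesis p_odd : odd p.
Local Notation om := (omega pcharFp).
Variables (n t r : nat) (U : orthoSpace F t) (Q : isoQuotient U r).
Local Notation N := (iqN Q).
Local Notation PQ := (iqP Q).
Local Notation V := (iqV Q).
Local Notation K := (orthog U N).
Local Notation lift := (iq_lift Q).

Let isoN : isotropic U N := iq_isotropic Q.

Lemma iq_formE k l (A : 'M[F]_(k, t)) (B : 'M[F]_(l, t)) :
  (A <= K)%MS -> (B <= K)%MS -> A *m PQ *m V *m (B *m PQ)^T = A *m U *m B^T.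
Proof.
have entry m (X : 'M[F]_(k, m)) (Y : 'M_m) (Z : 'M_(l, m)) i j :
    (X *m Y *m Z^T) i j = (row i X *m Y *m (row j Z)^T) 0 0.
  by rewrite -row_mul !mxE; apply: eq_bigr=> s _; rewrite !mxE.
move=> AK BK; apply/matrixP=> i j; rewrite !entry !row_mul.
by rewrite iq_form // (submx_trans (row_sub _ _)).
Qed.

Lemma iqN_P : N *m PQ = 0.
Proof. by apply/sub_kermxP; rewrite -{1}(iq_ker Q) capmxSr. Qed.

Lemma iqN_sub k (A : 'M[F]_(k, t)) : (A <= K)%MS -> A *m PQ = 0 -> (A <= N)%MS.
Proof. by move=> AK /sub_kermxP AP; rewrite -(iq_ker Q) sub_capmx AK AP. Qed.

Lemma iqN_subP k (A : 'M[F]_(k, t)) : (A <= N)%MS -> A *m PQ = 0.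
Proof. by case/submxP=> D ->; rewrite -mulmxA iqN_P mulmx0. Qed.

Lemma lift_K k (A : 'M[F]_(k, r)) : (A *m lift <= K)%MS.
Proof. exact: iq_lift_sub. Qed.

Lemma lift_P_K k (A : 'M[F]_(k, r)) : A *m lift *m PQ = A.
Proof. by rewrite -mulmxA iq_liftK mulmx1. Qed.

Lemma cosetv_lift (M : 'M[F]_(n, t)) : (M <= K)%MS ->
  cosetv U N (M *m PQ *m lift) = cosetv U N M.
Proof.
move=> MK; apply: cosetv_eq => //; apply: iqN_sub.
  by rewrite addmx_sub ?eqmx_opp ?lift_K.
by rewrite mulmxBl lift_P_K subrr.
Qed.

(** The isometry L^2(Hom(X, orthog N / N)) -> L^2(Hom(X, U)): inverse image to
    Hom(X, orthog N), extended by zero. *)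
Definition jmap : 'M[algC]_(#|{: 'cV[F]_(r * n)}|, #|{: 'cV[F]_(t * n)}|) :=
  \sum_(M : 'M[F]_(n, r)) (dl V M)^T *m cosetv U N (M *m lift).

Lemma jmapE M : dl V M *m jmap = cosetv U N (M *m lift).
Proof.
have dlT M' M'' : dl V M' *m (dl V M'')^T = (M' == M'')%:R%:M :> 'M[algC]_1.
  apply/matrixP=> a b; rewrite !ord1 /dl -rowE !mxE eqxx mulr1n.
  by rewrite (inj_eq (@ix_inj _ _ _ V)).
rewrite mulmx_sumr (bigD1 M) //= mulmxA dlT eqxx mul1mx big1 ?addr0 // => M' ne.
by rewrite mulmxA dlT eq_sym (negPf ne) raddf0 mul0mx.
Qed.

Lemma iq_dim' : t = (r + (\rank N).*2)%N.
Proof. by rewrite -[in LHS](iq_dim Q) mul2n. Qed.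

(** As t - r is even, the signs with which GL(X) acts for U and for orthog N / N
    agree. *)
Lemma ell_pow (x : F) : x != 0 -> ell (x ^+ r) = ell (x ^+ t) :> algC.
Proof.
move=> nzx; rewrite iq_dim' exprD -addnn exprD -expr2; set y := x ^+ \rank N.
have nzy : y != 0 by rewrite expf_neq0.
rewrite /ell; congr (if _ then _ else _); apply/existsP/existsP => [[z /eqP ->]|[z /eqP E]].
  by exists (z * y); rewrite exprMn.
by exists (z / y); rewrite exprMn -E exprVn mulfK ?expf_neq0.
Qed.

Lemma sum_orthog (T : nmodType) (f : 'M[F]_(n, t) -> T) :
  \sum_(M : 'M[F]_(n, t) | (M <= K)%MS) f M =
  \sum_(Mb : 'M[F]_(n, r)) \sum_(Y : 'M[F]_(n, t) | (Y <= N)%MS) f (Mb *m lift + Y).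
Proof.
rewrite (partition_big (fun M : 'M_(n, t) => M *m PQ) predT) //=.
apply: eq_bigr => Mb _; rewrite (reindex_inj (addrI (Mb *m lift))) /=.
apply: eq_bigl => Y; rewrite mulmxDl lift_P_K -[X in _ == X]addr0 (inj_eq (addrI _)).
apply/andP/idP => [[MK /eqP MP]|YN].
  apply: iqN_sub MP.
  by rewrite -[Y](addKr (Mb *m lift)) addmx_sub ?eqmx_opp ?lift_K.
by rewrite iqN_subP // addmx_sub ?lift_K ?(submx_trans YN).
Qed.

Lemma gam_quotient : gam n U pcharFp = (homcard n N)%:R * gam n V pcharFp.
Proof.
rewrite (gam_orthog pcharFp p_odd n isoN) gamE mulr_sumr sum_orthog.
apply: eq_bigr => Mb _.
rewrite (eq_bigr (fun=> om (- 2^-1 * \tr (Mb *m V *m Mb^T)))) => [|Y YN].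
  by rewrite sumr_const mulr_natl.
by rewrite (gram_coset isoN (lift_K Mb) YN) -iq_formE ?lift_K // lift_P_K.
Qed.

(** An isometry preserving N acts on U / orthog N by the inverse transpose of its
    action on N, so that its determinant is that of its action on orthog N / N. *)
Lemma det_iq_act (g : GLmx F t) : g \in iq_stab_group Q ->
  \det (iq_act Q g : 'M_r) = \det (g : 'M_t).
Proof.
move=> Sg; rewrite iq_actK //; set k := \rank N.
have [Og Ng] : g \in Ogrp U /\ (N *m g^T <= N)%MS.
  by move: Sg; rewrite inE => /andP[-> /andP[-> _]].
pose b : 'M[F]_(k, t) := row_base N.
have bN : (b :=: N)%MS by apply: eq_row_base.
have /row_freeP[Y bUY] : row_free (b *m U).
  by rewrite /row_free mxrankMfree ?row_free_unit ?gram_unitmx // bN.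
pose b' : 'M[F]_(k, t) := Y^T.
have b'b : b' *m U *m b^T = 1%:M.
  by rewrite -[LHS]trmxK gramC /b' trmxK bUY trmx1.
have Kb l (A : 'M[F]_(l, t)) : (A <= K)%MS -> A *m U *m b^T = 0.
  by move=> AK; apply: orthog_sub AK _; rewrite bN.
have bK : (b <= K)%MS by rewrite bN.
have lK : (lift <= K)%MS by rewrite -[lift]mul1mx lift_K.
have bP : b *m PQ = 0 by apply: iqN_subP; rewrite bN.
(* In the basis b, lift, b', with b' dual to b, the isometry g is block triangular
   with diagonal blocks its actions a on N, A on orthog N / N and d on U / orthog N. *)
pose S : 'M[F]_(k + (r + k), t) := col_mx b (col_mx lift b').
have dimS : (k + (r + k))%N = t by rewrite [RHS]iq_dim' -addnn addnCA.
have freeS : row_free S.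
  apply: inj_row_free => v; rewrite -[v]hsubmxK -[rsubmx v]hsubmxK.
  set v1 := lsubmx v; set v2 := lsubmx _; set v3 := rsubmx (rsubmx v).
  rewrite !mul_row_col => E.
  have v30 : v3 = 0.
    have /(congr1 (fun X => X *m U *m b^T)) := E; rewrite !mulmxDl !mul0mx.
    rewrite (Kb _ (v1 *m b)) ?(submx_trans (submxMl _ _) bK) // (Kb _ _ (lift_K v2)).
    by rewrite -!(mulmxA v3) b'b mulmx1 !add0r.
  have v20 : v2 = 0.
    have /(congr1 (mulmx^~ PQ)) := E; rewrite v30 mul0mx addr0 mulmxDl mul0mx.
    by rewrite -(mulmxA v1) bP mulmx0 add0r lift_P_K.
  move: E; rewrite v30 v20 !mul0mx !addr0 => /eqP.
  rewrite mulmx_free_eq0 ?row_base_free // => /eqP ->.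
  by rewrite row_mx0 row_mx0.
have /submxP[a Da] : (b *m g^T <= b)%MS.
  by rewrite !bN; apply: submx_trans Ng; rewrite submxMr ?bN.
have fullS : row_full S.
  by move: freeS; rewrite /row_free /row_full => /eqP ->; apply/eqP.
have /submxP[y Dy] : (b' *m g^T <= S)%MS by apply: submx_full.
have /submxP[x Dx] : (lift *m g^T - (iq_act_mx Q g)^T *m lift <= b)%MS.
  rewrite bN; apply: iqN_sub.
    by rewrite addmx_sub ?eqmx_opp ?lift_K //; apply: iq_stabK Sg lK.
  by rewrite mulmxBl (iq_actE Sg lK) -(mulmxA _ lift) iq_liftK mulmx1 mul1mx subrr.
set A := (iq_act_mx Q g)^T in Dx.
move: Dy; rewrite -[y]hsubmxK -[rsubmx y]hsubmxK !mul_row_col.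
set y1 := lsubmx y; set y2 := lsubmx _; set d := rsubmx (rsubmx y) => Dy.
have da : d *m a^T = 1%:M.
  have gU : g^T *m U *m g = U by apply/eqP; move: Og; rewrite inE.
  transitivity (b' *m g^T *m U *m (b *m g^T)^T); last first.
    rewrite trmx_mul trmxK -b'b !mulmxA -(mulmxA b' g^T U) -(mulmxA b' _ g).
    by rewrite gU.
  rewrite Da Dy trmx_mul mulmxA !mulmxDl (Kb _ (y1 *m b)) ?(submx_trans (submxMl _ _) bK) //.
  by rewrite (Kb _ _ (lift_K y2)) !mul0mx !add0r -!(mulmxA d) b'b mul1mx.
pose Tri : 'M[F]_(k + (r + k)) :=
  block_mx a 0 (col_mx x y1) (block_mx A 0 y2 d).
have DT : Tri *m S = S *m g^T.
  rewrite /Tri /S mul_block_col !mul0mx addr0 [col_mx x y1 *m b]mul_col_mx.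
  rewrite mul_block_col mul0mx addr0 add_col_mx -Da -Dx subrK addrA -addrA -Dy.
  by rewrite -!mul_col_mx.
rewrite -[RHS]det_tr -(det_intertwine dimS freeS DT) /Tri det_lblock.
rewrite det_lblock mulrCA -(det_tr a).
by rewrite [X in _ * X]mulrC -det_mulmx da det1 mulr1 -[LHS]det_tr.
Qed.

Variable muU : mx_representation algC (Sp F (t * n)) #|{: 'cV[F]_(t * n)}|.
Hypothesis muU_osc : oscillator pcharFp muU.
Variable muV : mx_representation algC (Sp F (r * n)) #|{: 'cV[F]_(r * n)}|.
Hypothesis muV_osc : oscillator pcharFp muV.
Local Notation WU := (howe_repr U muU).
Local Notation WV := (howe_repr V muV).

(** The two signs agree by det_iq_act. *)
Lemma jmap_g g : g \in iq_stab_group Q ->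
  WV (iq_act Q g, 1%g) *m jmap = jmap *m WU (g, 1%g).
Proof.
move=> Sg; have Og : g \in Ogrp U by move: Sg; rewrite inE => /andP[].
have Oa : iq_act Q g \in Ogrp V.
  by move/subsetP: (iq_act_sub Q) => /(_ g Sg); rewrite inE => /andP[_]; rewrite inE.
have SgV := groupVr Sg; have aV : (iq_act Q g)^-1%g = iq_act Q g^-1%g.
  by have /= -> := morphV (iq_act_morphism Q) Sg.
apply: (@eq_dl_mx _ _ _ V) => M; rewrite !mulmxA (howe_g muV_osc) // -scalemxAl !jmapE.
rewrite (cosetv_g muU_osc) // det_iq_act // aV iq_actK //; congr (_ *: _).
have NN : (N *m (g^-1)%g^T :=: N)%MS.
  by apply/eqmxP; move: SgV; rewrite inE => /andP[].
have lK := lift_K M; have lgK := iq_stabK SgV lK.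
apply: cosetv_eq; first exact: eqmx_sym.
apply: iqN_sub; first by rewrite addmx_sub ?eqmx_opp ?lift_K.
by rewrite mulmxBl lift_P_K (iq_actE SgV lK) lift_P_K subrr.
Qed.

(** On J this compares Gauss sums: the one for U is #|Hom(X, N)| times the one for
    orthog N / N. *)
Lemma jmap_h h : h \in Sp F n -> WV (1%g, h) *m jmap = jmap *m WU (1%g, h).
Proof.
pose S := [set h in Sp F n | WV (1%g, h) *m jmap == jmap *m WU (1%g, h)].
have gS : group_set S.
  apply/group_setP; split=> [|x y /setIdP[Hx /eqP ex] /setIdP[Hy /eqP ey]].
    by apply/setIdP; rewrite group1 !repr_mx1 mul1mx mulmx1.
  apply/setIdP; split; first exact: groupM.
  have EV := setX_reprM WV (group1 _) (group1 _) Hx Hy.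
  have EU := setX_reprM WU (group1 _) (group1 _) Hx Hy.
  rewrite !mulg1 in EU EV; rewrite -EV -EU -mulmxA ey.
  by rewrite (mulmxA _ jmap) ex -mulmxA.
suff : Sp F n \subset Group gS by move=> /subsetP sS /sS /setIdP[_ /eqP].
apply: Sp_gen => [A sA|C|]; apply/setIdP; split; rewrite ?gen_N_Sp ?gen_D_Sp ?gen_J_Sp ?trmx1 //; apply/eqP.
- apply: (@eq_dl_mx _ _ _ V) => M; rewrite !mulmxA (howe_N V muV_osc) // -scalemxAl !jmapE.
  rewrite (cosetv_N muU_osc isoN (lift_K M)) //; congr (om (_ * \tr _) *: _).
  have := iq_formE (lift_K M) (lift_K M); rewrite lift_P_K => E.
  by move: (M *m lift) E => L E; rewrite -!(mulmxA A) E.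
- apply: (@eq_dl_mx _ _ _ V) => M; rewrite !mulmxA (howe_D V muV_osc) // -scalemxAl !jmapE.
  rewrite (cosetv_D U muU_osc) mulmxA ell_pow //.
  by rewrite -unitfE -unitmxE gl_unitmx.
apply: (@eq_dl_mx _ _ _ V) => M; rewrite !mulmxA (howe_J V muV_osc) // -scalemxAl !jmapE.
rewrite (cosetv_J muU_osc isoN (lift_K M)) gam_quotient invfM mulrAC mulVf ?homcard_neq0 //.
rewrite mul1r; congr (_ *: _); rewrite sum_orthog mulmx_suml; apply: eq_bigr => Mb _.
rewrite -scalemxAl jmapE scaler_sumr; apply: eq_bigr => Y YN; congr (om (\tr _) *: _).
rewrite linearD mulmxDr (orthog_sub (lift_K M) YN) addr0.
by rewrite -iq_formE ?lift_K // !lift_P_K.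
Qed.

Lemma jmap_intertwine g h : g \in iq_stab_group Q -> h \in Sp F n ->
  WV (iq_act Q g, h) *m jmap = jmap *m WU (g, h).
Proof.
move=> Sg Hh; have Og : g \in Ogrp U by move: Sg; rewrite inE => /andP[].
have Oa : iq_act Q g \in Ogrp V.
  by move/subsetP: (iq_act_sub Q) => /(_ g Sg); rewrite inE => /andP[_]; rewrite inE.
have EV := setX_reprM WV Oa (group1 _) (group1 _) Hh.
have EU := setX_reprM WU Og (group1 _) (group1 _) Hh.
rewrite !mulg1 !mul1g in EU EV.
transitivity (WV (iq_act Q g, 1%g) *m WV (1%g, h) *m jmap).
  by congr (_ *m _); symmetry; apply: EV.
transitivity (jmap *m (WU (g, 1%g) *m WU (1%g, h))); last by congr (_ *m _); apply: EU.
by rewrite -mulmxA jmap_h // (mulmxA _ jmap) jmap_g // mulmxA.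
Qed.

End QuotientIntertwiner.

(** * Independence of the translates *)

Section CosetIndependence.

Variables (F : finFieldType) (p : nat) (pcharFp : p \in [pchar F]).
Hypothesis p_odd : odd p.
Local Notation om := (omega pcharFp).
Variables (n t r : nat) (le_tn : (t <= n)%N) (U : orthoSpace F t) (Q : isoQuotient U r).
Local Notation N := (iqN Q).
Local Notation PQ := (iqP Q).
Local Notation V := (iqV Q).
Local Notation K := (orthog U N).
Local Notation lift := (iq_lift Q).
Variable muU : mx_representation algC (Sp F (t * n)) #|{: 'cV[F]_(t * n)}|.
Hypothesis muU_osc : oscillator pcharFp muU.
Variable muV : mx_representation algC (Sp F (r * n)) #|{: 'cV[F]_(r * n)}|.
Hypothesis muV_osc : oscillator pcharFp muV.
Local Notation WU := (howe_repr U muU).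
Local Notation WV := (howe_repr V muV).
Local Notation j := (jmap n Q).
Local Notation G := (Ogrp U).
Local Notation S := (iq_stab_group Q).
Local Notation H := (Sp F n).
Local Notation P B rG := (gop H (coefP pcharFp B) rG).

Let isoN : isotropic U N := iq_isotropic Q.
Let le_rn : (r <= n)%N.
Proof. by apply: leq_trans le_tn; rewrite [t](iq_dim' Q) leq_addr. Qed.

Lemma lift_sub : (lift <= K)%MS.
Proof. by rewrite -[lift]mul1mx lift_K. Qed.

Lemma isometry_form y k l (A : 'M[F]_(k, t)) (B : 'M[F]_(l, t)) : y \in G ->
  A *m (y : 'M_t)^T *m U *m (B *m (y : 'M_t)^T)^T = A *m U *m B^T.
Proof.
rewrite inE => /eqP gU; rewrite trmx_mul trmxK !mulmxA.
by rewrite -(mulmxA A) -(mulmxA A) gU.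
Qed.

(** N is the radical of orthog N. *)
Lemma stab_of_orthog y : y \in G -> (K *m (y : 'M_t)^T <= K)%MS -> y \in S.
Proof.
move=> Gy Ky; have uy : (y : 'M_t)^T \in unitmx by rewrite unitmx_tr gl_unitmx.
have rky k (A : 'M[F]_(k, t)) : \rank (A *m (y : 'M_t)^T) = \rank A.
  by rewrite mxrankMfree ?row_free_unit.
have /eqmxP eKy : (K *m (y : 'M_t)^T == K)%MS by rewrite -(mxrank_leqif_eq Ky) rky.
have NKy : (N *m (y : 'M_t)^T <= K)%MS by apply: submx_trans (submxMr _ isoN) Ky.
suff Ny : (N *m (y : 'M_t)^T <= N)%MS.
  by apply/setIdP; rewrite -(mxrank_leqif_eq Ny) rky.
apply: iqN_sub => //; apply: (can_inj (mulmxK (gram_unitmx V))); rewrite mul0mx.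
have := iq_formE NKy lift_sub; rewrite iq_liftK trmx1 mulmx1 => ->.
have /submxP[D ->] : (lift <= K *m (y : 'M_t)^T)%MS by rewrite eKy lift_sub.
have NUK : N *m U *m K^T = 0.
  by apply: trmx_inj; rewrite gramC trmx0 (orthog_sub (submx_refl K) (submx_refl N)).
by rewrite trmx_mul mulmxA isometry_form // NUK mul0mx.
Qed.

Lemma cosetv_coef (N' : 'M[F]_t) (M M' : 'M[F]_(n, t)) :
  cosetv U N' M 0 (ix U M') = (M' - M <= N')%MS%:R.
Proof.
rewrite summxE (eq_bigr (fun Y => (Y == M' - M)%:R)) => [|Y _]; last first.
  by rewrite dlE [Y == _]eq_sym subr_eq [M + Y]addrC.
case MM: (M' - M <= N')%MS; last first.
  by rewrite big1 // => Y YN; case: eqP => // eY; rewrite -eY YN in MM.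
by rewrite (bigD1 (M' - M)) //= eqxx big1 ?addr0 // => Y /andP[_ /negPf ->].
Qed.

(** A map X -> orthog N over Mb can be chosen onto orthog N, as dim (orthog N) <= n. *)
Lemma generic_lift (Mb : 'M[F]_(n, r)) : \rank Mb = r ->
  exists2 M : 'M[F]_(n, t), (K <= M)%MS & (M - Mb *m lift <= N)%MS.
Proof.
move=> rMb; have [C DMb] := full_rank_pidM le_rn rMb.
set k := \rank N; have le_rk : (r + k <= n)%N.
  by apply: leq_trans le_tn; rewrite [t](iq_dim' Q) leq_add2l -addnn leq_addr.
pose D : 'M[F]_(n, r + k) := C *m pid_mx (r + k).
have fullD : row_full D.
  rewrite /row_full /D eqmxMfull ?row_full_unit ?gl_unitmx // rank_pid_mx //.
have DE : D = row_mx Mb (rsubmx D).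
  rewrite -[LHS]hsubmxK; congr row_mx; rewrite DMb /D -mulmx_lsub.
  by congr (_ *m _); apply/matrixP=> a b; rewrite !mxE /=; case: eqP => //= ->; rewrite (leq_trans (ltn_ord b) (leq_addr k r)) ltn_ord.
exists (D *m col_mx lift (row_base N)).
  rewrite (eqmxMfull _ fullD) -addsmxE.
  have KN : (K - K *m PQ *m lift <= N)%MS.
    apply: iqN_sub; first by rewrite addmx_sub ?eqmx_opp ?lift_K.
    by rewrite mulmxBl lift_P_K subrr.
  rewrite -[X in (X <= _)%MS](subrK (K *m PQ *m lift)) addmx_sub //.
    by apply: submx_trans KN _; rewrite -(eq_row_base N) addsmxSr.
  by apply: submx_trans (addsmxSl _ _); rewrite submxMl.
by rewrite DE mul_row_col addrC addKr (submx_trans (submxMl _ _)) ?eq_row_base.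
Qed.

(** A translate of Hom(X, orthog N) contains a map M onto orthog N only if it is
    Hom(X, orthog N) itself. *)
Lemma coef_moved y (M : 'M[F]_(n, t)) (v : 'rV_#|{: 'cV[F]_(r * n)}|) :
  y \in G -> y \notin S -> (K <= M)%MS -> (v *m j *m WU (y, 1%g)) 0 (ix U M) = 0.
Proof.
move=> Gy nSy KM; rewrite [v](dl_sum V) !mulmx_suml summxE big1 // => Mb _.
rewrite -!scalemxAl mxE jmapE (cosetv_g muU_osc) // mxE cosetv_coef.
case: (boolP (_ <= _)%MS) => [MN|]; rewrite ?mulr0 //; case/negP: nSy; apply: stab_of_orthog => //.
apply: (submx_trans (submxMr (y : 'M_t)^T KM)).
have yV : (y^-1)%g^T *m (y : 'M_t)^T = 1%:M by rewrite -trmx_mul -gl_mxM mulgV trmx1.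
have := submxMr (y : 'M_t)^T MN; rewrite mulmxBl -(mulmxA (Mb *m lift)) -(mulmxA N) yV !mulmx1 => My.
rewrite -[X in (X <= _)%MS](subrK (Mb *m lift)) addmx_sub ?lift_K //.
exact: submx_trans My isoN.
Qed.

Lemma coef_fixed (M : 'M[F]_(n, t)) Mb (v : 'rV_#|{: 'cV[F]_(r * n)}|) :
  (M - Mb *m lift <= N)%MS -> (v *m j) 0 (ix U M) = v 0 (ix V Mb).
Proof.
move=> MMb; rewrite [in LHS](dl_sum V v) !mulmx_suml summxE (bigD1 Mb) //=.
rewrite -scalemxAl mxE jmapE cosetv_coef MMb mulr1 big1 ?addr0 // => Mb' ne.
rewrite -scalemxAl mxE jmapE cosetv_coef; case: (boolP (_ <= _)%MS) => [MMb'|]; rewrite ?mulr0 //.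
case/eqP: ne; apply/eqP; rewrite -subr_eq0 -[Mb' - Mb](lift_P_K Q); apply/eqP.
apply: iqN_subP; have -> : (Mb' - Mb) *m lift = (M - Mb *m lift) - (M - Mb' *m lift).
  by rewrite mulmxBl opprB [RHS]addrC addrA subrK.
by rewrite addmx_sub ?eqmx_opp.
Qed.

Local Notation E := (@etop F p pcharFp n r V muV _ (snd_repr WV)).

Lemma coset_rep_in i : @coset_rep _ G S i \in G.
Proof.
have /rcosetsP[a Ga Da] := enum_valP i.
have : coset_rep i \in S :* a by rewrite -Da -coset_repK rcoset_refl.
case/rcosetP=> b /setIdP[Gb _] ->; exact: groupM.
Qed.

(** Apply to the relation an element h of Sp(V) and the projection onto the B0-part.
    The components v_i of the u_i are then supported on maps of full rank; the
    coefficient of v_i at such a map is, after translating by x_i^-1, the coefficient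
    of the whole relation at a generic lift of it, since by coef_moved the other
    translates do not contribute. So all v_i are zero, and the u_i by etop_killed. *)
Lemma coset_independent (u : 'I_#|rcosets S G| -> 'rV_#|{: 'cV[F]_(r * n)}|) :
  (forall i, u i *m E = u i) ->
  \sum_i u i *m j *m WU (coset_rep i, 1%g) = 0 -> forall i, u i = 0.
Proof.
move=> uE u0 i; apply: (etop_killed p_odd le_rn muV_osc (uE i)) => h Hh.
set PV := P (B0 n V) (snd_repr WV); pose v i := u i *m snd_repr WV h *m PV; rewrite -/(v i).
have supp Mb : v i 0 (ix V Mb) != 0 -> \rank Mb = r.
  move=> nz; suff gMb : 2^-1 *: (Mb *m V *m Mb^T) = B0 n V.
    have le_r : (r <= \rank (2^-1 *: (Mb *m V *m Mb^T)))%N.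
      by rewrite gMb (rank_B0 pcharFp p_odd le_rn V).
    by apply/eqP; rewrite eqn_leq rank_leq_col (leq_trans le_r) ?rank_gram_le.
  apply/eqP; apply: contraNT nz => /negbTE ng.
  have <- : v i *m PV = v i by rewrite /v -mulmxA P_idem.
  rewrite (dl_sum V (v i)) mulmx_suml summxE big1 // => M _.
  rewrite -scalemxAl (dl_P p_odd V muV_osc) ?gram_B0_sym // mxE.
  case: ifP => [gM|]; last by rewrite [X in _ * X]mxE mulr0.
  by rewrite dlE; case: eqP => [E1|]; rewrite ?mulr0 // -E1 ng in gM *.
have rel : \sum_i' v i' *m j *m WU (coset_rep i', 1%g) = 0.
  pose PU := P (B0 n V) (snd_repr WU).
  have jP : PV *m j = j *m PU.
    apply: gop_intertwine => k Hk. exact: (jmap_h p_odd Q muU_osc muV_osc Hk).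
  have WP x : x \in G -> PU *m WU (x, 1%g) = WU (x, 1%g) *m PU.
    move=> Gx; apply: gop_intertwine => k Hk.
    by rewrite [LHS]setX_reprM // [RHS]setX_reprM // !mulg1 !mul1g.
  have Wc x : x \in G -> WU (1%g, h) *m WU (x, 1%g) = WU (x, 1%g) *m WU (1%g, h).
    by move=> Gx; rewrite [LHS]setX_reprM // [RHS]setX_reprM // !mulg1 !mul1g.
  transitivity ((\sum_i u i *m j *m WU (coset_rep i, 1%g)) *m WU (1%g, h) *m PU).
    rewrite !mulmx_suml; apply: eq_bigr => i' _; have Gi := coset_rep_in i'.
    rewrite /v -(mulmxA _ PV) jP mulmxA -(mulmxA _ PU) WP // mulmxA.
    rewrite -(mulmxA (u i')) [snd_repr WV h *m j](jmap_h p_odd Q muU_osc muV_osc) //.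
    by rewrite mulmxA -(mulmxA _ (WU (1%g, h))) Wc // mulmxA.
  by rewrite u0 !mul0mx.
apply: (@eq_dl _ _ _ V) => Mb; rewrite [RHS]mxE; apply/eqP/contraT => nz.
have [M KM MMb] := generic_lift (supp _ nz); case/negP: nz.
have := congr1 (fun w => (w *m WU ((coset_rep i)^-1%g, 1%g)) 0 (ix U M)) rel.
have Wr i' : v i' *m j *m WU (coset_rep i', 1%g) *m WU ((coset_rep i)^-1%g, 1%g) =
    v i' *m j *m WU ((coset_rep i' * (coset_rep i)^-1)%g, 1%g).
  rewrite -(mulmxA _ (WU _)); congr (_ *m _).
  by rewrite [LHS]setX_reprM ?groupV ?coset_rep_in // mulg1.
rewrite mul0mx [RHS]mxE mulmx_suml summxE (eq_bigr _ (fun i' _ => congr1 (fun A : 'rV_ _ => A 0 (ix U M)) (Wr i'))).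
rewrite (bigD1 i) // mulgV big1 => [|i' /andP[_ ne]].
  by rewrite [WU _]repr_mx1 mulmx1 Monoid.mulm1 (coef_fixed _ MMb) => ->.
apply: coef_moved => //; first by rewrite groupM ?groupV ?coset_rep_in.
have := mem_coset_rep i' 1%g i.
by rewrite mulg1 coset_repK (inj_eq enum_val_inj) (negPf ne) => ->.
Qed.

End CosetIndependence.

(** * The translates span *)

(** Maschke's theorem: e is the projection along A onto an invariant complement. *)
Lemma equivariant_complement (gT : finGroupType) (G : {group gT}) d
    (rG : mx_representation algC G d) (A : 'M_d) : mxmodule rG A ->
  exists e : 'M_d, [/\ forall x, x \in G -> e *m rG x = rG x *m e, e *m e = e &
    forall k (u : 'M_(k, d)), (u *m e == 0) = (u <= A)%MS].
Proof.
move=> modA; have [B modB AB dxAB] := mx_Maschke_pchar rG (algC'G_pchar G) modA (submx1 A).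
have dxBA : (B :&: A = 0)%MS by rewrite capmxC; apply/mxdirect_addsP.
have sBA k (u : 'M_(k, d)) : (u <= B + A)%MS by rewrite addsmxC AB submx1.
exists (proj_mx B A); split=> [x Gx||k u].
- have /hom_mxP/(_ x Gx) := submx_trans (sBA _ 1%:M) (proj_mx_hom dxBA modB modA).
  by rewrite !mul1mx.
- exact: proj_mx_proj.
apply/eqP/idP => [u0|]; last exact: proj_mx_0.
by have := proj_mx_compl_sub (sBA _ u); rewrite u0 subr0.
Qed.

Section QuotientCosets.

Variables (F : finFieldType) (n t r : nat) (U : orthoSpace F t) (Q : isoQuotient U r).
Local Notation N := (iqN Q).
Local Notation PQ := (iqP Q).
Local Notation V := (iqV Q).
Local Notation K := (orthog U N).
Local Notation lift := (iq_lift Q).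
Variable Nb : 'M[F]_r.
Hypothesis isoNb : isotropic V Nb.

(** The inverse image in orthog N of a subspace of orthog N / N. *)
Definition preim_iq : 'M[F]_t := (N + Nb *m lift)%MS.

Lemma preim_iq_sub : (preim_iq <= K)%MS.
Proof. by rewrite addsmx_sub lift_K andbT; apply: iq_isotropic. Qed.

Lemma preim_iq_P : (preim_iq *m PQ <= Nb)%MS.
Proof. by rewrite addsmxMr addsmx_sub iqN_P sub0mx lift_P_K submx_refl. Qed.

Lemma preim_iqE (M : 'M[F]_(n, r)) (Y : 'M[F]_(n, t)) : (Y <= N)%MS ->
  ((M *m lift + Y)%R <= preim_iq)%MS = (M <= Nb)%MS.
Proof.
move=> YN; apply/idP/idP => [MY|MN].
  have := submx_trans (submxMr PQ MY) preim_iq_P.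
  by rewrite mulmxDl lift_P_K iqN_subP // addr0.
by rewrite addrC addmx_sub_adds // submxMr.
Qed.

(** jmap is transitive: it maps the vectors attached to a subspace of orthog N / N to
    those attached to its inverse image. *)
Lemma cosetv_jmap (M : 'M[F]_(n, r)) :
  cosetv V Nb M *m jmap n Q = cosetv U preim_iq (M *m lift).
Proof.
rewrite mulmx_suml /cosetv big_mkcond /= [RHS]big_mkcond /=.
transitivity (\sum_(Y : 'M[F]_(n, t) | (Y <= K)%MS)
    if (Y <= preim_iq)%MS then dl U (M *m lift + Y) else 0); last first.
  rewrite big_mkcond; apply: eq_bigr => Y _.
  by case: (boolP (Y <= preim_iq)%MS) => [H|]; rewrite ?if_same // (submx_trans H preim_iq_sub).
rewrite sum_orthog; apply: eq_bigr => Mb _.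
rewrite (eq_bigr (fun Y : 'M_(n, t) => if (Mb <= Nb)%MS then dl U ((M + Mb) *m lift + Y) else 0)).
  by case: ifP => _; [rewrite jmapE | rewrite big1].
by move=> Y YN; rewrite preim_iqE // mulmxDl addrA.
Qed.

Lemma preim_iq_orthog k (A : 'M[F]_(k, t)) :
  (A <= K)%MS -> (A *m PQ <= orthog V Nb)%MS -> (A <= orthog U preim_iq)%MS.
Proof.
move=> AK AN; apply/orthogP; rewrite -(iq_formE AK preim_iq_sub).
exact: orthog_sub AN preim_iq_P.
Qed.

Lemma preim_iq_isotropic : isotropic U preim_iq.
Proof.
by apply: preim_iq_orthog preim_iq_sub _; apply: submx_trans preim_iq_P isoNb.
Qed.

Lemma preim_iq_rank : Nb != 0 -> (\rank N < \rank preim_iq)%N.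
Proof.
move=> nz; have NN : (N <= preim_iq)%MS by apply: addsmxSl.
rewrite (ltn_leqif (mxrank_leqif_sup NN)); apply: contra nz => sN.
have /submx_trans/(_ sN) : (Nb *m lift <= preim_iq)%MS by apply: addsmxSr.
by move/iqN_subP; rewrite lift_P_K => ->.
Qed.

End QuotientCosets.

Section Spanning.

Variables (F : finFieldType) (p : nat) (pcharFp : p \in [pchar F]).
Hypothesis p_odd : odd p.
Variable mu : forall m : nat, mx_representation algC (Sp F m) #|{: 'cV[F]_m}|.
Hypothesis mu_osc : forall m : nat, oscillator pcharFp (mu m).
Variables (n t : nat) (le_tn : (t <= n)%N) (U : orthoSpace F t).
Variable Q : forall r : wittT U, isoQuotient U (wittV r).
Local Notation G := (Ogrp U).
Local Notation H := (Sp F n).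
Local Notation WU := (howe_repr U (mu (t * n))).
Local Notation Wq r := (howe_repr (iqV (Q r)) (mu (wittV r * n))).
Local Notation Eq r f := (etop pcharFp (iqV (Q r)) (mu (wittV r * n)) f).
Local Notation jq r := (jmap n (Q r)).

Lemma le_wittV (r : wittT U) : (wittV r <= t)%N.
Proof. by rewrite -ltnS; apply: ltn_ord. Qed.

Let le_rn (r : wittT U) : (wittV r <= n)%N.
Proof. exact: leq_trans (le_wittV r) le_tn. Qed.

(** The sum, over all r, of the translates by O(U) of the image under jmap of the
    sum of the eta(tau) in L^2(Hom(X, U_r)). *)
Definition theta_span : 'M[algC]_#|{: 'cV[F]_(t * n)}| :=
  (\sum_(r : wittT U) \sum_(x in G)
     <<Eq r (snd_repr (Wq r)) *m jq r *m WU (x, 1%g)>>)%MS.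
Local Notation A := theta_span.

Lemma theta_span_sub k (B : 'M_(k, _)) r x : x \in G ->
  (B <= Eq r (snd_repr (Wq r)) *m jq r *m WU (x, 1%g))%MS -> (B <= A)%MS.
Proof.
move=> Gx BE; apply: (sumsmx_sup r) => //; apply: (sumsmx_sup x) => //.
by rewrite genmxE.
Qed.

Lemma theta_span_stable g h : g \in G -> h \in H -> (A *m WU (g, h) <= A)%MS.
Proof.
move=> Gg Hh; rewrite sumsmxMr; apply/sumsmx_subP=> r _.
rewrite sumsmxMr; apply/sumsmx_subP=> x Gx.
rewrite (eqmxMr _ (genmxE _)) -[X in (X <= _)%MS]mulmxA.
have -> : WU (x, 1%g) *m WU (g, h) = WU (1%g, h) *m WU ((x * g)%g, 1%g).
  by rewrite [LHS]setX_reprM // [RHS]setX_reprM ?groupM // !mulg1 !mul1g.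
apply: (theta_span_sub (r := r) (groupM Gx Gg)); rewrite mulmxA submxMr //.
rewrite -[X in (X <= _)%MS]mulmxA -(jmap_h p_odd (Q r) (mu_osc _) (mu_osc _) Hh) !mulmxA submxMr //.
by rewrite -[_ *m Wq r _](etop_commH _ _ _ Hh) submxMl.
Qed.

(** An isotropic subspace has dimension at most t / 2, and a chosen one exists in each
    dimension that occurs. *)
Lemma isotropic_witt (N : 'M[F]_t) : isotropic U N ->
  exists r : wittT U, \rank (iqN (Q r)) = \rank N.
Proof.
move=> isoN; have le2 : (2 * \rank N <= t)%N.
  have := mxrankS isoN; rewrite mxrank_ker eqmxMfull; last first.
    by rewrite row_full_unit gram_unitmx.
  by rewrite mxrank_tr; have := rank_leq_col N; lia.
have wr : (inord (t - 2 * \rank N) : 'I_t.+1) \in witt_ranks U.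
  rewrite inE; apply/existsP; exists N; rewrite isoN inordK ?ltnS ?leq_subr //.
  by rewrite subnK ?eqxx.
pose r : wittT U := exist (fun i : 'I_t.+1 => i \in witt_ranks U) _ wr; exists r.
have := iq_dim (Q r); rewrite {1}/wittV /= inordK ?ltnS ?leq_subr //; lia.
Qed.

(** The functions on Hom(X, U_r) which jmap sends into the span are the kernel of an
    idempotent e commuting with Sp(V). It kills the dl M with M of rank r, by dl_etop,
    and the cosetv N M with N non-zero, by the induction hypothesis for the inverse
    images of the N; hence e = e * e = 0. *)
Lemma theta_span_step r :
  (forall (N : 'M[F]_t) (M : 'M[F]_(n, t)), isotropic U N ->
    (\rank (iqN (Q r)) < \rank N)%N -> (M <= orthog U N)%MS ->
    (cosetv U N M <= A)%MS) ->
  (jq r <= A)%MS.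
Proof.
move=> IH; pose A' := kermx (jq r *m cokermx A).
have A'P k (u : 'M_(k, _)) : (u <= A')%MS = (u *m jq r <= A)%MS.
  by rewrite [RHS]submxE -mulmxA; apply/sub_kermxP/eqP.
have modA' : mxmodule (snd_repr (Wq r)) A'.
  apply/mxmoduleP=> h Hh; rewrite A'P -mulmxA.
  rewrite [snd_repr _ h *m _](jmap_h p_odd (Q r) (mu_osc _) (mu_osc _) Hh) mulmxA.
  apply: submx_trans (theta_span_stable (group1 _) Hh).
  by rewrite submxMr // -A'P.
have [e [eC ee eA]] := equivariant_complement modA'.
rewrite -[jq r]mul1mx -A'P -eA mul1mx -ee; apply/eqP.
apply: (commutant_square_zero p_odd (le_rn r) (mu_osc _)) => [h Hh|M rM|N M isoN nzN MN]; first exact: eC.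
  apply/eqP; rewrite eA A'P -(dl_etop p_odd (le_rn r) _ (mu_osc _) rM).
  apply: (theta_span_sub (group1 G)); rewrite repr_mx1 mulmx1 -[X in (X <= _)%MS]mulmxA; exact: submxMl.
apply/eqP; rewrite eA A'P cosetv_jmap; apply: IH (preim_iq_isotropic isoN) _ _.
  exact: preim_iq_rank.
by rewrite preim_iq_orthog ?lift_K ?lift_P_K.
Qed.

(** By descending induction on the dimension of N; the case of one N implies that of
    all its translates under O(U), so by Witt_transitive N can be the chosen one. *)
Lemma cosetv_span (N : 'M[F]_t) (M : 'M[F]_(n, t)) : isotropic U N ->
  (M <= orthog U N)%MS -> (cosetv U N M <= A)%MS.
Proof.
have [m] := ubnP (t - \rank N); elim: m N M => // m IH N M ltm isoN MN.
have [r rr] := isotropic_witt isoN.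
have [g Gg Ng] := Witt_transitive (two_neq0 pcharFp p_odd) isoN (iq_isotropic (Q r)) (esym rr).
have ug : (g : 'M_t)^T \in unitmx by rewrite unitmx_tr gl_unitmx.
have jA : (jq r <= A)%MS.
  apply: theta_span_step => N' M' isoN' lt_rk MN'; apply: IH MN' => //.
  by have := rank_leq_col N; have := rank_leq_col N'; lia.
have Mg : (M *m (g : 'M_t)^T <= orthog U (iqN (Q r)))%MS.
  apply/orthogP; have /submxP[D ->] : (iqN (Q r) <= N *m (g : 'M_t)^T)%MS by rewrite Ng.
  by rewrite trmx_mul mulmxA isometry_form // (orthogP _ _ _ MN) mul0mx.
have cA : (cosetv U (iqN (Q r)) (M *m (g : 'M_t)^T) <= A)%MS.
  by rewrite -cosetv_lift // -jmapE; apply: submx_trans (submxMl _ _) jA.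
have := submx_trans (submxMr (WU (g, 1%g)) cA) (theta_span_stable Gg (group1 H)).
rewrite (cosetv_g (mu_osc _)) // (eqmx_scale _ (ell_neq0 _)).
have gV : (g : 'M_t)^T *m (g^-1 : GLmx F t)%g^T = 1%:M.
  by rewrite -trmx_mul -gl_mxM mulVg trmx1.
rewrite (@cosetv_eq _ _ _ U _ N _ M) //.
  by apply: eqmx_trans (eqmxMr _ (eqmx_sym Ng)) _; rewrite -mulmxA gV mulmx1.
by rewrite -mulmxA gV mulmx1 subrr sub0mx.
Qed.

(** The basis vectors are the cosetv N M with N = 0. *)
Theorem theta_span_full : (1%:M <= A)%MS.
Proof.
apply/row_subP=> i; have [M ->] := ixP U i; rewrite row1.
have -> : delta_mx 0 (ix U M) = cosetv U 0 M.
  rewrite /cosetv (big_pred1 0) ?addr0 // => Y.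
  by rewrite submx0.
by apply: cosetv_span; rewrite ?/isotropic ?sub0mx //; apply/orthogP; rewrite trmx0 mulmx0.
Qed.

End Spanning.

(** * The trace of one summand *)

Section InducedTrace.

Variables (F : finFieldType) (p : nat) (pcharFp : p \in [pchar F]).
Hypothesis p_odd : odd p.
Variables (n t r : nat) (le_tn : (t <= n)%N) (U : orthoSpace F t) (Q : isoQuotient U r).
Local Notation V := (iqV Q).
Variable muU : mx_representation algC (Sp F (t * n)) #|{: 'cV[F]_(t * n)}|.
Hypothesis muU_osc : oscillator pcharFp muU.
Variable muV : mx_representation algC (Sp F (r * n)) #|{: 'cV[F]_(r * n)}|.
Hypothesis muV_osc : oscillator pcharFp muV.
Local Notation WU := (howe_repr U muU).
Local Notation WV := (howe_repr V muV).
Local Notation j := (jmap n Q).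
Local Notation G := (Ogrp U).
Local Notation S := (iq_stab_group Q).
Local Notation H := (Sp F n).
Local Notation x_ i := (@coset_rep _ G S i).
Local Notation e f := (@etop F p pcharFp n r V muV _ f).
Local Notation eta := (@eta_irr F p pcharFp r V n muV).

Let le_rn : (r <= n)%N.
Proof. by apply: leq_trans le_tn; rewrite [t](iq_dim' Q) leq_addr. Qed.

Let E := e (snd_repr WV).
Let b := row_base E.

Lemma iq_act_in s : s \in S -> iq_act Q s \in Ogrp V.
Proof.
by move=> Ss; move/subsetP: (iq_act_sub Q) => /(_ s Ss) /setIdP[_]; rewrite inE.
Qed.

Lemma stab_in s : s \in S -> s \in G. Proof. by case/setIdP. Qed.

Let EE : E *m E = E. Proof. exact: etop_idem. Qed.

Let bE : b *m E = b.
Proof.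
have /submxP[D ->] : (b <= E)%MS by rewrite eq_row_base.
by rewrite -mulmxA EE.
Qed.

Let bfree : row_free b. Proof. exact: row_base_free. Qed.

Lemma jmap_etop : j *m e (snd_repr WU) = E *m j.
Proof.
apply/esym/etop_intertwine => h Hh.
by have := jmap_h p_odd Q muU_osc muV_osc Hh.
Qed.

Lemma etop_commW g : g \in G ->
  e (snd_repr WU) *m WU (g, 1%g) = WU (g, 1%g) *m e (snd_repr WU).
Proof.
move=> Gg; apply: etop_intertwine => k Hk.
by rewrite [LHS]setX_reprM // [RHS]setX_reprM // !mulg1 !mul1g.
Qed.

Lemma etop_commV a h : a \in Ogrp V -> h \in H -> E *m WV (a, h) = WV (a, h) *m E.
Proof.
move=> Ga Hh; have -> : WV (a, h) = WV (a, 1%g) *m WV (1%g, h).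
  by rewrite setX_reprM ?group1 // mulg1 mul1g.
rewrite mulmxA -etop_commG // -!mulmxA; congr (_ *m _).
by rewrite [RHS](etop_commH pcharFp V muV Hh).
Qed.

(** The blocks are bases of the translates of the image of jmap. *)
Let B : 'M_(\sum_(i < #|rcosets S G|) \rank E, #|{: 'cV[F]_(t * n)}|) :=
  \mxcol_i (b *m j *m WU (x_ i, 1%g)).

Let B_free : row_free B.
Proof.
apply: inj_row_free => v; rewrite -[v]submxrowK mul_mxrow_mxcol => v0.
suff v_0 i : submxrow v i = 0.
  by apply/mxrowP=> i; rewrite mxrowK v_0 submxrow0.
have u0 : \sum_i submxrow v i *m b *m j *m WU (x_ i, 1%g) = 0.
  by rewrite -[RHS]v0; apply: eq_bigr => k _; rewrite !mulmxA.
have uE k : submxrow v k *m b *m E = submxrow v k *m b by rewrite -mulmxA bE.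
have /eqP := coset_independent p_odd le_tn muU_osc muV_osc uE u0 i.
by rewrite mulmx_free_eq0 // => /eqP.
Qed.

Let B_i i : (b *m j *m WU (x_ i, 1%g) <= B)%MS.
Proof.
apply/submxP; exists (\mxrow_k (if k == i then 1%:M else 0)).
rewrite mul_mxrow_mxcol (bigD1 i) //= eqxx mul1mx big1 ?addr0 // => k /negPf ->.
by rewrite mul0mx.
Qed.

Let coset_dec x : x \in G -> exists2 i, exists2 s, s \in S & x = (s * x_ i)%g
  & forall k, ((x * (x_ k)^-1)%g \in S) = (k == i).
Proof.
move=> Gx; have Cx : S :* x \in rcosets S G by apply/rcosetsP; exists x.
have Di := enum_rankK_in Cx Cx; set i := enum_rank_in _ _ in Di; exists i.
  exists (x * (x_ i)^-1)%g; last by rewrite mulgKV.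
  by rewrite -mem_rcoset coset_repK Di rcoset_refl.
move=> k; rewrite -mem_rcoset (sameP rcoset_eqP eqP) coset_repK -Di.
by rewrite (inj_eq enum_val_inj) eq_sym.
Qed.

Lemma jmap_move s x h : s \in S -> x \in G -> h \in H ->
  j *m WU ((s * x)%g, h) = WV (iq_act Q s, h) *m j *m WU (x, 1%g).
Proof.
move=> Ss Gx Hh; rewrite (jmap_intertwine p_odd muU_osc muV_osc Ss Hh).
by rewrite -mulmxA setX_reprM ?(stab_in Ss) // mulg1.
Qed.

Let B_mul : B *m e (snd_repr WU) = B.
Proof.
rewrite mxcol_mul; apply/eq_mxcol=> i.
rewrite -mulmxA -etop_commW ?coset_rep_in // mulmxA -(mulmxA b) jmap_etop.
by rewrite !mulmxA bE.
Qed.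

Hypothesis e_span : (e (snd_repr WU) <= \sum_(x in G) <<E *m j *m WU (x, 1%g)>>)%MS.

Let e_sub : (e (snd_repr WU) <= B)%MS.
Proof.
apply: submx_trans e_span _; apply/sumsmx_subP=> x Gx; rewrite genmxE.
have [i [s Ss ->] _] := coset_dec Gx.
rewrite -[X in (X <= _)%MS]mulmxA jmap_move ?coset_rep_in // !mulmxA.
rewrite etop_commV ?iq_act_in // -!mulmxA.
apply: submx_trans (submxMl _ _) (submx_trans _ (B_i i)); rewrite !mulmxA.
by rewrite -!(mulmxA _ j) submxMr // eq_row_base.
Qed.

(** The rows of B are a basis of the image of the projection e, and (g, h) acts in this
    basis by a block matrix T of the same shape as that of the induced
    representation; on the diagonal blocks the trace is given by trace_etop. *)
Lemma trace_summand g h : g \in G -> h \in H ->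
  \tr (WU (g, h) *m e (snd_repr WU)) =
  \sum_tau \tr (ind_repr G (iq_repr 'Chi_tau) g) * 'chi_(eta tau) h.
Proof.
move=> Gg Hh.
have [X eX] := submxP e_sub.
have BX : B *m X = 1%:M.
  by apply: (row_free_inj B_free); rewrite -mulmxA -eX B_mul mul1mx.
have [Y EY] : exists Y, E = Y *m b by apply/submxP; rewrite eq_row_base.
have bY : b *m Y = 1%:M by apply: (row_free_inj bfree); rewrite -mulmxA -EY bE mul1mx.
pose T := \mxblock_(i, k) (if (x_ i * g * (x_ k)^-1)%g \in S
  then b *m WV (iq_act Q (x_ i * g * (x_ k)^-1)%g, h) *m Y else 0).
have BW : B *m WU (g, h) = T *m B.
  rewrite mul_mxblock_mxrow mxcol_mul; apply/eq_mxcol=> i.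
  have [k [s Ss Ds] Hk] := coset_dec (groupM (coset_rep_in i) Gg).
  rewrite (bigD1 k) // big1 => [|l /andP[_ nel]]; last by rewrite Hk (negPf nel) mul0mx.
  rewrite Hk eqxx Monoid.mulm1 Ds mulgK.
  rewrite -[LHS]mulmxA setX_reprM ?coset_rep_in ?group1 // mul1g Ds -mulmxA jmap_move ?coset_rep_in //.
  have bW : b *m WV (iq_act Q s, h) = b *m WV (iq_act Q s, h) *m Y *m b.
    by rewrite -[RHS]mulmxA -EY -[RHS]mulmxA -etop_commV ?iq_act_in // mulmxA bE.
  by rewrite [RHS]mulmxA (mulmxA _ b j) -bW [LHS]mulmxA (mulmxA b).
rewrite mxtrace_mulC eX (trace_image BX BW) mxtrace_mxblock.
transitivity (\sum_i \sum_tau \tr (let s := (x_ i * g * (x_ i)^-1)%g in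
  if s \in S then iq_repr 'Chi_tau s else 0) * 'chi_(eta tau) h); last first.
  rewrite exchange_big; apply: eq_bigr => tau _ /=.
  by rewrite mxtrace_mxblock mulr_suml.
apply: eq_bigr => i _ /=; case: ifP => [Ss|_]; last first.
  by rewrite mxtrace0 big1 // => tau _; rewrite mxtrace0 mul0r.
rewrite -mulmxA mxtrace_mulC -mulmxA -EY trace_etop ?iq_act_in //.
apply: eq_bigr => tau _; congr (_ * _).
by rewrite -irrRepr cfunE iq_act_in.
Qed.

End InducedTrace.

(** * The decomposition *)

Section Decomposition.

Variables (F : finFieldType) (p : nat) (pcharFp : p \in [pchar F]).
Hypothesis p_odd : odd p.
Variable mu : forall m : nat, mx_representation algC (Sp F m) #|{: 'cV[F]_m}|.
Hypothesis mu_osc : forall m : nat, oscillator pcharFp (mu m).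
Variables (n t : nat) (le_tn : (t <= n)%N) (U : orthoSpace F t).
Variable Q : forall r : wittT U, isoQuotient U (wittV r).
Local Notation G := (Ogrp U).
Local Notation H := (Sp F n).
Local Notation WU := (howe_repr U (mu (t * n))).
Local Notation Wq r := (howe_repr (iqV (Q r)) (mu (wittV r * n))).
Local Notation Eq r f := (etop pcharFp (iqV (Q r)) (mu (wittV r * n)) f).
Local Notation jq r := (jmap n (Q r)).
Local Notation eta r tau :=
  (@eta_irr F p pcharFp (wittV r) (iqV (Q r)) n (mu (wittV r * n)) tau).

Let le_rn (r : wittT U) : (wittV r <= n)%N.
Proof. exact: leq_trans (le_wittV r) le_tn. Qed.

Lemma eta_rank r tau : rep_rank pcharFp 'Chi_(eta r tau) = wittV r.
Proof. by have [] := eta_spec p_odd (le_rn r) (mu_osc _) tau. Qed.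

(** The rank of eta(tau) determines r. *)
Lemma eta_witt r r' tau tau' : eta r tau = eta r' tau' -> r = r'.
Proof.
move=> e; apply/val_inj/val_inj; rewrite -[LHS]/(wittV r) -[RHS]/(wittV r').
by rewrite -(eta_rank tau) -(eta_rank tau') e.
Qed.

Lemma etop_orthogonal d (rG : mx_representation algC H d) r r' :
  Eq r rG *m Eq r' rG = if r == r' then Eq r rG else 0.
Proof.
case: eqVneq => [<-|ne]; first exact: (etop_idem p_odd (le_rn r) _ (mu_osc _)).
rewrite mulmx_suml big1 // => tau _; rewrite mulmx_sumr big1 // => tau' _.
by rewrite eopM ifF //; apply: contraNF ne => /eqP/eta_witt ->.
Qed.

Lemma etop_summand r r' x : x \in G ->
  Eq r' (snd_repr (Wq r')) *m jq r' *m WU (x, 1%g) *m Eq r (snd_repr WU) =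
  if r' == r then Eq r' (snd_repr (Wq r')) *m jq r' *m WU (x, 1%g) else 0.
Proof.
move=> Gx; rewrite -mulmxA.
have -> : WU (x, 1%g) *m Eq r (snd_repr WU) = Eq r (snd_repr WU) *m WU (x, 1%g).
  apply/esym/etop_intertwine => k Hk.
  by rewrite [LHS]setX_reprM // [RHS]setX_reprM // !mulg1 !mul1g.
rewrite mulmxA -(mulmxA _ (jq r')).
have -> : jq r' *m Eq r (snd_repr WU) = Eq r (snd_repr (Wq r')) *m jq r'.
  by apply/esym/etop_intertwine => k Hk; apply: (jmap_h p_odd _ (mu_osc _) (mu_osc _)).
by rewrite mulmxA etop_orthogonal; case: ifP; rewrite ?mul0mx.
Qed.

Lemma etop_span r : (Eq r (snd_repr WU) <= \sum_(x in G)
  <<Eq r (snd_repr (Wq r)) *m jq r *m WU (x, 1%g)>>)%MS.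
Proof.
have /(submxMr (Eq r (snd_repr WU))) := theta_span_full p_odd mu_osc le_tn Q.
rewrite mul1mx => /submx_trans; apply; rewrite sumsmxMr; apply/sumsmx_subP=> r' _.
rewrite sumsmxMr; apply/sumsmx_subP=> x Gx; rewrite (eqmxMr _ (genmxE _)) etop_summand //.
case: eqP => [->|_]; last exact: sub0mx.
by apply: (sumsmx_sup x); rewrite ?genmxE.
Qed.

(** The sum fixes each of the translates, which span. *)
Lemma sum_etop : \sum_r Eq r (snd_repr WU) = 1%:M.
Proof.
apply/esym/eqP; rewrite -subr_eq0 -[X in X == _]mul1mx; apply/eqP/sub_kermxP.
apply: submx_trans (theta_span_full p_odd mu_osc le_tn Q) _.
apply/sumsmx_subP=> r' _; apply/sumsmx_subP=> x Gx; rewrite genmxE; apply/sub_kermxP.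
rewrite mulmxBr mulmx1 [X in _ - X]mulmx_sumr (bigD1 r') // etop_summand // eqxx.
rewrite big1 => [|r /andP[_ ne]]; first by rewrite Monoid.mulm1 subrr.
by rewrite etop_summand // eq_sym (negPf ne).
Qed.

Lemma trace_howe g h : g \in G -> h \in H -> \tr (WU (g, h)) =
  \sum_r \sum_tau \tr (ind_repr G (iq_repr (Q := Q r) 'Chi_tau) g) * 'chi_(eta r tau) h.
Proof.
move=> Gg Hh; rewrite -[LHS](congr1 mxtrace (mulmx1 _)) -sum_etop mulmx_sumr raddf_sum.
apply: eq_bigr => r _.
exact: (trace_summand p_odd le_tn (mu_osc _) (mu_osc _) (etop_span r)).
Qed.

End Decomposition.

Theorem mainTheorem2 (F : finFieldType) (p : nat) (pcharFp : p \in [pchar F])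
  (p_odd : odd p)
  (mu : forall m : nat, mx_representation algC (Sp F m) #|{: 'cV[F]_m}|)
  (mu_osc : forall m : nat, oscillator pcharFp (mu m))
  (n t : nat) (le_tn : (t <= n)%N) (U : orthoSpace F t)
  (Q : forall r : wittT U, isoQuotient U (wittV r)) :
  let etaQ (r : wittT U) (tau : Iirr (Ogrp (iqV (Q r)))) : Iirr (Sp F n) :=
    eta_irr pcharFp (mu (wittV r * n)%N) tau in
  mx_rsim (howe_repr U (mu (t * n)%N))
    (\big[dadd_grepr/grepr0]_(r : wittT U)
      \big[dadd_grepr/grepr0]_(tau : Iirr (Ogrp (iqV (Q r))))
        Representation
          (outer_repr (ind_repr (Ogrp U) (iq_repr 'Chi_tau))
                      'Chi_(etaQ r tau)))
  /\
  (forall a b : {r : wittT U & Iirr (Ogrp (iqV (Q r)))},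
     a <> b ->
     ~ mx_rsim 'Chi_(etaQ (tag a) (tagged a)) 'Chi_(etaQ (tag b) (tagged b))).
Proof.
move=> etaQ; split.
  apply: cfRepr_inj; rewrite cfRepr_dsum; apply/cfun_inP=> -[g h] /setXP[/= Gg Hh].
  rewrite cfunE setX_mem // mulr1n sum_cfunE.
  rewrite [LHS](trace_howe p_odd mu_osc le_tn Q Gg Hh); apply: eq_bigr => r _.
  rewrite cfRepr_dsum sum_cfunE; apply: eq_bigr => tau _.
  rewrite cfunE setX_mem // mulr1n /= mxtrace_prod; congr (_ * _).
  by rewrite -irrRepr cfunE Hh mulr1n.
move=> [r tau] [r' tau'] neq /= /cfRepr_sim; rewrite !irrRepr => /irr_inj e.
have rr := eta_witt p_odd mu_osc le_tn e; subst r'.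
have le_rn : (wittV r <= n)%N := leq_trans (le_wittV r) le_tn.
by apply: neq; rewrite (eta_inj p_odd le_rn (mu_osc _) e).
Qed.
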